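(* Let $\mathcal O\subseteq\mathbb R^d$ be open and let $M$ be a Lévy-valued random measure on $\mathscr B_b(\mathcal O)$. For $t\ge0$ let $$J_{\mathcal D}(t):\mathcal D(\mathcal O)\to L^0(\Omega,P),\qquad J_{\mathcal D}(t)f=\int_{\mathcal O}f(x)\,M(t,\mathrm dx).$$ Then there exists a genuine Lévy process $(Y(t):t\ge0)$ in $\mathcal D^*(\mathcal O)$ satisfying $$\langle f,Y(t)\rangle=J_{\mathcal D}(t)f\qquad\text{for all }f\in\mathcal D(\mathcal O),\ t\ge0.$$
   Context: Fix a probability space $(\Omega,\mathcal A,P)$; $L^0(\Omega,P)$ is the space of $P$-equivalence classes of real-valued random variables with convergence in probability. $B_{\mathbb R}=[-1,1]$. For a Borel set $\mathcal O\subseteq\mathbb R^d$, $\mathscr B(\mathcal O)$ is its Borel $\sigma$-algebra and $\mathscr B_b(\mathcal O)=\{A\in\mathscr B(\mathcal O): A\text{ is relatively compact}\}$. An infinitely divisible random measure on $\mathscr B_b(\mathcal O)$ is a map $M:\mathscr B_b(\mathcal O)\to L^0(\Omega,P)$ such that for each collection of disjoint sets $A_1,A_2,\ldots\in\mathscr B_b(\mathcal O)$: (a) $M(A_1),M(A_2),\ldots$ are independent; (b) if $\bigcup_kA_k\in\mathscr B_b(\mathcal O)$ then $M(\bigcup_kA_k)=\sum_kM(A_k)$ $P$-a.s.; and (c) $M(A)$ is infinitely divisible for each $A\in\mathscr B_b(\mathcal O)$. A Lévy-valued random measure on $\mathscr B_b(\mathcal O)$ is a family $(M(t):t\ge0)$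 of infinitely divisible random measures on $\mathscr B_b(\mathcal O)$ such that for all $n$ and $A_1,\dots,A_n\in\mathscr B_b(\mathcal O)$ the process $((M(t)(A_1),\dots,M(t)(A_n)):t\ge0)$ is a Lévy process in $\mathbb R^n$; write $M(t,A)=M(t)(A)$. Characteristics and control measure of $M$: there are a signed measure $\gamma$ on $\mathscr B_b(\mathcal O)$, a measure $\Sigma$ on $\mathscr B_b(\mathcal O)$ and a $\sigma$-finite measure $\nu$ on $\mathscr B(\mathcal O\times\mathbb R)$ such that $M(1,A)$ has Lévy–Khintchine characteristics $(\gamma(A),\Sigma(A),\nu(A\times\cdot))$ (truncation $y\mathbf 1_{B_{\mathbb R}}(y)$) for each $A\in\mathscr B_b(\mathcal O)$. The control measure is $\lambda(A)=\|\gamma\|_{\mathrm{TV}}(A)+\Sigma(A)+\int_{\mathbb R}(|y|^2\wedge1)\,\nu(A,\mathrm dy)$, where $\|\gamma\|_{\mathrm{TV}}$ and $\Sigma$ are extended to $\sigma$-finite measures on $\mathscr B(\mathcal O)$. Integral: for a simple function $f=\sum_{k=1}^n\alpha_k\mathbf 1_{A_k}$ with $\alpha_k\in\mathbb R$ and pairwise disjoint $A_k\in\mathscr B_b(\mathcal O)$, $\int_Af(x)\,M(t,\mathrm dx):=\sum_k\alpha_kM(t,A\cap A_k)$ for $A\in\mathscr B(\mathcal O)$. A measurable $f:\mathcal O\to\mathbb R$ is $M$-integrable if there are simple $f_n\to f$ $\lambda$-a.e. such that $\int_Af_n(x)\,M(t,\mathrm dx)$ converges in probability for all $A\in\mathscr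 B(\mathcal O)$, $t\ge0$; then $\int_Af(x)\,M(t,\mathrm dx)$ is the limit in probability. All $f\in\mathcal D(\mathcal O)$ are $M$-integrable, so $J_{\mathcal D}(t)$ is well defined. $\mathcal D(\mathcal O)$ is the space of infinitely differentiable functions with compact support in $\mathcal O$, with the strict inductive limit topology of the Fréchet spaces $\mathcal D(K_i)=\{f\in C^\infty(\mathbb R^d):\mathrm{supp}(f)\subseteq K_i\}$, for a strictly increasing sequence of compacts $K_i$ with $\bigcup_iK_i=\mathcal O$. $\mathcal D^*(\mathcal O)$ is its topological dual with the strong topology. A genuine Lévy process in $\mathcal D^*(\mathcal O)$ is a Lévy process in the usual sense (starting at $0$, with independent and stationary increments and stochastically continuous) whose values $Y(t)$ are $\mathcal D^*(\mathcal O)$-valued random variables (as opposed to a merely cylindrical process). *)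

(* Defs.v *)
From HB Require Import structures.
From mathcomp Require Import all_boot all_order all_algebra.
From mathcomp Require Import all_classical all_reals all_analysis.

Set Implicit Arguments.
Unset Strict Implicit.
Unset Printing Implicit Defensive.

Import Order.TTheory GRing.Theory Num.Theory.
Import numFieldNormedType.Exports.

Local Open Scope classical_set_scope.
Local Open Scope ring_scope.

Section bounded.
Context (R : realType) (V : preTopologicalLmodType R).

Definition vn_bounded (B : set V) : Prop :=
  forall W : set V, nbhs 0 W ->
    exists2 r : R, 0 < r & forall a : R, r <= `|a| -> B `<=` [set a *: v | v in W].

Lemma vn_bounded0 : vn_bounded set0.
Proof. by move=> W _; exists 1 => // a _ v. Qed.

Lemma vn_boundedU (A B : set V) :
  vn_bounded A -> vn_bounded B -> vn_bounded (A `|` B).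
Proof.
move=> bA bB W W0; have [r r0 rA] := bA _ W0; have [s s0 sB] := bB _ W0.
exists (Num.max r s); first by rewrite lt_max r0.
move=> a; rewrite ge_max => /andP[ra sa] v [Av|Bv]; first exact: rA Av.
exact: sB Bv.
Qed.

End bounded.

Section strong_dual.
Context (R : realType) (V : preTopologicalLmodType R).

Definition dual_pred : {pred V -> R} :=
  fun phi => `[< scalar phi /\ continuous phi >].

Record strong_dual := StrongDual {
  dual_fun :> V -> R;
  _ : dual_fun \in dual_pred }.

HB.instance Definition _ := [isSub of strong_dual for dual_fun].
HB.instance Definition _ := gen_eqMixin strong_dual.
HB.instance Definition _ := [Choice of strong_dual by <:].

Lemma dual_pred_submod : submod_closed dual_pred.
Proof.
split.
  by apply/asboolP; split=> [a u v /=|x]; [rewrite /= mulr0 addr0|exact: cvg_cst].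
move=> a phi psi /asboolP[lphi cphi] /asboolP[lpsi cpsi].
apply/asboolP; split=> [b u v|x].
  have e x : (a *: phi + psi) x = a * phi x + psi x by [].
  by rewrite !e lphi lpsi !mulrDr addrACA mulrCA.
by apply: cvgD (cpsi x); apply: cvgZl_tmp; exact: cphi.
Qed.

HB.instance Definition _ :=
  GRing.isSubmodClosed.Build R (V -> R) dual_pred dual_pred_submod.
HB.instance Definition _ := [SubChoice_isSubLmodule of strong_dual by <:].

(* Topology of uniform convergence on the bounded subsets of [V]. *)
Definition strong_open (U : set strong_dual) : Prop :=
  forall phi, U phi -> exists B (e : R), [/\ vn_bounded B, 0 < e &
    [set psi : strong_dual | forall v, B v -> `|psi v - phi v| <= e] `<=` U].

Lemma strong_openT : strong_open setT.
Proof. by move=> phi _; exists set0, 1; split=> //; exact: vn_bounded0. Qed.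

Lemma strong_openI : setI_closed strong_open.
Proof.
move=> U1 U2 oU1 oU2 phi [/oU1[B1 [e1 [b1 e10 s1]]] /oU2[B2 [e2 [b2 e20 s2]]]].
exists (B1 `|` B2), (Num.min e1 e2); split; first exact: vn_boundedU.
  by rewrite lt_min e10.
move=> psi /= h; split; [apply: s1|apply: s2] => v Bv;
  apply: (le_trans (h v _)); rewrite ?ge_min ?lexx ?orbT //; by [left|right].
Qed.

Lemma strong_open_bigU (I : Type) (f : I -> set strong_dual) :
  (forall i, strong_open (f i)) -> strong_open (\bigcup_i f i).
Proof.
move=> of_ phi [i _ /(of_ i)[B [e [bB e0 s]]]]; exists B, e; split=> //.
by apply: subset_trans s _ => psi fpsi; exists i.
Qed.

HB.instance Definition _ := isOpenTopological.Build strong_dual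
  strong_openT strong_openI strong_open_bigU.

End strong_dual.

Section smooth.
Context (R : realType) (d : nat).
Local Notation E := 'rV[R]_d.

Definition iter_partial (s : seq 'I_d) (f : E -> R) : E -> R :=
  foldr (fun i g x => 'D_(delta_mx 0 i) g x) f s.

Definition smooth (f : E -> R) : Prop :=
  forall s : seq 'I_d, continuous (iter_partial s f) /\
    forall i x, derivable (iter_partial s f) x (delta_mx 0 i).

Definition tsupport (f : E -> R) : set E := closure [set x | f x != 0].

Lemma iter_partialP s a (f g : E -> R) : smooth f -> smooth g ->
  iter_partial s (a *: f + g) = a *: iter_partial s f + iter_partial s g.
Proof.
move=> sf sg; elim: s => [//|i s IHs]; apply/funext => x.
have [_ df] := sf s; have [_ dg] := sg s.
rewrite [LHS]/= -/(iter_partial s _) IHs deriveD//; last exact: derivableZ.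
by rewrite deriveZ.
Qed.

Lemma smooth0 : smooth 0.
Proof.
have e s : iter_partial s 0 = 0 :> (E -> R).
  elim: s => [//|i s IHs]; apply/funext => x.
  by rewrite [LHS]/= -/(iter_partial s _) IHs derive_cst.
move=> s; rewrite e; split=> [x|i x]; first exact: (@cst_continuous E R (0 : R)).
exact: (derivable_cst (0 : R)).
Qed.

Lemma smoothP a (f g : E -> R) : smooth f -> smooth g -> smooth (a *: f + g).
Proof.
move=> sf sg s; rewrite iter_partialP //; have [cf df] := sf s; have [cg dg] := sg s.
split=> [x|i x]; last by apply: derivableD; [exact: derivableZ|].
by apply: cvgD (cg x); apply: cvgZl_tmp; exact: cf.
Qed.

End smooth.

Section testfun.
Context (R : realType) (d : nat) (O : set 'rV[R]_d).
Local Notation E := 'rV[R]_d.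

Definition testfun_pred : {pred E -> R} :=
  fun f => `[< [/\ smooth f, compact (tsupport f) & tsupport f `<=` O] >].

Record testfun := TestFun {
  testfun_fun :> E -> R;
  _ : testfun_fun \in testfun_pred }.

HB.instance Definition _ := [isSub of testfun for testfun_fun].
HB.instance Definition _ := gen_eqMixin testfun.
HB.instance Definition _ := [Choice of testfun by <:].

Lemma testfun_pred_submod : submod_closed testfun_pred.
Proof.
split.
  have t0 : tsupport (0 : E -> R) = set0.
    rewrite /tsupport (_ : [set _ | _] = set0) ?closure0 //.
    by apply/seteqP; split=> x //=; rewrite eqxx.
  by apply/asboolP; split; rewrite ?t0; [exact: smooth0|exact: compact0|].
move=> a f g /asboolP[sf cf fO] /asboolP[sg cg gO]; apply/asboolP.
have sub : tsupport (a *: f + g) `<=` tsupport f `|` tsupport g.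
  rewrite /tsupport -closureU; apply: closure_subset => x /= h.
  have [fx0|] := eqVneq (f x) 0; last by left.
  right; apply: contra h => /eqP gx0.
  by rewrite !fctE /= fx0 gx0 scaler0 addr0.
split; first exact: smoothP.
  apply: subclosed_compact sub; first exact: closed_closure.
  exact: compactU.
by apply: (subset_trans sub) => x [/fO|/gO].
Qed.

HB.instance Definition _ :=
  GRing.isSubmodClosed.Build R (E -> R) testfun_pred testfun_pred_submod.
HB.instance Definition _ := [SubChoice_isSubLmodule of testfun by <:].

(* [W] meets the Frechet space D(K) of test functions supported in [K] in a
   neighbourhood of 0 for the seminorms
   f |-> max_(|alpha| <= m) sup_x |partial^alpha f x|. *)
Definition nbhs0_on (K : set E) (W : set testfun) : Prop :=
  exists (m : nat) (e : R), 0 < e /\ forall f : testfun, tsupport f `<=` K ->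
    (forall (s : seq 'I_d) x, (size s <= m)%N -> `|iter_partial s f x| <= e) ->
    W f.

Definition balanced (W : set testfun) : Prop :=
  forall (a : R) f, `|a| <= 1 -> W f -> W (a *: f).

(* Base of neighbourhoods of 0 of the locally convex inductive limit of the
   spaces D(K).  [K] ranges over all compact subsets of [O]; an exhausting
   sequence K_0, K_1, ... is cofinal among them, so that it gives the same
   topology. *)
Definition lf_nbhs0 (W : set testfun) : Prop :=
  [/\ convex_set W, balanced W &
      forall K : set E, compact K -> K `<=` O -> nbhs0_on K W].

Definition lf_open (U : set testfun) : Prop :=
  forall f, U f ->
    exists2 W, lf_nbhs0 W & [set f + g | g in W] `<=` U.

Lemma lf_openT : lf_open setT.
Proof.
move=> f _; exists setT => //; split=> //.
by move=> K _ _; exists 0%N, 1.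
Qed.

Lemma lf_openI : setI_closed lf_open.
Proof.
move=> U1 U2 o1 o2 f [/o1[W1 [cv1 b1 n1] s1] /o2[W2 [cv2 b2 n2] s2]].
exists (W1 `&` W2); last first.
  by move=> _ [g [g1 g2] <-]; split; [apply: s1|apply: s2]; exists g.
split.
- move=> x y l; rewrite !in_setI => /andP[x1 x2] /andP[y1 y2].
  by rewrite cv1 ?cv2.
- by move=> a g a1 [g1 g2]; split; [exact: b1|exact: b2].
move=> K cK KO; have [m1 [e1 [e10 h1]]] := n1 K cK KO.
have [m2 [e2 [e20 h2]]] := n2 K cK KO.
exists (maxn m1 m2), (Num.min e1 e2); split; first by rewrite lt_min e10.
move=> g gK h; split.
  apply: h1 => // s x sm; apply: (le_trans (h s x _)); last by rewrite ge_min lexx.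
  by rewrite (leq_trans sm) // leq_maxl.
apply: h2 => // s x sm; apply: (le_trans (h s x _)).
  by rewrite (leq_trans sm) // leq_maxr.
by rewrite ge_min lexx orbT.
Qed.

Lemma lf_open_bigU (I : Type) (F : I -> set testfun) :
  (forall i, lf_open (F i)) -> lf_open (\bigcup_i F i).
Proof.
move=> oF f [i _ /(oF i)[W nW s]]; exists W => //.
by apply: subset_trans s _ => g Fg; exists i.
Qed.

HB.instance Definition _ := isOpenTopological.Build testfun
  lf_openT lf_openI lf_open_bigU.

End testfun.

Definition borel (U : topologicalType) : set (set U) := <<s @open U >>.
Arguments borel : clear implicits.

Section processes.
Context (R : realType) (disp : measure_display) (T : measurableType disp).
Variable P : probability T R.

Definition independent (I : eqType) (U : Type) (G : set (set U))
    (X : I -> T -> U) : Prop :=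
  forall (s : seq I) (B : I -> set U), uniq s -> (forall i, G (B i)) ->
    P (\bigcap_(i in [set` s]) (X i @^-1` B i)) =
    (\prod_(i <- s) P (X i @^-1` B i))%E.

Definition cvg_in_prob (X : nat -> T -> R) (Y : T -> R) : Prop :=
  forall e : R, 0 < e ->
    P [set w | e < `|X n w - Y w|] @[n --> \oo] --> 0%E.

(* Time is [0, +oo[: the values of [X] at negative times are irrelevant. *)
Definition levy_process (U : preTopologicalLmodType R) (X : R -> T -> U) : Prop :=
  [/\ forall t, 0 <= t -> forall B, borel U B -> measurable (X t @^-1` B),
      {ae P, forall w, X 0 w = 0},
      forall t : nat -> R, 0 <= t 0%N -> (forall i, t i <= t i.+1) ->
        independent (borel U) (fun i w => X (t i.+1) w - X (t i) w),
      forall s h : R, 0 <= s -> 0 <= h -> forall B, borel U B ->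
        P [set w | B (X (s + h) w - X s w)] = P [set w | B (X h w - X 0 w)] &
      forall (t : R) (V : set U), 0 <= t -> open V -> V 0 ->
        P [set w | ~ V (X s w - X t w)]
          @[s --> within [set s | 0 <= s] (nbhs t)] --> 0%E].

(* (rho * mu)(B) = \int mu(B - x) rho(dx), iterated from the Dirac mass at 0. *)
Fixpoint conv_pow (rho : probability (measurableTypeR R) R) (n : nat)
    (B : set R) : \bar R :=
  if n is n'.+1 then \int[rho]_x conv_pow rho n' [set y : R | B (x + y)%R]
  else \d_(0 : R) B.

Definition infinitely_divisible (X : {RV P >-> R}) : Prop :=
  forall n : nat, (0 < n)%N -> exists rho : probability (measurableTypeR R) R,
    forall B : set R, measurable B -> distribution P X B = conv_pow rho n B.

Definition levy_measure (n : {measure set (measurableTypeR R) -> \bar R}) : Prop :=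
  n [set 0] = 0%E /\ (\int[n]_y (Num.min (y ^+ 2) 1)%:E < +oo)%E.

(* Levy-Khintchine formula E[exp(iuX)] = exp(psi(u)) with
   psi(u) = iub - su^2/2 + \int (exp(iuy) - 1 - iuy 1_{|y| <= 1}) n(dy),
   written out in real and imaginary parts. *)
Definition lk_re (s : R) (n : {measure set (measurableTypeR R) -> \bar R}) (u : R) : R :=
  - (s * u ^+ 2 / 2) + \int[n]_y (cos (u * y) - 1).

Definition lk_im (b : R) (n : {measure set (measurableTypeR R) -> \bar R}) (u : R) : R :=
  u * b + \int[n]_y (sin (u * y) - u * y * \1_(`[-1, 1]%classic) y).

Definition levy_khintchine (X : {RV P >-> R}) (b s : R)
    (n : {measure set (measurableTypeR R) -> \bar R}) : Prop :=
  [/\ 0 <= s, levy_measure n & forall u : R,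
    ('E_P[(fun w => cos (u * X w))] =
      (expR (lk_re s n u) * cos (lk_im b n u))%:E)%E /\
    ('E_P[(fun w => sin (u * X w))] =
      (expR (lk_re s n u) * sin (lk_im b n u))%:E)%E].

End processes.

Notation borelType U := (g_sigma_algebraType (@open U)).

Section slice.
Context (R : realType) (d1 d2 : measure_display)
  (X : measurableType d1) (Y : measurableType d2).
Variables (nu : {measure set (X * Y) -> \bar R}) (A : set X) (mA : measurable A).

(* The measure nu(A x .) on [Y]. *)
Definition slice of measurable A := fun B : set Y => nu (A `*` B).

Let slice0 : slice mA set0 = 0%E.
Proof. by rewrite /slice setX0 measure0. Qed.

Let slice_ge0 B : (0 <= slice mA B)%E.
Proof. exact: measure_ge0. Qed.

Let slice_sigma_additive : semi_sigma_additive (slice mA).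
Proof.
move=> F mF tF mUF; rewrite /slice setX_bigcupr.
apply: measure_semi_sigma_additive.
- by move=> i; exact: measurableX.
- apply/trivIsetP => i j _ _ ij; rewrite -setXI.
  by move/trivIsetP : tF => /(_ _ _ _ _ ij) ->//; rewrite setX0.
- by rewrite -setX_bigcupr; exact: measurableX.
Qed.

HB.instance Definition _ := isMeasure.Build _ _ _ (slice mA)
  slice0 slice_ge0 slice_sigma_additive.

End slice.

Section random_measures.
Context (R : realType) (disp : measure_display) (T : measurableType disp).
Variable P : probability T R.
Context (d : nat).
Local Notation E := 'rV[R]_d.
Variable O : set E.

(* Borel subsets of [O] that are relatively compact in [O]. *)
Definition Bb (A : set E) : Prop :=
  [/\ @measurable _ (borelType E) A, compact (closure A) &
      closure A `<=` O].

(* Elements of L^0 are given by representatives, and their equality is almost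
   sure equality.  The values of [m] outside [Bb] are irrelevant, and so are
   those of [M] below at negative times. *)
Definition infdiv_random_measure (m : set E -> {RV P >-> R}) : Prop :=
  (forall A : nat -> set E, (forall k, Bb (A k)) -> trivIset setT A ->
    independent P (borel R) (fun k => m (A k) : T -> R) /\
    (Bb (\bigcup_k A k) -> {ae P, forall w,
      (\sum_(0 <= k < n) m (A k) w) @[n --> \oo] --> m (\bigcup_k A k) w})) /\
  (forall A, Bb A -> infinitely_divisible (m A)).

Definition levy_valued_random_measure (M : R -> set E -> {RV P >-> R}) : Prop :=
  (forall t, 0 <= t -> infdiv_random_measure (M t)) /\
  (forall (n : nat) (A : 'I_n -> set E), (forall i, Bb (A i)) ->
    @levy_process _ _ _ P ('rV[R]_n : normedModType R)
      (fun t w => \row_i M t (A i) w)).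

Definition sigma_additive_on_Bb (mu : set E -> R) : Prop :=
  mu set0 = 0 /\
  forall A : nat -> set E, (forall k, Bb (A k)) -> trivIset setT A ->
    Bb (\bigcup_k A k) ->
    (\sum_(0 <= k < n) mu (A k)) @[n --> \oo] --> mu (\bigcup_k A k).

Definition characteristics (M : R -> set E -> {RV P >-> R})
    (gamma Sigma : set E -> R)
    (nu : {measure set (borelType E * measurableTypeR R) -> \bar R}) : Prop :=
  [/\ sigma_additive_on_Bb gamma,
      sigma_additive_on_Bb Sigma /\ (forall A, Bb A -> 0 <= Sigma A),
      sigma_finite (O `*` setT : set (borelType E * measurableTypeR R)) nu &
      forall (A : set E) (mA : @measurable _ (borelType E) A), Bb A ->
        levy_khintchine (M 1 A) (gamma A) (Sigma A) (slice nu mA)].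

(* On [Bb], the total variation of [gamma]; on the other Borel subsets of [O],
   its extension as a measure, which is inner regular with respect to [Bb]. *)
Definition total_variation (gamma : set E -> R) (A : set E) : \bar R :=
  ereal_sup [set x | exists (n : nat) (B : 'I_n -> set E),
    [/\ forall i, Bb (B i) /\ B i `<=` A, trivIset setT B &
        x = (\sum_(i < n) `|gamma (B i)|)%:E]].

(* Likewise, the extension of [Sigma] from [Bb] to the Borel subsets of [O]. *)
Definition extension (Sigma : set E -> R) (A : set E) : \bar R :=
  ereal_sup [set (Sigma B)%:E | B in [set B | Bb B /\ B `<=` A]].

(* Only the restriction of [nu] to O x R matters: [A] is a subset of [O]. *)
Definition control_measure (gamma Sigma : set E -> R)
    (nu : {measure set (borelType E * measurableTypeR R) -> \bar R})
    (A : set E) (mA : @measurable _ (borelType E) A) : \bar R :=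
  (total_variation gamma A + extension Sigma A +
   \int[slice nu mA]_y (Num.min (`|y| ^+ 2) 1)%:E)%E.

Record simple_fun := SimpleFun {
  sf_size : nat;
  sf_coef : 'I_sf_size -> R;
  sf_set : 'I_sf_size -> set E;
  _ : forall k, Bb (sf_set k);
  _ : trivIset setT sf_set }.

Definition sf_eval (g : simple_fun) (x : E) : R :=
  \sum_k sf_coef k * \1_(@sf_set g k) x.

Definition sf_integral (M : R -> set E -> {RV P >-> R}) (t : R) (A : set E)
    (g : simple_fun) (w : T) : R :=
  \sum_k sf_coef k * M t (A `&` @sf_set g k) w.

Section integral.
Variables (M : R -> set E -> {RV P >-> R}) (gamma Sigma : set E -> R)
  (nu : {measure set (borelType E * measurableTypeR R) -> \bar R}).

(* [J t A] is (a version of) the integral of [f] over [A] with respect to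
   [M t], for all [t >= 0] and all Borel subsets [A] of [O]. *)
Definition is_M_integral (f : E -> R) (J : R -> set E -> {RV P >-> R}) : Prop :=
  measurable_fun (O : set (borelType E)) (f : borelType E -> R) /\
  exists g : nat -> simple_fun,
    (exists (N : set E) (mN : @measurable _ (borelType E) N),
      control_measure gamma Sigma nu mN = 0%E /\
      forall x, O x -> ~ N x -> sf_eval (g n) x @[n --> \oo] --> f x) /\
    (forall (A : set E) (t : R),
      @measurable _ (borelType E) A -> A `<=` O -> 0 <= t ->
      cvg_in_prob P (fun n => sf_integral M t A (g n)) (J t A)).

Definition M_integrable (f : E -> R) : Prop := exists J, is_M_integral f J.

End integral.

End random_measures.

(* Main.v *)
Require Import Defs.
From HB Require Import structures.
From mathcomp Require Import all_boot all_order all_algebra.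
From mathcomp Require Import all_classical all_reals all_analysis.
From mathcomp Require Import measurable_realfun ring lra.

Set Implicit Arguments.
Unset Strict Implicit.
Unset Printing Implicit Defensive.

Import Order.TTheory GRing.Theory Num.Theory.
Import numFieldNormedType.Exports.

Local Open Scope classical_set_scope.
Local Open Scope ring_scope.

(** A test function [f] is expanded in the indicators of countably many dyadic
    cells [Q_p] of the shells of a compact exhaustion of [O], the cells of the
    same level being disjoint: [f = \sum_p c_p(f) 1_(Q_p)], where [c_p(f)] is a
    mixed difference of [f] on a dyadic grid.  Derivatives of [f] up to the
    order [d] control [\sum_p (c_p(f) / w_p)^2] on each shell, for weights [w_p]
    that decay with the level but for which [\sum_p w_p 1_(Q_p)] is bounded.
    The boundedness of the range of a random measure on a bounded set and a
    random sign (Paley-Zygmund) argument show that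
    [\sum_p (w_p M(t, Q_p))^2] converges almost surely on each shell, with
    tails that are small uniformly for [t] in a bounded interval.  By
    Cauchy-Schwarz, [Y(t) f = \sum_p (c_p(f) / w_p) (w_p M(t, Q_p))] defines a
    functional on test functions that depends continuously, for the strong
    topology of the dual, on a point of a separable space of square summable
    sequences.  Hence the Levy properties of [Y] follow from those of the finite
    families of coordinates [M(t, Q_p)].  The partial sums of the expansion are
    simple functions, so [Y(t) f] is a version of the integral of [f]; two
    versions agree by a gliding hump argument. *)

(** * Outer probability and independence *)

(** Each [J(t) f] is fixed only up to a null set depending on [f], and there are uncountably many
    test functions; moreover the paths of [M(t, .)] need not be measures, so [f] cannot be
    integrated path by path. Passing to countably many variables leaves a single null set on which
    the process has to be altered. As [M(t, A)] may have no moments, all estimates are probabilities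
    of exceeding a level, and second moments are replaced by those of min(u, 1). The weights face
    two opposite demands: at a fixed point they must be summable over the levels, yet the squared
    quotients must stay summable although the number of cells doubles with each level of each
    coordinate. One derivative per coordinate leaves room for both, whence the order [d]. Finally,
    the integral is defined by arbitrary approximating sequences that converge off a null set of the
    control measure, without any domination; agreement of versions therefore does not follow from
    the estimates for the expansion and needs an argument of its own. *)

Section outer_probability.
Context (R : realType) (disp : measure_display) (T : measurableType disp).
Variable P : probability T R.
Implicit Types A B C : set T.

(* Outer probability, so that most estimates need no measurability check. *)
Definition oprob A : R :=
  inf [set fine (P B) | B in [set B | measurable B /\ A `<=` B]].

Lemma fin_prob A : measurable A -> P A \is a fin_num.
Proof. by move=> mA; exact: fin_num_measure. Qed.

Let oprob_set_nonempty A :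
  [set fine (P B) | B in [set B | measurable B /\ A `<=` B]] !=set0.
Proof. by exists (fine (P setT)), setT; split. Qed.

Let oprob_set_lb A :
  lbound [set fine (P B) | B in [set B | measurable B /\ A `<=` B]] 0.
Proof. by move=> _ [B _ <-]; exact: fine_ge0. Qed.

Lemma oprob_le_meas A B : measurable B -> A `<=` B -> oprob A <= fine (P B).
Proof.
move=> mB AB; apply: ge_inf; first by exists 0; exact: oprob_set_lb.
by exists B.
Qed.

Lemma oprobE A : measurable A -> oprob A = fine (P A).
Proof.
move=> mA; apply/eqP; rewrite eq_le oprob_le_meas//=.
apply: lb_le_inf => // _ [B [mB AB] <-].
by apply: fine_le; rewrite ?fin_prob//; apply: le_measure; rewrite ?inE.
Qed.

Lemma EFin_oprob A : measurable A -> (oprob A)%:E = P A.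
Proof. by move=> mA; rewrite oprobE// fineK// fin_prob. Qed.

Lemma oprob_ge0 A : 0 <= oprob A.
Proof. exact: lb_le_inf. Qed.

Lemma oprob_adherent A e : 0 < e ->
  exists B, [/\ measurable B, A `<=` B & oprob B < oprob A + e].
Proof.
move=> e0; have [|_ [B [mB AB] <-] h] := @inf_adherent _
  [set fine (P B) | B in [set B | measurable B /\ A `<=` B]] e e0.
  by split=> //; exists 0; exact: oprob_set_lb.
by exists B; split=> //; rewrite oprobE.
Qed.

Lemma le_oprob A B : A `<=` B -> oprob A <= oprob B.
Proof.
move=> AB; apply: lb_le_inf => // _ [C [mC BC] <-].
by apply: oprob_le_meas => //; exact: subset_trans BC.
Qed.

Lemma oprobT : oprob setT = 1.
Proof. by rewrite oprobE// probability_setT. Qed.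

Lemma oprob0 : oprob set0 = 0.
Proof. by rewrite oprobE// measure0. Qed.

Lemma oprobU A B : oprob (A `|` B) <= oprob A + oprob B.
Proof.
apply/ler_addgt0Pr => e e0.
have [A' [mA' AA' hA]] := oprob_adherent A (divr_gt0 e0 (ltr0n _ 2)).
have [B' [mB' BB' hB]] := oprob_adherent B (divr_gt0 e0 (ltr0n _ 2)).
apply: (@le_trans _ _ (oprob A' + oprob B')); last first.
  by rewrite [e]splitr; lra.
apply: (@le_trans _ _ (fine (P (A' `|` B')))).
  by apply: oprob_le_meas; [exact: measurableU|exact: setUSS].
rewrite !oprobE// -fineD ?fin_prob//.
apply: fine_le; rewrite ?fin_numD ?fin_prob//; first exact: measurableU.
exact: measureU2.
Qed.

Lemma le_oprobU A B C a b : A `<=` B `|` C -> oprob B <= a -> oprob C <= b ->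
  oprob A <= a + b.
Proof.
by move=> h ha hb; apply: le_trans (le_oprob h) _; apply: le_trans (oprobU _ _) _;
  exact: lerD.
Qed.

Lemma oprob_sum (s : seq (set T)) :
  oprob [set w | exists2 A, A \in s & A w] <= \sum_(A <- s) oprob A.
Proof.
elim: s => [|A s IH].
  by rewrite big_nil (_ : [set _ | _] = set0) ?oprob0// -subset0 => w [].
rewrite big_cons; apply: le_oprobU IH; last exact: lexx.
by move=> w [B]; rewrite inE => /orP[/eqP->|Bs] Bw; [left|right; exists B].
Qed.

Lemma oprob_ae (Q : set T) : {ae P, forall w, Q w} -> oprob (~` Q) = 0.
Proof.
move=> [B [mB PB0 QB]]; apply/eqP; rewrite eq_le oprob_ge0 andbT.
by rewrite (le_trans (oprob_le_meas mB _))// PB0.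
Qed.

Lemma ae_oprob (Q : set T) : oprob (~` Q) = 0 -> {ae P, forall w, Q w}.
Proof.
move=> Q0; have /choice[F hF] (n : nat) : exists B,
    [/\ measurable B, ~` Q `<=` B & oprob B < n.+1%:R^-1].
  have [|B [mB QB hB]] := @oprob_adherent (~` Q) n.+1%:R^-1.
    by rewrite invr_gt0.
  by exists B; split=> //; rewrite Q0 add0r in hB.
have mF : measurable (\bigcap_n F n).
  by apply: bigcapT_measurable => n; have [] := hF n.
exists (\bigcap_n F n); split=> //; last first.
  by move=> w Qw n _; have [_ + _] := hF n; exact.
rewrite -EFin_oprob//; congr (_%:E); apply/eqP; rewrite eq_le oprob_ge0 andbT.
apply/ler_addgt0Pr => e e0; rewrite add0r.
have := @archimedean.Num.Theory.truncnS_gt _ e^-1.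
set n := Num.trunc _ => ltn.
have [_ _ /ltW h] := hF n; apply: le_trans (le_oprob _) (le_trans h _).
  by move=> w /(_ n I).
by rewrite invf_ple ?posrE// ltW.
Qed.

Lemma le_oprob_ae A B : {ae P, forall w, A w -> B w} -> oprob A <= oprob B.
Proof.
move=> /oprob_ae h; rewrite -[leRHS]add0r; apply: (@le_oprobU A (~` (fun w => A w ->
  B w)) B) (lexx _); last by rewrite h.
by move=> w Aw; have [Bw|nBw] := pselect (B w); [right|left=> /(_ Aw)].
Qed.

(** Turns probability bounds into inequalities between constants: if the exceptional events do not
    fill the space, all the good estimates hold at one common point [w], from which [w] can then be
    eliminated. *)
Lemma oprob_lt1_ex (s : seq (set T)) : \sum_(A <- s) oprob A < 1 ->
  exists w, forall A, A \in s -> ~ A w.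
Proof.
move=> s1; apply: contrapT => h; have := oprob_sum s; apply/negP; rewrite -ltNge.
apply: lt_le_trans s1 _; rewrite -oprobT; apply: le_oprob => w _.
apply: contrapT => nA; apply: h; exists w => A As Aw; apply: nA.
by exists A.
Qed.

Lemma oprob_lt1_ex3 A B C : oprob A + oprob B + oprob C < 1 ->
  exists w, [/\ ~ A w, ~ B w & ~ C w].
Proof.
move=> h; have [|w hw] := @oprob_lt1_ex [:: A; B; C].
  by rewrite !big_cons big_nil addr0 addrA.
by exists w; split; apply: hw; rewrite !inE eqxx ?orbT.
Qed.

Lemma oprob_cvg0 (F : nat -> set T) (e : R) : (forall n, measurable (F n)) ->
  (forall n, F n.+1 `<=` F n) -> \bigcap_n F n = set0 -> 0 < e ->
  exists n, oprob (F n) <= e.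
Proof.
move=> mF dF F0 e0.
have : P (F n) @[n --> \oo] --> P (\bigcap_n F n).
  apply: nonincreasing_cvg_mu => //; first by rewrite (le_lt_trans (probability_le1 _ _)) ?ltry.
    by rewrite F0.
  by apply/nonincreasing_seqP => n; exact/subsetPset.
rewrite F0 measure0 => /fine_cvgP[_ /cvgr0Pnorm_lt /(_ _ e0)[n _ h]].
exists n; rewrite oprobE//; apply: le_trans (ltW (h n (leqnn n))).
by rewrite ler_norm.
Qed.

Lemma oprob_cvg0_mono (F : nat -> set T) (e : R) : (forall n, F n.+1 `<=` F n) ->
  (forall n, measurable (F n)) -> oprob (\bigcap_n F n) = 0 -> 0 < e ->
  exists n, oprob (F n) <= e.
Proof.
move=> dF mF F0 e0.
have mI : measurable (\bigcap_n F n) by exact: bigcapT_measurable.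
have dF' n : F n.+1 `\` \bigcap_n F n `<=` F n `\` \bigcap_n F n by exact: setSD.
have F'0 : \bigcap_n (F n `\` \bigcap_n F n) = set0.
  rewrite -subset0 => w h; have [_ []] := h 0%N I.
  by move=> k _; have [] := h k I.
have [n hn] := oprob_cvg0 (fun n => measurableD (mF n) mI) dF' F'0 e0.
exists n; rewrite -(addr0 e); apply: (le_oprobU _ hn) (_ : oprob (\bigcap_n F n) <= 0).
  by move=> w Fw; have [|] := pselect ((\bigcap_n F n) w); [right|left].
by rewrite F0.
Qed.

End outer_probability.

(** * Independence: from generators to sigma-algebras *)

Section generated_independence.
Context (R : realType) (disp : measure_display) (T : measurableType disp).
Variable P : probability T R.
Implicit Types (A B C : set T) (G H : set (set T)).

(** The sets that satisfy the product formula with the fixed event [C] form a Dynkin class, so the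
    pi-lambda theorem applies. *)
Lemma indep_generated1 G C : setI_closed G -> measurable C ->
  (forall A, G A -> measurable A /\ P (A `&` C) = (P A * P C)%E) ->
  forall A, <<s G >> A -> measurable A /\ P (A `&` C) = (P A * P C)%E.
Proof.
move=> GI mC hG; rewrite -setI_closed_g_dynkin_g_sigma_algebra//.
have fC := fin_prob P mC.
apply: smallest_sub; last exact: hG.
split.
- by rewrite /= setTI probability_setT mul1e.
- move=> A [mA hA]; split; first exact: measurableC.
  rewrite setIC -setDE measureD//; last by rewrite ltey_eq fC.
  transitivity (P C - P A * P C)%E.
    by congr (_ - _)%E; rewrite setIC; exact: hA.
  by rewrite probability_setC// muleBl ?fin_num_adde_defr ?mul1e ?fin_prob.
- move=> F tF hF; have mF n : measurable (F n) by case: (hF n).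
  split; first exact: bigcupT_measurable.
  rewrite setI_bigcupl measure_bigcup//; last 2 first.
    by move=> n _; exact: measurableI.
    by under eq_fun do rewrite setIC; exact: trivIset_setIl.
  rewrite measure_bigcup// muleC -[in RHS](fineK fC) -nneseriesZl//.
  by apply: eq_eseriesr => n _; rewrite (fineK fC) muleC; exact: (hF n).2.
Qed.

Lemma indep_generated2 G H : setI_closed G -> setI_closed H ->
  (forall A, G A -> measurable A) -> (forall A, H A -> measurable A) ->
  (forall A B, G A -> H B -> P (A `&` B) = (P A * P B)%E) ->
  forall A B, <<s G >> A -> <<s H >> B -> P (A `&` B) = (P A * P B)%E.
Proof.
move=> GI HI mG mH h A B GA HB.
have mB : measurable B.
  by move: HB; apply: smallest_sub; [exact: sigma_algebra_measurable|exact: mH].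
suff /(_ _ GA)[] : forall A, <<s G >> A ->
  measurable A /\ P (A `&` B) = (P A * P B)%E by [].
apply: indep_generated1 => // {GA}A GA; split; first exact: mG.
rewrite setIC muleC; have mA := mG _ GA.
suff /(_ _ HB)[] : forall B, <<s H >> B ->
  measurable B /\ P (B `&` A) = (P B * P A)%E by [].
apply: indep_generated1 => // {mB HB}B HB; split; first exact: mH.
by rewrite setIC muleC; exact: h.
Qed.

End generated_independence.

Section real_borel.
Context (R : realType).

Lemma measurable_norm_gt (disp : measure_display) (T : measurableType disp)
    (f : T -> R) (y : R) : measurable_fun setT f -> measurable [set w | y < `|f w|].
Proof.
move=> mf; rewrite (_ : [set _ | _] = (Num.norm \o f) @^-1` `]y, +oo[).
  rewrite -[X in measurable X]setTI.
  by apply: (measurableT_comp (@normr_measurable R setT) mf).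
by apply/seteqP; split=> w /=; rewrite in_itv/= andbT.
Qed.

Lemma borel_measurableE :
  borel R = @measurable _ (measurableTypeR R) :> set (set R).
Proof.
apply/seteqP; split => [B|B].
  apply: smallest_sub; first exact: sigma_algebra_measurable.
  by move=> A /open_measurable.
rewrite [X in X -> _](_ : _ =
    <<s [set A | exists x y, A = `]x, y[%classic :> set R] >> B).
  move: B; apply: smallest_sub; first exact: smallest_sigma_algebra.
  move=> _ [x [y ->]]; apply: sub_sigma_algebra; exact: interval_open.
by have := RGenOpens.measurableE R => /(congr1 (@^~ B)).
Qed.

End real_borel.

Section independent_reals.
Context (R : realType) (disp : measure_display) (T : measurableType disp).
Variable P : probability T R.

Section cylinders.
Context (I : eqType) (X : I -> T -> R).

(** A pi-system generating the sigma-algebra of the variables [X i] with [i] in [D]. *)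
Definition cylinder (D : set I) : set (set T) :=
  [set A | exists (s : seq I) (B : I -> set R), [/\ forall i, i \in s -> D i,
    forall i, measurable (B i) &
    A = [set w | forall i, i \in s -> B i (X i w)]]].

Lemma setI_closed_cylinder D : setI_closed (cylinder D).
Proof.
move=> _ _ [s1 [B1 [D1 m1 ->]]] [s2 [B2 [D2 m2 ->]]].
exists (s1 ++ s2), (fun i => (if i \in s1 then B1 i else setT) `&`
                        (if i \in s2 then B2 i else setT)); split.
- by move=> i; rewrite mem_cat => /orP[/D1|/D2].
- by move=> i; apply: measurableI; case: ifP.
apply/seteqP; split => w /=.
  by move=> [h1 h2] i _; split; case: ifP => // is_; [exact: h1|exact: h2].
move=> h; split=> i is_; have := h i; rewrite mem_cat is_ ?orbT => /(_ isT)[//].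
Qed.

(** Measurability is stated on the sample space equipped with the generated sigma-algebra, so that
    closure properties of measurable functions express which coordinates an event depends on. *)
Lemma measurable_cylinder D i : D i ->
  measurable_fun setT (X i : g_sigma_algebraType (cylinder D) -> R).
Proof.
move=> Di _ B mB; rewrite setTI; apply: sub_sigma_algebra.
exists [:: i], (fun=> B); split=> // [j|]; first by rewrite inE => /eqP->.
by apply/seteqP; split=> [w Bw j|w /(_ i)]; rewrite inE ?eqxx; [move/eqP->|exact].
Qed.

Lemma measurable_sum_cylinder D (s : seq I) : (forall i, i \in s -> D i) ->
  measurable_fun setT
    ((fun w => \sum_(i <- s) X i w) : g_sigma_algebraType (cylinder D) -> R).
Proof.
elim: s => [_|i s IH h]; first by under eq_fun do rewrite big_nil; exact: measurable_cst.
under eq_fun do rewrite big_cons; apply: measurable_funD.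
  by apply: measurable_cylinder; apply: h; rewrite mem_head.
by apply: IH => j js; apply: h; rewrite in_cons js orbT.
Qed.

Hypothesis mX : forall i, measurable_fun setT (X i).

Lemma cylinder_measurable D A : cylinder D A -> measurable A.
Proof.
move=> [s [B [_ mB ->]]].
rewrite (_ : [set _ | _] = \bigcap_(i in [set` s]) X i @^-1` B i); last first.
  by apply/seteqP; split=> w h i /= is_; exact: h.
apply: fin_bigcap_measurable => // i _.
by rewrite -[X in measurable X]setTI; exact: mX.
Qed.

Lemma sigma_cylinder_measurable D A : <<s cylinder D >> A -> measurable A.
Proof.
move: A; apply: smallest_sub; first exact: sigma_algebra_measurable.
by move=> A; exact: cylinder_measurable.
Qed.

Lemma independent_blocks (D1 D2 : set I) A B : independent P (borel R) X ->
  D1 `&` D2 = set0 -> <<s cylinder D1 >> A -> <<s cylinder D2 >> B ->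
  P (A `&` B) = (P A * P B)%E.
Proof.
move=> indX D120; apply: indep_generated2.
- exact: setI_closed_cylinder.
- exact: setI_closed_cylinder.
- by move=> C; exact: cylinder_measurable.
- by move=> C; exact: cylinder_measurable.
have E (s : seq I) (C : I -> set R) : (forall i, measurable (C i)) ->
    P [set w | forall i, i \in s -> C i (X i w)] =
    (\prod_(i <- undup s) P (X i @^-1` C i))%E.
  move=> mC; rewrite -indX ?undup_uniq//; last by move=> i; rewrite borel_measurableE;
    exact: mC.
  by congr (P _); apply/seteqP; split=> w h i /=; [rewrite mem_undup|rewrite -mem_undup];
    exact: h.
move=> _ _ [s1 [B1 [s1D m1 ->]]] [s2 [B2 [s2D m2 ->]]].
(* As [D1] and [D2] are disjoint, the two families of constraints merge into one without
   conflict. *)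
rewrite !E//; pose C i := if i \in s1 then B1 i else B2 i.
have s12 i : i \in s2 -> (i \in s1) = false.
  move=> i2; apply/negP => i1; have : (D1 `&` D2) i by split; [exact: s1D|exact: s2D].
  by rewrite D120.
rewrite (_ : _ `&` _ = [set w | forall i, i \in s1 ++ s2 -> C i (X i w)]); last first.
  apply/seteqP; split => w /=.
    move=> [h1 h2] i; rewrite mem_cat /C => /orP[i1|i2]; first by rewrite i1; exact: h1.
    by rewrite s12//; exact: h2.
  move=> h; split=> i is_; have := h i; rewrite mem_cat is_ /C ?orbT => /(_ isT).
    by rewrite is_.
  by rewrite s12.
rewrite E; last by move=> i; rewrite /C; case: ifP.
rewrite (perm_big (undup s1 ++ undup s2)) /=; last first.
  apply: uniq_perm; rewrite ?undup_uniq// ?cat_uniq ?undup_uniq ?andbT/=.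
    by apply/hasPn => i; rewrite !mem_undup => i2; rewrite /= s12.
  by move=> i; rewrite mem_cat !mem_undup mem_cat.
rewrite big_cat/=; congr (_ * _)%E; apply: eq_big_seq => i; rewrite mem_undup => is_.
  by rewrite /C is_.
by rewrite /C s12.
Qed.

End cylinders.

(** Split according to the first [k] with |S k| > 3x, the event [G k]. Then either |S n| > x, or |S
    n - S k| > 2x; the latter event is independent of [G k] and has probability at most 2p. As the
    [G k] are disjoint, this adds up to p + 2p. *)
Lemma etemadi (X : nat -> T -> R) (n : nat) (x p : R) :
  (forall i, measurable_fun setT (X i)) -> independent P (borel R) X ->
  (forall k, (k <= n)%N -> oprob P [set w | x < `|\sum_(i < k) X i w|] <= p) ->
  oprob P [set w | exists2 k, (k <= n)%N & 3 * x < `|\sum_(i < k) X i w|] <= 3 * p.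
Proof.
move=> mX indX hp.
pose S k w := \sum_(i < k) X i w.
pose G k := [set w | 3 * x < `|S k w| /\ forall i, (i < k)%N -> ~ 3 * x < `|S i w|].
pose H k := [set w | 2 * x < `|S n w - S k w|].
have mS k (D : set nat) : (forall i, (i < k)%N -> D i) ->
    measurable_fun setT (S k : g_sigma_algebraType (cylinder X D) -> R).
  move=> kD; rewrite (_ : S k = fun w => \sum_(i <- iota 0 k) X i w).
    by apply: measurable_sum_cylinder => i; rewrite mem_iota => /andP[_ /kD].
  apply/funext => w; rewrite /S -(big_mkord xpredT (X^~ w)).
  by rewrite /index_iota subn0.
have mgt (D : set nat) (f : g_sigma_algebraType (cylinder X D) -> R) (y : R) :
    measurable_fun setT f -> <<s cylinder X D >> [set w | y < `|f w|].
  exact: measurable_norm_gt.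
have sG k : <<s cylinder X [set i | (i < k)%N] >> (G k).
  rewrite (_ : G k = [set w | 3 * x < `|S k w|] `&`
      \bigcap_(i in [set i | (i < k)%N]) ~` [set w | 3 * x < `|S i w|]) //.
  apply: (@measurableI _ (g_sigma_algebraType (cylinder X [set i | (i < k)%N]))).
    by apply: mgt; exact: mS.
  apply: fin_bigcap_measurable; first exact: finite_II.
  move=> i ik; apply: measurableC; apply: mgt; apply: mS => j ji /=.
  exact: ltn_trans ik.
have sH k : (k <= n)%N -> <<s cylinder X [set i | (k <= i)%N] >> (H k).
  move=> kn; apply: (mgt _ (fun w => S n w - S k w)).
  rewrite (_ : (fun w => _) = fun w => \sum_(i <- index_iota k n) X i w).
    by apply: measurable_sum_cylinder => i; rewrite mem_index_iota => /andP[].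
  apply/funext => w; rewrite /S -!(big_mkord xpredT (X^~ w)).
  by rewrite (big_cat_nat (n := k))//= addrAC subrr add0r.
have mG k : measurable (G k) by apply: sigma_cylinder_measurable (sG k).
have mH k : (k <= n)%N -> measurable (H k).
  by move=> kn; apply: sigma_cylinder_measurable (sH k kn).
have pH k : (k <= n)%N -> oprob P (H k) <= p + p.
  move=> kn; apply: (le_oprobU _ (hp n (leqnn n)) (hp k kn)) => w /=.
  rewrite /H /= -/(S n w) -/(S k w) => h.
  have [|/ltW] := leP `|S n w| x; [right|by left].
  have := ler_normB (S n w) (S k w).
  lra.
have pGH k : (k <= n)%N -> oprob P (G k `&` H k) <= oprob P (G k) * (p + p).
  move=> kn; suff -> : oprob P (G k `&` H k) = oprob P (G k) * oprob P (H k).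
    by apply: ler_wpM2l; [exact: oprob_ge0|exact: pH].
  apply: EFin_inj; rewrite EFinM !EFin_oprob//; [|exact: mH|exact/measurableI/mH].
  apply: independent_blocks (sG k) (sH k kn) => //.
  by rewrite -subset0 => i [/= ik]; rewrite leqNgt ik.
have sumG : \sum_(k < n.+1) oprob P (G k) <= 1.
  have tG : trivIset setT G.
    apply/trivIsetP => i j _ _; wlog ij : i j / (i < j)%N.
      move=> h; rewrite neq_ltn => /orP[|] ij; first by apply: h; rewrite ?neq_ltn ?ij.
      by rewrite setIC; apply: h; rewrite ?neq_ltn ?ij.
    by move=> _; rewrite -subset0 => w [[Gi _] [_ /(_ _ ij)]].
  rewrite -lee_fin -sumEFin.
  under eq_bigr do rewrite EFin_oprob//.
  rewrite -(measure_bigsetU P mG tG).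
  exact/probability_le1/bigsetU_measurable.
apply: (@le_trans _ _ (p + (p + p))); last by lra.
apply: (@le_oprobU _ _ _ _ _ [set w | x < `|S n w|]
  [set w | exists2 A, A \in [seq G k `&` H k | k <- iota 0 n.+1] & A w]).
- move=> w [k kn hk].
  have exk : exists k, 3 * x < `|S k w| by exists k.
  case: (ex_minnP exk) => m hm min_m.
  have mn : (m <= n)%N by apply: leq_trans kn; exact: min_m.
  have Gm : G m w.
    by split=> // i im hi; have := min_m i hi; rewrite leqNgt im.
  have [Sx|Sx] := ltP x `|S n w|; [by left|right].
  exists (G m `&` H m); first by apply/mapP; exists m => //; rewrite mem_iota.
  split=> //; rewrite /H /=; have := lerB_dist (S m w) (S n w).
  rewrite distrC; lra.
- exact: hp.
- apply: le_trans (oprob_sum _ _) _; rewrite big_map.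
  apply: (@le_trans _ _ (\sum_(k <- iota 0 n.+1) oprob P (G k) * (p + p))).
    rewrite big_seq [leRHS]big_seq; apply: ler_sum => k.
    by rewrite mem_iota ltnS => /andP[_ kn]; exact: pGH.
  rewrite -mulr_suml -[leRHS]mul1r; apply: ler_wpM2r.
    by rewrite (le_trans (oprob_ge0 P (H n)))// pH.
  have := sumG; rewrite -(big_mkord xpredT (fun k => oprob P (G k))).
  by rewrite /index_iota subn0.
Qed.

(** By Fubini, the probability that |X + Y| > l is the average over y, under the law of [Y], of the
    probability that |X + y| > l. Some y does at least as well as the average, and [a] is its
    opposite. *)
Lemma concentration (X Y : T -> R) (l q : R) :
  measurable_fun setT X -> measurable_fun setT Y ->
  (forall A B, measurable A -> measurable B ->
     P (X @^-1` A `&` Y @^-1` B) = (P (X @^-1` A) * P (Y @^-1` B))%E) ->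
  oprob P [set w | l < `|X w + Y w|] < q ->
  exists a, oprob P [set w | l < `|X w - a|] < q.
Proof.
move=> mX mY indXY hq; apply: contrapT => nex.
pose C := [set z : measurableTypeR R * measurableTypeR R | l < `|z.1 + z.2|].
have mC : measurable C.
  apply: (@measurable_norm_gt _ _ (measurableTypeR R * measurableTypeR R)%type
    (fun z => z.1 + z.2) l).
  by apply: measurable_funD; [exact: measurable_fst|exact: measurable_snd].
pose X1 : T -> measurableTypeR R := X; pose Y1 : T -> measurableTypeR R := Y.
have mX1 : measurable_fun setT X1 by [].
have mY1 : measurable_fun setT Y1 by [].
have mYX : measurable_fun setT (fun w => (Y1 w, X1 w)) by exact/measurable_fun_pairP.
pose X' : {RV P >-> measurableTypeR R} := mfun_Sub (mem_set mX1).
pose Y' : {RV P >-> measurableTypeR R} := mfun_Sub (mem_set mY1).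
pose YX : {RV P >-> (measurableTypeR R * measurableTypeR R)%type} :=
  mfun_Sub (mem_set mYX).
have E : ((distribution P Y' \x distribution P X') C = distribution P YX C)%E.
  apply: product_measure_unique => // A B mA mB.
  rewrite /= /distribution /pushforward /= muleC -indXY//; congr (P _).
  by apply/seteqP; split=> w [].
have : (q%:E <= distribution P YX C)%E.
  rewrite -E -[leLHS]mule1 -(@probability_setT _ _ _ (distribution P Y')).
  rewrite -integral_cst//; apply: ge0_le_integral => //.
  - move=> y _; rewrite lee_fin; apply: le_trans (ltW hq); exact: oprob_ge0.
  - exact: measurable_fun_xsection.
  - move=> y _ /=; have : q <= oprob P [set w | l < `|X w - - y|].
      by rewrite leNgt; apply/negP => h; apply: nex; exists (- y).
    rewrite -lee_fin EFin_oprob; last first.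
      apply: measurable_norm_gt; apply: measurable_funB => //; exact: measurable_cst.
    move/le_trans; apply; rewrite /distribution /pushforward /=.
    rewrite (_ : [set w | _] = X1 @^-1` xsection C y)//.
    apply/seteqP; split=> w /=; rewrite opprK addrC /xsection /= inE; exact.
have mXY : measurable_fun setT (fun w => X w + Y w) by exact: measurable_funD.
rewrite /distribution /pushforward /= (_ : _ @^-1` _ = [set w | l < `|X w + Y w|]).
  by rewrite -EFin_oprob ?lee_fin ?leNgt ?hq//; exact: measurable_norm_gt.
by apply/seteqP; split=> w /=; rewrite /C /= addrC.
Qed.

End independent_reals.

(** * Control of a real Levy process at earlier times *)

Section levy_maximal.
Context (R : realType) (disp : measure_display) (T : measurableType disp).
Variable P : probability T R.
Variables (X : R -> T -> R) (t l q : R).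
Hypothesis mX : forall s, measurable_fun setT (X s).
Hypothesis indX : forall s u : R, 0 <= s -> s <= u ->
  forall A B : set R, measurable A -> measurable B ->
  P (X s @^-1` A `&` (X u \- X s) @^-1` B) =
  (P (X s @^-1` A) * P ((X u \- X s)%R @^-1` B))%E.
Hypothesis statX : forall s h a c : R, 0 <= s -> 0 <= h ->
  oprob P [set w | c < `|X (s + h) w - X s w - a|] =
  oprob P [set w | c < `|X h w - a|].
Hypothesis cvgX : forall e r : R, 0 < e -> 0 < r -> exists2 h0 : R, 0 < h0 &
  forall h : R, 0 <= h -> h <= h0 -> oprob P [set w | e < `|X h w|] <= r.

(* Every [X h] is close to a constant [a h], additive in [h] up to an error of
   order [l]; by the Hyers-Ulam argument [a h] is bounded by a multiple of [l]. *)
Lemma levy_maximal (h : R) : 0 < l -> q <= 4^-1 -> 0 <= h -> h <= t ->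
  oprob P [set w | l < `|X t w|] < q -> oprob P [set w | 16 * l < `|X h w|] < q.
Proof.
move=> l0 q4 h0 ht Xt.
pose C h a := oprob P [set w | l < `|X h w - a|] < q.
have exC (s : R) : 0 <= s -> s <= t -> exists a, C s a.
  move=> s0 st; apply: (@concentration _ _ _ P _ (X t \- X s)) => //.
  - by apply: measurable_funB.
  - exact: indX.
  - by under eq_set do rewrite subrKC.
(* Three events of probability below 1/4 leave a point where all three variables are within [l] of
   their centres; this is where 3l comes from. *)
have addC (s u a b c : R) : 0 <= s -> 0 <= u -> C s a -> C u b -> C (s + u) c ->
    `|c - a - b| <= 3 * l.
  move=> s0 u0 Ca Cb Cc.
  have [|w [/negP + /negP + /negP]] := @oprob_lt1_ex3 _ _ _ P
      [set w | l < `|X s w - a|] [set w | l < `|X (s + u) w - X s w - b|]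
      [set w | l < `|X (s + u) w - c|].
    by rewrite (statX b l s0 u0); move: Ca Cb Cc; rewrite /C; lra.
  rewrite -!leNgt !ler_distl => /andP[? ?] /andP[? ?] /andP[? ?].
  by apply/andP; split; lra.
have bndC (s a e : R) : C s a -> oprob P [set w | e < `|X s w|] <= 4^-1 -> `|a| <= l + e.
  move=> Ca he.
  have [|w [/negP + /negP + _]] := @oprob_lt1_ex3 _ _ _ P
      [set w | l < `|X s w - a|] [set w | e < `|X s w|] set0.
    by rewrite oprob0; move: Ca; rewrite /C; lra.
  rewrite -!leNgt !ler_norml => /andP[? ?] /andP[? ?].
  by apply/andP; split; lra.
have [e e0 he] := cvgX l0 (ltac:(by rewrite invr_gt0) : 0 < 4^-1).
(* A crude bound, only needed to know that the centres are bounded at all: each step of length [e]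
   costs 3l for additivity and 2l for the centre at time [e]. *)
have bnd n (s a : R) : 0 <= s -> s <= t -> s <= n.+1%:R * e -> C s a ->
    `|a| <= 2 * l + n%:R * (5 * l).
  elim: n s a => [|n IH] s a s0 st sn Ca.
    by rewrite mul0r addr0 mulrDl !mul1r; apply: bndC Ca _; apply: he => //; lra.
  have [se|es] := leP s e.
    apply: le_trans (_ : 2 * l <= _); last by rewrite lerDl; apply: mulr_ge0 => //; lra.
    by rewrite mulrDl !mul1r; apply: bndC Ca _; exact: he.
  have [b Cb] := exC (s - e) ltac:(lra) ltac:(lra).
  have [c Cc] := exC e ltac:(lra) ltac:(lra).
  have Hb : `|b| <= 2 * l + n%:R * (5 * l).
    apply: IH Cb; [lra|lra|]; rewrite lerBlDr (le_trans sn)// -natr1.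
    by rewrite mulrDl mul1r.
  have Hc : `|c| <= l + l by apply: bndC Cc _; apply: he => //; lra.
  have := addC _ _ b c a (ltac:(lra) : 0 <= s - e) (ltW e0) Cb Cc.
  rewrite subrK => /(_ Ca); move: Hb Hc.
  have -> : n.+1%:R * (5 * l) = n%:R * (5 * l) + 5 * l.
    by rewrite -natr1 mulrDl mul1r.
  set N := _ * _; rewrite !ler_norml => /andP[? ?] /andP[? ?] /andP[? ?].
  by apply/andP; split; lra.
have [B B0 HB] : exists2 B : R, 0 <= B & forall s a : R, 0 <= s -> s <= t -> C s a -> `|a| <= B.
  pose n := Num.trunc (t / e).
  exists (2 * l + n%:R * (5 * l)).
    by apply: addr_ge0; [lra|apply: mulr_ge0 => //; lra].
  move=> s a s0 st; apply: bnd => //; rewrite (le_trans st)// -ler_pdivrMr//.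
  exact/ltW/archimedean.Num.Theory.truncnS_gt.
(* Doubling the time halves the crude part. With bound D + 14l at 2u, the centre at u is at most D/2
   + 17l/2; for s > t/2, passing from t - s to s through t adds 3l + 2l, and 17/2 + 5 is below 14.
   For large n only 15l remains, and |X h| > 16l then forces |X h - a| > l. *)
have step n (s a : R) : 0 <= s -> s <= t -> C s a -> `|a| <= B / 2 ^+ n + 14 * l.
  elim: n s a => [|n IH] s a s0 st Ca.
    by rewrite expr0 divr1 (le_trans (HB _ _ s0 st Ca))// lerDl; lra.
  rewrite exprS invfM mulrCA; set D := B / 2 ^+ n in IH *.
  have half (u b : R) : 0 <= u -> u + u <= t -> C u b -> `|b| <= 2^-1 * D + 17/2 * l.
    move=> u0 ut Cb; have uu0 : 0 <= u + u by exact: addr_ge0.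
    have [c Cc] := exC (u + u) uu0 ut.
    have := IH _ _ uu0 ut Cc; have := addC _ _ _ _ _ u0 u0 Cb Cb Cc.
    rewrite !ler_norml => /andP[? ?] /andP[? ?]; apply/andP; split; lra.
  have [st2|ts2] := leP (s + s) t.
    by apply: le_trans (half _ _ s0 st2 Ca) _; lra.
  have [b Cb] := exC (t - s) ltac:(lra) ltac:(lra).
  have [c Cc] := exC t ltac:(lra) ltac:(lra).
  have Hb := half (t - s) b ltac:(lra) ltac:(lra) Cb.
  have Hc : `|c| <= l + l by apply: bndC Cc _; lra.
  have := addC _ _ a b c s0 (ltac:(lra) : 0 <= t - s) Ca Cb.
  rewrite addrC subrK => /(_ Cc); move: Hb Hc.
  rewrite !ler_norml => /andP[? ?] /andP[? ?] /andP[? ?].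
  by apply/andP; split; lra.
have [a Ca] := exC h h0 ht.
have a15 : `|a| <= 15 * l.
  pose n := (Num.trunc (B / l)).+1.
  apply: le_trans (step n h a h0 ht Ca) _.
  suff : B / 2 ^+ n <= l by lra.
  rewrite ler_pdivrMr ?exprn_gt0// mulrC -ler_pdivrMr//.
  apply: le_trans (ltW (archimedean.Num.Theory.truncnS_gt _)) _.
  by rewrite -natrX ler_nat ltnW// ltn_expl.
apply: le_lt_trans Ca; apply: le_oprob => w /= hw.
have := ler_normB (X h w) (- a); have := ler_normD (X h w - a) a.
rewrite subrK; lra.
Qed.

End levy_maximal.

(** * Infinitely divisible random measures *)

Section convergence_in_probability.
Context (R : realType) (disp : measure_display) (T : measurableType disp).
Variable P : probability T R.

Lemma ae_cvg_oprob (X : nat -> T -> R) (Y : T -> R) (x e : R) :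
  (forall n, measurable_fun setT (X n)) -> measurable_fun setT Y ->
  {ae P, forall w, X n w @[n --> \oo] --> Y w} -> 0 < x -> 0 < e ->
  exists N, forall n, (N <= n)%N -> oprob P [set w | x < `|X n w - Y w|] <= e.
Proof.
move=> mX mY XY x0 e0.
pose G k := [set w | x < `|X k w - Y w|]; pose F n := \bigcup_(k in [set k | (n <= k)%N]) G k.
have [||||N hN] := @oprob_cvg0_mono _ _ _ P F e.
- by move=> n w [k /= /ltnW nk Gk]; exists k.
- move=> n; apply: bigcup_measurable => k _.
  by apply: measurable_norm_gt; exact: measurable_funB.
- apply/eqP; rewrite eq_le oprob_ge0 andbT -(oprob_ae XY); apply: le_oprob.
  move=> w Fw /cvgrPdist_lt /(_ _ x0)[N _ hN]; have [k /= Nk Gk] := Fw N I.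
  by have := hN k Nk; rewrite /= distrC ltNge ltW.
- exact: e0.
exists N => n Nn; apply: le_trans hN; apply: le_oprob => w Gw.
by exists n.
Qed.

Lemma tight (X : T -> R) (e : R) : measurable_fun setT X -> 0 < e ->
  exists2 l : R, 0 < l & oprob P [set w | l < `|X w|] < e.
Proof.
move=> mX e0; have [||||n hn] := @oprob_cvg0 _ _ _ P
  (fun n => [set w | n.+1%:R < `|X w|]) (e / 2).
- by move=> n; exact: measurable_norm_gt.
- by move=> n w /=; apply: lt_trans; rewrite ltr_nat.
- rewrite -subset0 => w /(_ (Num.trunc `|X w|) I) /=.
  by rewrite ltNge ltW// archimedean.Num.Theory.truncnS_gt.
- exact: divr_gt0.
exists n.+1%:R => //; apply: le_lt_trans hn _; rewrite ltr_pdivrMr//; lra.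
Qed.

End convergence_in_probability.

(** Summation by parts: monotone coefficients bounded by [dl] have total variation at most 2dl, and
    the boundary term contributes another dl. *)
Lemma sorted_abel (R : realType) (b X : nat -> R) (n : nat) (dl y : R) :
  (forall i, (i < n)%N -> b i.+1 <= b i) -> (forall i, (i <= n)%N -> `|b i| <= dl) ->
  (forall k, (k <= n.+1)%N -> `|\sum_(i < k) X i| <= y) ->
  `|\sum_(i < n.+1) b i * X i| <= 3 * dl * y.
Proof.
move=> nb bdl Sy.
have y0 : 0 <= y by apply: le_trans (Sy 0%N isT).
suff : `|\sum_(i < n.+1) b i * X i - b n * \sum_(i < n.+1) X i| <= (b 0%N - b n) * y.
  move=> h.
  have bS : `|b n * \sum_(i < n.+1) X i| <= dl * y.
    by rewrite normrM; apply: ler_pM => //; [exact: bdl|exact: Sy].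
  have bb : (b 0%N - b n) * y <= (dl + dl) * y.
    apply: ler_wpM2r => //; have := bdl n (leqnn n); have := bdl 0%N (leq0n n).
    by rewrite !ler_norml; lra.
  have := ler_normD (\sum_(i < n.+1) b i * X i - b n * \sum_(i < n.+1) X i)
    (b n * \sum_(i < n.+1) X i).
  by rewrite subrK; lra.
have {bdl} : forall k, (k <= n)%N -> `|\sum_(i < k.+1) b i * X i - b k * \sum_(i < k.+1) X i|
    <= (b 0%N - b k) * y.
  elim=> [_|k IH kn].
    by rewrite !big_ord_recl !big_ord0 !addr0 !subrr normr0 mul0r.
  rewrite 2!(big_ord_recr k.+1)/=.
  set A := \sum_(i < k.+1) b i * X i in IH *; set S := \sum_(i < k.+1) X i in IH *.
  rewrite (_ : _ - _ = (A - b k * S) + (b k - b k.+1) * S); last by ring.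
  apply: le_trans (ler_normD _ _) _.
  rewrite (_ : _ * y = (b 0%N - b k) * y + (b k - b k.+1) * y); last by ring.
  apply: lerD; first exact/IH/ltnW.
  rewrite normrM ger0_norm ?subr_ge0 ?nb//; apply: ler_wpM2l.
    by rewrite subr_ge0 nb.
  by apply: Sy; exact: ltnW.
by apply.
Qed.

Section bounded_borel_sets.
Context (R : realType) (d : nat) (O : set 'rV[R]_d).
Local Notation E := 'rV[R]_d.
Local Notation bmeas A := (@measurable _ (borelType E) A).

Lemma bmeas_open (A : set E) : open A -> bmeas A.
Proof. by move=> oA; exact: sub_sigma_algebra. Qed.

Lemma bmeas_closed (A : set E) : closed A -> bmeas A.
Proof.
move=> cA; rewrite -[A]setCK; apply: measurableC; apply: bmeas_open.
by apply: closed_openC.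
Qed.

Lemma Bb_meas A : Bb O A -> bmeas A. Proof. by case. Qed.

Lemma Bb_sub A B : Bb O A -> bmeas B -> B `<=` A -> Bb O B.
Proof.
move=> [mA cA AO] mB BA; have cBA := closure_subset BA; split=> //.
  by apply: subclosed_compact cBA; first exact: closed_closure.
exact: subset_trans AO.
Qed.

Lemma BbO A : Bb O A -> A `<=` O.
Proof. by move=> [_ _]; apply: subset_trans; exact: subset_closure. Qed.

Lemma Bb0 : Bb O set0.
Proof. by split=> //; rewrite closure0//; exact: compact0. Qed.

Lemma BbU A B : Bb O A -> Bb O B -> Bb O (A `|` B).
Proof.
move=> [mA cA AO] [mB cB BO]; split; first exact: measurableU.
  by rewrite closureU; exact: compactU.
by rewrite closureU => x [/AO|/BO].
Qed.

Lemma Bb_compact K : compact K -> K `<=` O -> Bb O K.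
Proof.
move=> cK KO; have clK : closed K by apply: compact_closed => //; exact: norm_hausdorff.
by split; [exact: bmeas_closed| |]; rewrite -(proj1 (closure_id _) clK).
Qed.

End bounded_borel_sets.

(** * Consequences of countable additivity *)

Section random_measure.
Context (R : realType) (disp : measure_display) (T : measurableType disp).
Variable P : probability T R.
Context (d : nat).
Local Notation E := 'rV[R]_d.
Variables (O : set E) (m : set E -> {RV P >-> R}).
Local Notation bmeas A := (@measurable _ (borelType E) A).
Hypothesis Hm : infdiv_random_measure O m.

Let mRV A : measurable_fun setT (m A : T -> R). Proof. exact: measurable_funPT. Qed.

Lemma rm_sigma_additive (A : nat -> set E) : (forall k, Bb O (A k)) ->
  trivIset setT A -> Bb O (\bigcup_k A k) ->
  {ae P, forall w, (\sum_(k < n) m (A k) w) @[n --> \oo] --> m (\bigcup_k A k) w}.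
Proof.
move=> bA tA bU; have [/(_ _ bA tA) [_ /(_ bU)] + _] := Hm.
apply: filterS => w; apply: cvg_trans.
rewrite (_ : (fun n => _) = fun n => \sum_(0 <= k < n) m (A k) w)//.
by apply/funext => n; rewrite big_mkord.
Qed.

(** The empty set is a disjoint union of copies of itself, so a series with constant terms converges
    almost surely and its terms must vanish. *)
Lemma rm_set0 : {ae P, forall w, m set0 w = 0}.
Proof.
have := rm_sigma_additive (fun=> Bb0 O) (@trivIset_set0 _ _ _).
rewrite bigcup0// => /(_ (Bb0 O)).
apply: filterS => w h; have : cvgn (series (fun=> m set0 w)).
  apply/cvg_ex; exists (m set0 w); apply: cvg_trans h.
  rewrite (_ : series _ = fun n => \sum_(k < n) m set0 w)//.
  by apply/funext => n; rewrite /series /= big_mkord.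
move=> /cvg_series_cvg_0 c0.
by rewrite -(cvg_lim (@norm_hausdorff _ _) c0) lim_cst.
Qed.

Lemma rm_additive A B : Bb O A -> Bb O B -> A `&` B = set0 ->
  {ae P, forall w, m (A `|` B) w = m A w + m B w}.
Proof.
move=> bA bB AB0.
have := @rm_sigma_additive (bigcup2 A B) _ _.
rewrite bigcup2E -trivIset_bigcup2 => /(_ _ AB0 (BbU bA bB)) h.
have {h} := h _; move=> /(_ ltac:(by case=> [|[|k]] //=; exact: Bb0)).
have := rm_set0; apply: filterS2 => w m0 h.
apply: (cvg_unique _ h) => //; apply: cvg_near_cst.
exists 2%N => // n /= n2; rewrite -(subnKC n2) !big_ord_recl/= addrA.
by rewrite big1 ?addr0.
Qed.

Definition seqU (I : eqType) (s : seq I) (F : I -> set E) : set E :=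
  [set x | exists2 i, i \in s & F i x].

Lemma seqU_cons (I : eqType) i (s : seq I) F : seqU (i :: s) F = F i `|` seqU s F.
Proof.
apply/seteqP; split=> x /=.
  by move=> [j]; rewrite inE => /orP[/eqP->|js] Fx; [left|right; exists j].
by move=> [Fx|[j js Fx]]; [exists i; rewrite ?mem_head|exists j; rewrite // inE js orbT].
Qed.

Lemma Bb_seqU (I : eqType) (s : seq I) F : (forall i, i \in s -> Bb O (F i)) ->
  Bb O (seqU s F).
Proof.
elim: s => [_|i s IH bF].
  by rewrite (_ : seqU _ _ = set0); [exact: Bb0|rewrite -subset0 => x []].
rewrite seqU_cons; apply: BbU; first by apply: bF; rewrite mem_head.
by apply: IH => j js; apply: bF; rewrite inE js orbT.
Qed.

Lemma rm_seq_additive (I : eqType) (s : seq I) (F : I -> set E) : uniq s ->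
  (forall i, i \in s -> Bb O (F i)) ->
  (forall i j, i \in s -> j \in s -> i != j -> F i `&` F j = set0) ->
  {ae P, forall w, m (seqU s F) w = \sum_(i <- s) m (F i) w}.
Proof.
elim: s => [_ _ _|i s IH /= /andP[ins us] bF tF].
  rewrite (_ : seqU _ _ = set0); last by rewrite -subset0 => x [].
  by have := rm_set0; apply: filterS => w ->; rewrite big_nil.
rewrite seqU_cons.
have bF' j : j \in s -> Bb O (F j) by move=> js; apply: bF; rewrite inE js orbT.
have h0 : F i `&` seqU s F = set0.
  rewrite -subset0 => x [Fi [j js Fj]]; have : (F i `&` F j) x by [].
  rewrite tF ?mem_head ?inE ?js ?orbT//.
  by apply: contraNneq ins => ->.
have h1 := rm_additive (bF i (mem_head _ _)) (Bb_seqU bF') h0.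
have tF' j k : j \in s -> k \in s -> j != k -> F j `&` F k = set0.
  by move=> js ks; apply: tF; rewrite inE ?js ?ks orbT.
have h2 := IH us bF' tF'; apply: filterS2 h1 h2 => w -> ->.
by rewrite big_cons.
Qed.

Lemma rm_continuous_below (F : nat -> set E) : (forall n, Bb O (F n)) ->
  (forall n, F n `<=` F n.+1) -> Bb O (\bigcup_n F n) ->
  {ae P, forall w, m (F n) w @[n --> \oo] --> m (\bigcup_n F n) w}.
Proof.
move=> bF ndF bU.
have hF : {homo F : n k / (n <= k)%N >-> (n <= k)%O}.
  by apply/nondecreasing_seqP => n; exact/subsetPset.
have bD k : Bb O (seqD F k).
  case: k => [|k]/=; first exact: bF.
  apply: (Bb_sub (bF k.+1)); last exact: subDsetl.
  by apply: measurableD; apply: Bb_meas; exact: bF.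
have tD := trivIset_seqD hF.
have := rm_sigma_additive bD tD; rewrite eq_bigcup_seqD => /(_ bU) h1.
have h2 : {ae P, forall w, forall n, m (F n) w = \sum_(k < n.+1) m (seqD F k) w}.
  apply/ae_foralln => n.
  have tD' i j : i \in iota 0 n.+1 -> j \in iota 0 n.+1 -> i != j ->
      seqD F i `&` seqD F j = set0.
    by move=> _ _ ij; move/trivIsetP : tD => /(_ _ _ _ _ ij); exact.
  have := rm_seq_additive (iota_uniq 0 n.+1) (fun i _ => bD i) tD'.
  rewrite (_ : seqU _ _ = F n).
    apply: filterS => w ->.
    by rewrite -(big_mkord xpredT (fun k => m (seqD F k) w)) /index_iota subn0.
  rewrite -(nondecreasing_bigsetU_seqD n hF) -bigcup_mkord.
  apply/seteqP; split=> x [k].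
    by rewrite mem_iota => /andP[_ kn] Fk; exists k.
  by move=> kn Fk; exists k => //; rewrite mem_iota.
apply: filterS2 h1 h2 => w h1 h2; rewrite (funext h2).
by rewrite (cvg_shiftS (fun n => \sum_(k < n) m (seqD F k) w)).
Qed.

(** The terms of an almost surely convergent series tend to 0. The proofs by contradiction below
    construct disjoint sets that violate this. *)
Lemma rm_exhaustive (D : nat -> set E) (x e : R) : (forall n, Bb O (D n)) ->
  trivIset setT D -> Bb O (\bigcup_n D n) -> 0 < x -> 0 < e ->
  exists N, forall n, (N <= n)%N -> oprob P [set w | x < `|m (D n) w|] <= e.
Proof.
move=> bD tD bU x0 e0.
have [|||N hN] := @ae_cvg_oprob _ _ _ P (fun n => m (D n)) (cst 0) x e _ _ _ x0 e0.
- by move=> n; exact: mRV.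
- exact: measurable_cst.
- have := rm_sigma_additive bD tD bU; apply: filterS => w h.
  have : cvgn (series (fun k => m (D k) w)).
    apply/cvg_ex; exists (m (\bigcup_n D n) w); apply: cvg_trans h.
    rewrite (_ : series _ = fun n => \sum_(k < n) m (D k) w)//.
    by apply/funext => n; rewrite /series /= big_mkord.
  exact: cvg_series_cvg_0.
exists N => n Nn; apply: le_trans (hN n Nn).
by apply: le_oprob => w /=; rewrite subr0.
Qed.

End random_measure.

Lemma nonincreasing_subset (T : Type) (B : nat -> set T) n k :
  (forall n, B n.+1 `<=` B n) -> (n <= k)%N -> B k `<=` B n.
Proof.
move=> dB nk; rewrite -(subnK nk); elim: (k - n)%N => // j IH.
by apply: subset_trans IH; exact: dB.
Qed.

(** * Estimates uniform over all subsets of a bounded set *)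

Section random_measure_estimates.
Context (R : realType) (disp : measure_display) (T : measurableType disp).
Variable P : probability T R.
Context (d : nat).
Local Notation E := 'rV[R]_d.
Variables (O : set E) (m : set E -> {RV P >-> R}).
Local Notation bmeas A := (@measurable _ (borelType E) A).
Hypothesis Hm : infdiv_random_measure O m.

Let mRV A : measurable_fun setT (m A : T -> R). Proof. exact: measurable_funPT. Qed.

Lemma rm_split A C : Bb O A -> bmeas C ->
  {ae P, forall w, m A w = m (A `\` C) w + m (A `&` C) w}.
Proof.
move=> bA mC; have mA := Bb_meas bA.
have e : (A `\` C) `|` (A `&` C) = A.
  apply/seteqP; split=> x; first by case=> -[].
  by move=> Ax; have [|] := pselect (C x); [right|left].
rewrite -[X in {ae P, forall w, m X w = _}]e; apply: (rm_additive Hm).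
- by apply: (Bb_sub bA); [exact: measurableD|exact: subDsetl].
- by apply: (Bb_sub bA); [exact: measurableI|exact: subIsetl].
- by rewrite -subset0 => x [[_ h] [_]].
Qed.

(** Otherwise each [B n] contains some [A n] on which [m] is not small. Removing a later [B k] from
    [A n] changes [m] little, since what is removed in the limit lies in the null intersection; the
    remainders, taken along a fast subsequence, are disjoint and contradict [rm_exhaustive]. *)
Lemma rm_order_continuous (B : nat -> set E) F (x e : R) : Bb O F ->
  B 0%N `<=` F -> (forall n, bmeas (B n)) -> (forall n, B n.+1 `<=` B n) ->
  (forall A, bmeas A -> A `<=` \bigcap_n B n -> {ae P, forall w, m A w = 0}) ->
  0 < x -> 0 < e ->
  exists n, forall A, bmeas A -> A `<=` B n -> oprob P [set w | x < `|m A w|] <= e.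
Proof.
move=> bF BF mB dB B0 x0 e0; apply: contrapT => /forallNP nex.
have Bmono n k : (n <= k)%N -> B k `<=` B n by exact: nonincreasing_subset.
have bB A n : bmeas A -> A `<=` B n -> Bb O A.
  move=> mA AB; apply: (Bb_sub bF) => //; apply: subset_trans BF.
  exact: subset_trans (Bmono _ _ (leq0n n)).
have /choice[A hA] (n : nat) : exists A,
    [/\ bmeas A, A `<=` B n & e < oprob P [set w | x < `|m A w|]].
  apply: contrapT => h; apply: (nex n) => A mA AB.
  by rewrite leNgt; apply/negP => lt_e; apply: h; exists A.
pose C := \bigcap_n B n.
have mC : bmeas C by exact: bigcapT_measurable.
have /choice[g hg] (n : nat) : exists k, (n < k)%N /\
    e / 2 <= oprob P [set w | x / 2 < `|m (A n `\` B k) w|].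
  have [mA AB eA] := hA n.
  have mAD D : bmeas D -> bmeas (A n `\` D) by exact: measurableD.
  have bAD D : bmeas D -> Bb O (A n `\` D).
    by move=> mD; apply: (bB _ n); [exact: mAD|exact: subset_trans AB].
  have UE : \bigcup_k (A n `\` B k) = A n `\` C.
    apply/seteqP; split=> [y [k _ [Ay nB]]|y [Ay nC]].
      by split=> // Cy; apply: nB; exact: Cy.
    apply: contrapT => nU; apply: nC => j _.
    by apply: contrapT => nB; apply: nU; exists j.
  have cv := @rm_continuous_below _ _ _ P _ O m Hm (fun k => A n `\` B k)
    (fun k => bAD _ (mB k)) _ _.
  have {}cv : {ae P, forall w, m (A n `\` B k) w @[k --> \oo] --> m (A n `\` C) w}.
    rewrite -UE; apply: cv; first by move=> k; apply: setDS; exact: dB.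
    by rewrite UE; exact: bAD.
  have [|N hN] := @ae_cvg_oprob _ _ _ P (fun k => m (A n `\` B k)) (m (A n `\` C))
    (x / 2) (e / 2) (fun k => mRV _) (mRV _) cv (divr_gt0 x0 (ltr0n _ 2)).
    exact: divr_gt0.
  exists (maxn N n.+1); split; first by rewrite leq_max leqnn orbT.
  set k := maxn _ _.
  have [_ h1] := (tt, rm_split (bB _ _ mA AB) mC).
  have h2 := B0 _ (measurableI _ _ mA mC) (@subIset _ _ _ _ (or_intror (fun=> id))).
  have h3 : oprob P [set w | x < `|m (A n) w|] <=
      oprob P ([set w | x / 2 < `|m (A n `\` B k) w|] `|`
               [set w | x / 2 < `|m (A n `\` B k) w - m (A n `\` C) w|]).
    apply: le_oprob_ae; apply: filterS2 h1 h2 => w /= -> ->; rewrite addr0.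
    move=> hx; have [|h] := ltP (x / 2) `|m (A n `\` B k) w|; [by left|right].
    have := ler_distD (m (A n `\` B k) w) (m (A n `\` C) w) 0.
    by rewrite !subr0 distrC; lra.
  have := le_trans h3 (oprobU _ _ _); have := hN k (leq_maxl _ _); lra.
(* Each piece avoids [B (ni i.+1)], which contains all later pieces. *)
pose ni i := iter i g 0%N; pose D i := A (ni i) `\` B (ni i.+1).
have ni_mono i j : (i < j)%N -> (ni i.+1 <= ni j)%N.
  move=> ij; rewrite -(subnK ij); elim: (j - i.+1)%N => // k IH.
  by apply: leq_trans IH _; rewrite addSn /= ltnW//; case: (hg (ni (k + i.+1)%N)).
have bD i : Bb O (D i).
  have [mA AB _] := hA (ni i); apply: (bB _ (ni i)); first exact: measurableD.
  by move=> y [/AB].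
have tD : trivIset setT D.
  apply: ltn_trivIset => n i ni_; rewrite -subset0 => y [[_ nB] [Any _]].
  by apply: nB; have [_ AB _] := hA (ni n); exact: (Bmono _ _ (ni_mono _ _ ni_) _ (AB _ Any)).
have bU : Bb O (\bigcup_i D i).
  apply: (Bb_sub bF); first by apply: bigcupT_measurable => i; exact: Bb_meas.
  move=> y [i _ [Ay _]]; apply/BF/(Bmono _ (ni i) (leq0n _)).
  by have [_ AB _] := hA (ni i); exact: AB.
have [||N hN] := rm_exhaustive Hm bD tD bU (_ : 0 < x / 2) (_ : 0 < e / 4).
- exact: divr_gt0.
- exact: divr_gt0.
have := hN N (leqnn N); have [_] := hg (ni N); rewrite -/(D N); lra.
Qed.


(** [m F] is the sum of the independent variables [m A] and [m (F \ A)], so a bound on [m F]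
    concentrates [m A] around a constant. *)
Lemma rm_concentration A F (l q : R) : Bb O F -> bmeas A -> A `<=` F ->
  oprob P [set w | l < `|m F w|] < q ->
  exists a, oprob P [set w | l < `|m A w - a|] < q.
Proof.
move=> bF mA AF hq.
have bA := Bb_sub bF mA AF.
have bD : Bb O (F `\` A).
  by apply: (Bb_sub bF); [exact: measurableD (Bb_meas bF) mA|exact: subDsetl].
apply: (@concentration _ _ _ P (m A) (m (F `\` A))) => //.
  move=> B C mB mC; have [/(_ (bigcup2 A (F `\` A))) + _] := Hm.
  case=> [[|[|k]]//||ind _]; first exact: Bb0.
    by rewrite -trivIset_bigcup2 setDIK.
  have := ind [:: 0%N; 1%N] (fun i => if i is 0%N then B else C) isT.
  rewrite !big_cons big_nil mule1/= => <-; last first.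
    by case=> [|i]; rewrite borel_measurableE.
  congr (P _); apply/seteqP; split=> w.
    by move=> [Bw Cw] i /=; rewrite !inE => /orP[]/eqP->.
  by move=> h; split; [apply: (h 0%N)|apply: (h 1%N)]; rewrite /= !inE.
apply: le_lt_trans hq; apply: le_oprob_ae.
have := rm_split bF mA; apply: filterS => w /= ->.
by rewrite setIidr// addrC.
Qed.

(* The centres [a A] of the laws of [m A] given by [rm_concentration] are
   additive in [A] up to a bounded error; were they unbounded, one could split
   off disjoint sets on which [m] does not tend to 0. *)
Lemma rm_bounded_range F (e : R) : Bb O F -> 0 < e -> exists2 x : R, 0 < x &
  forall A, bmeas A -> A `<=` F -> oprob P [set w | x < `|m A w|] <= e.
Proof.
move=> bF e0; pose q := Num.min e 4^-1.
have q0 : 0 < q by rewrite lt_min e0 /=; lra.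
have qe : q <= e by rewrite ge_min lexx.
have q4 : q <= 4^-1 by rewrite ge_min lexx orbT.
have [l l0 hl] := tight P (mRV F) q0.
have /choice[a ha] (A : set E) : exists a : R, bmeas A -> A `<=` F ->
  oprob P [set w | l < `|m A w - a|] < q.
  have [[mA AF]|nA] := pselect (bmeas A /\ A `<=` F).
    by have [a ha] := rm_concentration bF mA AF hl; exists a.
  by exists 0 => mA AF; exfalso; apply: nA.
have aD (A C : set E) : bmeas A -> A `<=` F -> bmeas C ->
    `|a A - a (A `\` C) - a (A `&` C)| <= 3 * l.
  move=> mA AF mC.
  have mAC := measurableD mA mC; have mAI := measurableI _ _ mA mC.
  have ADF : A `\` C `<=` F by move=> x [/AF].
  have AIF : A `&` C `<=` F by move=> x [/AF].
  have h := rm_split (Bb_sub bF mA AF) mC.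
  have hA : oprob P [set w | l < `|m (A `\` C) w + m (A `&` C) w - a A|] < q.
    apply: le_lt_trans (ha A mA AF); apply: le_oprob_ae.
    by apply: filterS h => w /= ->.
  have [|w [/negP + /negP + /negP]] := @oprob_lt1_ex3 _ _ _ P
      [set w | l < `|m (A `\` C) w + m (A `&` C) w - a A|]
      [set w | l < `|m (A `\` C) w - a (A `\` C)|]
      [set w | l < `|m (A `&` C) w - a (A `&` C)|].
    by have := ha _ mAC ADF; have := ha _ mAI AIF; lra.
  rewrite -!leNgt !ler_norml => /andP[? ?] /andP[? ?] /andP[? ?].
  by apply/andP; split; lra.
pose unb (B : set E) := forall C : R, exists A, [/\ bmeas A, A `<=` B & (C < `|a A|)%R].
have [unbF|] := pselect (unb F); last first.
  move=> /existsNP[C nC]; have {}nC A : bmeas A -> A `<=` F -> `|a A| <= C.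
    by move=> mA AF; rewrite leNgt; apply/negP => h; apply: nC; exists A.
  have C0 : 0 <= C by apply: le_trans (nC set0 _ _).
  exists (C + l); first exact: ltr_pwDr.
  move=> A mA AF; apply: le_trans qe; apply/ltW.
  apply: le_lt_trans (ha A mA AF); apply: le_oprob => w /=.
  have := nC A mA AF; have := ler_normD (m A w - a A) (a A); rewrite subrK; lra.
exfalso.
(* If the centres are unbounded on subsets of [B], some [A] in [B] has a centre so large that, by
   near-additivity, [B \ A] has a large centre too. At least one of [A] and [B \ A] still has
   unbounded centres; it is kept, and the other one is split off. *)
have stp (B : set E) : exists B' : set E, bmeas B -> B `<=` F -> unb B ->
    [/\ bmeas B', B' `<=` B, unb B' & l + 1 < `|a (B `\` B')|].
  have [[mB BF uB]|nB] := pselect [/\ bmeas B, B `<=` F & unb B]; last first.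
    by exists set0 => mB BF uB; exfalso; apply: nB.
  have [A [mA AB hA]] := uB (`|a B| + 3 * l + (l + 1)).
  have mBA := measurableD mB mA.
  have hBA : l + 1 < `|a (B `\` A)|.
    have := aD B A mB BF mA; rewrite (setIidr AB) => h.
    have := ler_distD (a B - a (B `\` A)) (a A) 0.
    rewrite subr0 distrC; have := ler_normB (a B) (a (B `\` A)).
    rewrite subr0; lra.
  have [uA|nuA] := pselect (unb A).
    by exists A => _ _ _; split.
  exists (B `\` A) => _ _ _; split=> //; last first.
    by rewrite setDD (setIidr AB); move: hA; have := normr_ge0 (a B); lra.
  move=> C; have /existsNP[C' nC'] := nuA.
  have [A' [mA' A'B hA']] := uB (C + C' + 3 * l).
  exists (A' `\` A); split; [exact: measurableD|exact: setSD|].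
  have h1 : `|a (A' `&` A)| <= C'.
    rewrite leNgt; apply/negP => h; apply: nC'; exists (A' `&` A).
    by split=> //; exact: measurableI.
  have := aD A' A mA' (subset_trans A'B BF) mA.
  have := ler_distD (a (A' `\` A) + a (A' `&` A)) (a A') 0.
  have := ler_normD (a (A' `\` A)) (a (A' `&` A)).
  by rewrite !subr0 opprD addrA; lra.
have /choice[g hg] := stp.
pose B n := iter n g F.
have hB n : [/\ bmeas (B n), B n `<=` F & unb (B n)].
  elim: n => [|n [mB BF uB]]; first by split=> //; exact: Bb_meas bF.
  by have [mB' B'B uB' _] := hg _ mB BF uB; split=> //; exact: subset_trans BF.
have hD n : B n.+1 `<=` B n /\ l + 1 < `|a (B n `\` B n.+1)|.
  by have [mB BF uB] := hB n; have [_ B'B _ h] := hg _ mB BF uB.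
pose D n := B n `\` B n.+1.
have mD n : bmeas (D n).
  by have [? _ _] := hB n; have [? _ _] := hB n.+1; exact: measurableD.
have DF n : D n `<=` F by have [_ BF _] := hB n; move=> x [/BF].
have bD n : Bb O (D n) by exact: (Bb_sub bF).
have tD : trivIset setT D.
  apply: ltn_trivIset => n k kn; rewrite -subset0 => x [[_ nB] [Bn _]].
  by apply: nB; apply: (nonincreasing_subset (fun k => (hD k).1) kn).
have bU : Bb O (\bigcup_i D i).
  apply: (Bb_sub bF); first exact: bigcupT_measurable.
  by move=> x [i _]; exact: DF.
have [N hN] := rm_exhaustive Hm bD tD bU ltr01 (ltac:(lra) : 0 < 4^-1).
(* At a common point |m (D N)| <= 1 and [m (D N)] is within [l] of its centre, which exceeds l + 1
   in absolute value. *)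
have [|w [/negP + /negP + _]] := @oprob_lt1_ex3 _ _ _ P
    [set w | 1 < `|m (D N) w|] [set w | l < `|m (D N) w - a (D N)|] set0.
  rewrite oprob0; have := hN N (leqnn N); have := ha (D N) (mD N) (@DF N); lra.
rewrite -!leNgt; have [_] := hD N; rewrite -/(D N).
have := ler_distD (m (D N) w) (a (D N)) 0; rewrite !subr0 distrC; lra.
Qed.

End random_measure_estimates.

(** * Simple functions and a contraction principle *)

Section simple_functions.
Context (R : realType) (disp : measure_display) (T : measurableType disp).
Variable P : probability T R.
Context (d : nat).
Local Notation E := 'rV[R]_d.
Local Notation bmeas A := (@measurable _ (borelType E) A).

(* Simple functions as lists of (coefficient, set), the sets being possibly not
   disjoint. *)
Definition leval (s : seq (R * set E)) (x : E) : R :=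
  \sum_(p <- s) p.1 * \1_(p.2) x.

Definition lint (m : set E -> {RV P >-> R}) (s : seq (R * set E)) (w : T) : R :=
  \sum_(p <- s) p.1 * m p.2 w.

Variables (O : set E) (m : set E -> {RV P >-> R}).
Hypothesis Hm : infdiv_random_measure O m.

Let mRV A : measurable_fun setT (m A : T -> R). Proof. exact: measurable_funPT. Qed.

Section atoms.
Variables (s : seq (R * set E)) (F : set E).
Hypotheses (bF : Bb O F) (sF : forall p, p \in s -> bmeas p.2 /\ p.2 `<=` F).
Let n := size s.
Let al (i : 'I_n) := (tnth (in_tuple s) i).1.
Let A (i : 'I_n) := (tnth (in_tuple s) i).2.
Let mA i : bmeas (A i). Proof. by case: (sF (mem_tnth i (in_tuple s))). Qed.
Let AF i : A i `<=` F. Proof. by case: (sF (mem_tnth i (in_tuple s))). Qed.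

(** An atom of the algebra generated by the sets of [s] is indexed by the positions of the sets that
    contain it, so repeated sets do no harm. The empty index stands for the complement of their
    union. *)
Definition atom_tag (x : E) : {set 'I_n} := finset (fun i => x \in A i).
Definition atom (J : {set 'I_n}) : set E := [set x | atom_tag x = J].
Definition atom_value (J : {set 'I_n}) : R := \sum_(i in J) al i.

Lemma atomP (J : {set 'I_n}) x i : atom J x -> (i \in J) = (x \in A i).
Proof. by move=> <-; rewrite /atom_tag finset.in_set. Qed.

Lemma atom_meas J : bmeas (atom J).
Proof.
rewrite (_ : atom J = \bigcap_(i in [set: 'I_n]) (if i \in J then A i else ~` A i)).
  apply: fin_bigcap_measurable; first exact: finite_finset.
  by move=> i _; case: ifP => _; [|apply: measurableC].
apply/seteqP; split=> x.
  move=> xJ i _; rewrite (atomP i xJ); case: ifPn; rewrite ?notin_setE//.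
  by rewrite inE.
move=> h; apply/finset.setP => i; rewrite finset.in_set.
by have := h i I; case: ifPn => _ hi; [rewrite mem_set|apply/negbTE; rewrite notin_setE].
Qed.

Lemma atom_disjoint J K : J != K -> atom J `&` atom K = set0.
Proof. by move=> JK; rewrite -subset0 => x [xJ xK]; move: JK; rewrite -xJ -xK eqxx. Qed.

Lemma atom_sub (J : {set 'I_n}) i : i \in J -> atom J `<=` A i.
Proof. by move=> iJ x xJ; move: iJ; rewrite (atomP i xJ) inE. Qed.

Lemma atom_subF J : J != finset.set0 -> atom J `<=` F.
Proof.
by move=> /finset.set0Pn[i iJ]; apply: subset_trans (AF (i := i)); exact: atom_sub.
Qed.

Lemma leval_atom J x : atom J x -> leval s x = atom_value J.
Proof.
move=> xJ; rewrite /leval big_tnth /atom_value [RHS]big_mkcond /=; apply: eq_bigr => i _.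
by rewrite indicE (atomP i xJ); case: (_ \in _); rewrite ?mulr1 ?mulr0.
Qed.

(** Sorted by decreasing value for the summation by parts. Empty atoms are dropped so that every
    listed value is attained by [leval s], and hence inherits its bound. *)
Definition atom_list : seq {set 'I_n} :=
  sort (fun J K => atom_value K <= atom_value J)
    [seq J <- enum {set 'I_n} | (J != finset.set0) && `[< atom J !=set0 >]].

Lemma mem_atom_list (J : {set 'I_n}) : (J \in atom_list) =
  (J != finset.set0) && `[< atom J !=set0 >].
Proof. by rewrite mem_sort mem_filter mem_enum andbT. Qed.

Lemma uniq_atom_list : uniq atom_list.
Proof. by rewrite sort_uniq filter_uniq// enum_uniq. Qed.

Lemma atom_Bb (J : {set 'I_n}) : J \in atom_list -> Bb O (atom J).
Proof.
by rewrite mem_atom_list => /andP[J0 _]; apply: (Bb_sub bF (atom_meas J)); exact: atom_subF.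
Qed.

Lemma rm_atoms i : {ae P, forall w,
  m (A i) w = \sum_(J <- atom_list | i \in (J : {set 'I_n})) m (atom J) w}.
Proof.
have := @rm_seq_additive _ _ _ P _ O m Hm _ [seq J : {set 'I_n} <- atom_list | i \in J] atom.
rewrite filter_uniq ?uniq_atom_list// => /(_ isT).
have Ei : seqU [seq J : {set 'I_n} <- atom_list | i \in J] atom = A i.
  apply/seteqP; split=> x.
    by move=> [J]; rewrite mem_filter => /andP[iJ _]; exact: atom_sub.
  move=> Ax; have iJ : i \in atom_tag x by rewrite finset.in_set mem_set.
  exists (atom_tag x) => //; rewrite mem_filter iJ mem_atom_list /=.
  apply/andP; split; first by apply/finset.set0Pn; exists i.
  by apply/asboolP; exists x.
rewrite Ei => h; have {h} := h _ (fun J K _ _ => atom_disjoint (J := J) (K := K)).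
have bA (J : {set 'I_n}) : J \in [seq J : {set 'I_n} <- atom_list | i \in J] -> Bb O (atom J).
  by rewrite mem_filter => /andP[_]; exact: atom_Bb.
move=> /(_ bA); by apply: filterS => w ->; rewrite big_filter.
Qed.

Lemma lint_atoms : {ae P, forall w,
  lint m s w = \sum_(J <- atom_list) atom_value J * m (atom J) w}.
Proof.
have : {ae P, forall w, forall i, m (A i) w = \sum_(J <- atom_list | i \in (J : {set 'I_n}))
  m (atom J) w}.
  by apply: filter_forall => i; exact: rm_atoms.
apply: filterS => w h; rewrite /lint big_tnth.
under eq_bigr => i _ do rewrite -/(A i) -/(al i) h mulr_sumr.
rewrite (exchange_big_dep xpredT)//=; apply: eq_bigr => J _.
by rewrite mulr_suml.
Qed.

(* The integral against the sorted values is an Abel sum of the partial sums of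
   [m] over the atoms, which are controlled by Etemadi's inequality. *)
Lemma rm_contraction (dl x p : R) : 0 <= x -> (forall y, `|leval s y| <= dl) ->
  (forall B, bmeas B -> B `<=` F -> oprob P [set w | x < `|m B w|] <= p) ->
  oprob P [set w | 3 * dl * (3 * x) < `|lint m s w|] <= 3 * p.
Proof.
move=> x0 hdl hp.
have dl0 : 0 <= dl by apply: le_trans (hdl 0).
have p0 : 0 <= p.
  by apply: le_trans (hp set0 measurable0 _) => //; exact: oprob_ge0.
(* The default [set0] extends the list of atoms to a disjoint sequence, the form in which
   independence is given. *)
pose B k := nth set0 [seq atom J | J <- atom_list] k.
have BE k : (k < size atom_list)%N -> B k = atom (nth finset.set0 atom_list k).
  by move=> kl; rewrite /B (nth_map finset.set0).
have B0 k : (size atom_list <= k)%N -> B k = set0.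
  by move=> kl; rewrite /B nth_default// size_map.
have bB k : Bb O (B k).
  have [kl|kl] := ltnP k (size atom_list); last by rewrite B0//; exact: Bb0.
  by rewrite BE//; apply: atom_Bb; exact: mem_nth.
have BF k : B k `<=` F.
  have [kl|kl] := ltnP k (size atom_list); last by rewrite B0.
  rewrite BE//; apply: atom_subF.
  by have := mem_nth finset.set0 kl; rewrite mem_atom_list => /andP[].
have tB : trivIset setT B.
  apply/trivIsetP => i j _ _ ij.
  have [il|il] := ltnP i (size atom_list); last by rewrite B0// set0I.
  have [jl|jl] := ltnP j (size atom_list); last by rewrite [B j]B0// setI0.
  by rewrite !BE//; apply: atom_disjoint; rewrite nth_uniq// uniq_atom_list.
have [indB _] := Hm.1 B bB tB.
have hS k : (k <= size atom_list)%N ->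
    oprob P [set w | x < `|\sum_(i < k) m (B i) w|] <= p.
  move=> _; have := @rm_seq_additive _ _ _ P _ O m Hm _ (iota 0 k) B (iota_uniq 0 k)
    (fun i _ => bB i) _.
  have h i j : i \in iota 0 k -> j \in iota 0 k -> i != j -> B i `&` B j = set0.
    by move=> _ _; move/trivIsetP : tB => /(_ i j); exact.
  move=> /(_ h) {}h.
  apply: le_trans (hp (seqU (iota 0 k) B) _ _); last 2 first.
  - by apply: Bb_meas; apply: Bb_seqU => i _; exact: bB.
  - by move=> y [i _]; exact: BF.
  apply: le_oprob_ae; apply: filterS h => w /= ->.
  by rewrite -(big_mkord xpredT (fun i => m (B i) w)) /index_iota subn0.
have := etemadi (fun i => mRV (B i)) indB hS; apply: le_trans.
apply: le_oprob_ae; apply: filterS lint_atoms => w /= ->.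
rewrite (big_nth finset.set0) big_mkord => hw.
apply: contrapT => nex; move: hw; apply/negP; rewrite -leNgt.
have Bw k : (k <= size atom_list)%N -> `|\sum_(i < k) m (B i) w| <= 3 * x.
  by move=> kl; rewrite leNgt; apply/negP => h; apply: nex; exists k.
have bv i : (i < size atom_list)%N -> `|atom_value (nth finset.set0 atom_list i)| <= dl.
  move=> il; have := mem_nth finset.set0 il.
  by rewrite mem_atom_list => /andP[_ /asboolP[y /leval_atom <-]].
rewrite (eq_bigr (fun i : 'I__ => atom_value (nth finset.set0 atom_list i) * m (B i) w)).
  move: Bw bv; case E : (size atom_list) => [|N] Bw bv.
    by rewrite big_ord0 normr0; apply: mulr_ge0; apply: mulr_ge0.
  apply: (@sorted_abel _ (fun i => atom_value (nth finset.set0 atom_list i))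
    (fun i => m (B i) w) N dl (3 * x)) => //.
  move=> i iN; have /(sortedP finset.set0) := sort_sorted (leT := fun J K =>
    atom_value K <= atom_value J)
    (fun J K => real_leVge (num_real (atom_value K)) (num_real (atom_value J)))
    [seq J <- enum {set 'I_n} | (J != finset.set0) && `[< atom J !=set0 >]].
  by apply; rewrite -/atom_list E.
by move=> i _; rewrite BE.
Qed.

End atoms.
End simple_functions.

Section list_operations.
Context (R : realType) (d : nat).
Local Notation E := 'rV[R]_d.
Implicit Types s : seq (R * set E).

Definition lscale (c : R) s := [seq (c * p.1, p.2) | p <- s].
Definition lrestr (A : set E) s := [seq (p.1, A `&` p.2) | p <- s].

Lemma leval_cat s s' y : leval (s ++ s') y = leval s y + leval s' y.
Proof. by rewrite /leval big_cat. Qed.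

Lemma leval_scale c s y : leval (lscale c s) y = c * leval s y.
Proof. by rewrite /leval big_map mulr_sumr; apply: eq_bigr => p _ /=; rewrite mulrA. Qed.

Lemma leval_restr A s y : leval (lrestr A s) y = \1_A y * leval s y.
Proof.
by rewrite /leval big_map mulr_sumr; apply: eq_bigr => p _ /=; rewrite indicI mulrCA.
Qed.

Context (disp : measure_display) (T : measurableType disp) (P : probability T R).
Variable m : set E -> {RV P >-> R}.

Lemma lint_cat s s' w : lint m (s ++ s') w = lint m s w + lint m s' w.
Proof. by rewrite /lint big_cat. Qed.

Lemma lint_scale c s w : lint m (lscale c s) w = c * lint m s w.
Proof. by rewrite /lint big_map mulr_sumr; apply: eq_bigr => p _ /=; rewrite mulrA. Qed.

Lemma lint_measurable s : measurable_fun setT (lint m s).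
Proof.
apply: measurable_sum => p; apply: measurable_funM; first exact: measurable_cst.
exact: measurable_funPT.
Qed.

Variables (O F : set E).
Hypotheses (Hm : infdiv_random_measure O m) (bF : Bb O F).
Local Notation bmeas A := (@measurable _ (borelType E) A).

(** [rm_contraction] rescaled; 9 is the product of the factor 3 of the summation by parts and the 3
    of Etemadi's inequality. *)
Lemma lint_small s (x y p : R) : 0 < x ->
  (forall q, q \in s -> bmeas q.2 /\ q.2 `<=` F) ->
  (forall B, bmeas B -> B `<=` F -> oprob P [set w | x < `|m B w|] <= p) ->
  (forall z, `|leval s z| <= y / (9 * x)) ->
  oprob P [set w | y < `|lint m s w|] <= 3 * p.
Proof.
move=> x0 sF hx hs; have := rm_contraction Hm bF sF (ltW x0) hs hx.
rewrite (_ : 3 * _ * _ = y)//; field; lra.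
Qed.

(** The difference of the two lists evaluates to 0, so the contraction estimate applies at level 0,
    with arbitrarily small probability: the integral depends only on the function, not on its
    representation. *)
Lemma lint_eq s s' : (forall q, q \in s -> bmeas q.2 /\ q.2 `<=` F) ->
  (forall q, q \in s' -> bmeas q.2 /\ q.2 `<=` F) ->
  (forall y, leval s y = leval s' y) -> {ae P, forall w, lint m s w = lint m s' w}.
Proof.
move=> sF sF' ss'; apply: ae_oprob; apply/eqP; rewrite eq_le oprob_ge0 andbT.
apply/ler_addgt0Pr => e e0; rewrite add0r.
have e30 : 0 < e / 3 by exact: divr_gt0.
have [x x0 hx] := rm_bounded_range Hm bF e30.
have h : oprob P [set w | 0 < `|lint m (s ++ lscale (- 1) s') w|] <= 3 * (e / 3).
  apply: (lint_small x0 _ hx).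
    by move=> q; rewrite mem_cat => /orP[/sF//|/mapP[q' /sF' h ->]].
  by move=> z; rewrite leval_cat leval_scale ss' mulN1r subrr normr0 mul0r.
apply: le_trans (le_oprob _ _) (le_trans h _); last by lra.
move=> w /= /eqP; rewrite lint_cat lint_scale mulN1r normr_gt0.
by rewrite subr_eq0.
Qed.

End list_operations.

(** * Random signs and sums of squares *)

Section random_signs.
Context (R : realType).
Implicit Types (v : seq R) (S : R).

(* Average of min ((S + \sum_i +- v_i)^2, 1) over all choices of the signs. *)
Fixpoint sign_avg v S : R :=
  if v is a :: v' then (sign_avg v' (S + a) + sign_avg v' (S - a)) / 2
  else Num.min (S ^+ 2) 1.

Lemma sign_avg_ge0 v S : 0 <= sign_avg v S.
Proof.
elim: v S => [|a v IH] S /=; first by rewrite le_min sqr_ge0 ler01.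
by apply: divr_ge0 => //; apply: addr_ge0.
Qed.

(* From min (u, 1) >= la u - (la u)^2 / 4 and the second and fourth moments of
   the Rademacher sum. *)
Lemma sign_avg_moments v S (la : R) : 0 <= la -> la <= 1 ->
  la * (S ^+ 2 + \sum_(a <- v) a ^+ 2) -
  la ^+ 2 * (S ^+ 4 + 6 * S ^+ 2 * (\sum_(a <- v) a ^+ 2) +
             3 * (\sum_(a <- v) a ^+ 2) ^+ 2) / 4 <= sign_avg v S.
Proof.
move=> la0 la1; elim: v S => [|a v IH] S /=.
  rewrite big_nil; set u := S ^+ 2.
  have -> : S ^+ 4 = u ^+ 2 by rewrite -exprM.
  have u0 : 0 <= u by exact: sqr_ge0.
  rewrite le_min; apply/andP; split.
    have : la * u <= u by rewrite ler_piMl.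
    have : 0 <= la ^+ 2 * u ^+ 2 by apply: mulr_ge0; exact: sqr_ge0.
    lra.
  by have := sqr_ge0 (1 - la * u / 2); lra.
rewrite big_cons; set q := \sum_(a <- v) a ^+ 2 in IH *.
have := IH (S + a); have := IH (S - a).
have : 0 <= la ^+ 2 * (a ^+ 2) ^+ 2 by apply: mulr_ge0; exact: sqr_ge0.
lra.
Qed.

(** The choice la = 1/q in [sign_avg_moments] at S = 0 gives 1 - 3/4. *)
Lemma sign_avg_ge v : 1 <= \sum_(a <- v) a ^+ 2 -> 4^-1 <= sign_avg v 0.
Proof.
set q := \sum_(a <- v) _ => q1; have q0 : 0 < q by exact: lt_le_trans q1.
have := @sign_avg_moments v 0 q^-1; rewrite -/q => h.
apply: le_trans (h _ _); last 2 first.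
- by rewrite invr_ge0 ltW.
- by rewrite invf_le1.
rewrite !expr0n /= !mulr0 !add0r mul0r add0r mulVf ?gt_eqF//.
rewrite mulrCA -exprMn mulVf ?gt_eqF// expr1n; lra.
Qed.

End random_signs.

Section paley_zygmund.
Context (R : realType) (d : nat).
Local Notation E := 'rV[R]_d.
Context (disp : measure_display) (T : measurableType disp) (P : probability T R).
Variables (m : set E -> {RV P >-> R}) (O F : set E).
Hypotheses (Hm : infdiv_random_measure O m) (bF : Bb O F).
Local Notation bmeas A := (@measurable _ (borelType E) A).

(** [L] holds the terms whose signs are still averaged, [s] those whose signs are already chosen. *)
Let savg (L s : seq (R * set E)) w := sign_avg [seq p.1 * m p.2 w | p <- L] (lint m s w).

Let savg_cons p L s : savg (p :: L) s =
  fun w => 2^-1 * (savg L (p :: s) w + savg L ((- p.1, p.2) :: s) w).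
Proof.
apply/funext => w; rewrite /savg /= mulrC; congr (_ * (_ + _)); congr sign_avg.
  by rewrite /lint big_cons addrC.
by rewrite /lint big_cons /= mulNr addrC.
Qed.

Let measurable_savg L s : measurable_fun setT (savg L s).
Proof.
elim: L s => [|p L IH] s.
  apply: measurable_minr; last exact: measurable_cst.
  by apply: measurable_funX; exact: lint_measurable.
rewrite savg_cons; apply: measurable_funM; first exact: measurable_cst.
exact: measurable_funD.
Qed.

Let expect_min (X : T -> R) (y : R) : measurable_fun setT X -> 0 <= y ->
  (\int[P]_w (Num.min (X w ^+ 2) 1)%:E <= (oprob P [set w | y < `|X w|] + y ^+ 2)%:E)%E.
Proof.
move=> mX y0; have mA := measurable_norm_gt y mX.
set A := [set w | _] in mA *.
apply: (@le_trans _ _ (\int[P]_w (((\1_A w)%:E + (y ^+ 2)%:E))%E)%E).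
  apply: ge0_le_integral => //.
  - by move=> w _; rewrite lee_fin le_min sqr_ge0 ler01.
  - apply/measurable_EFinP; apply: measurable_minr; last exact: measurable_cst.
    exact: measurable_funX.
  - by apply/emeasurable_funD; apply/measurable_EFinP => //; exact: measurable_indic.
  - move=> w _; rewrite -EFinD lee_fin indicE.
    have [wA|] := boolP (w \in A).
      by rewrite ge_min; apply/orP; right; rewrite lerDl sqr_ge0.
    rewrite notin_setE /A /= => /negP; rewrite -leNgt => Xy.
    rewrite add0r ge_min; apply/orP; left.
    by rewrite -[X w ^+ 2]real_normK ?num_real// lerXn2r// nnegrE.
rewrite ge0_integralD//; last 2 first.
- by apply/measurable_EFinP; exact: measurable_indic.
- by move=> w _; rewrite lee_fin sqr_ge0.
rewrite integral_indic// setIT integral_cst//.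
by rewrite EFinD EFin_oprob// -[X in (_ <= _ + X)%E]mule1 -(@probability_setT _ _ _ P).
Qed.

(** The invariant adds the absolute values of the pending terms to |leval s|, so it survives either
    choice of the next sign. Every completely signed function is then bounded by [dl], and [heta]
    applies to it. *)
Lemma expect_sign_avg (L s : seq (R * set E)) (dl eta : R) :
  (forall p, p \in L -> bmeas p.2 /\ p.2 `<=` F) ->
  (forall p, p \in s -> bmeas p.2 /\ p.2 `<=` F) ->
  (forall z, `|leval s z| + \sum_(p <- L) `|p.1| * \1_(p.2) z <= dl) ->
  (forall s', (forall p, p \in s' -> bmeas p.2 /\ p.2 `<=` F) ->
     (forall z, `|leval s' z| <= dl) ->
     (\int[P]_w (Num.min (lint m s' w ^+ 2) 1)%:E <= eta%:E)%E) ->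
  (\int[P]_w (savg L s w)%:E <= eta%:E)%E.
Proof.
move=> + + + heta; elim: L s => [|p L IH] s LF sF hs.
  by apply: heta => // z; have := hs z; rewrite big_nil addr0.
rewrite savg_cons.
have e0 L' s' w : (0 <= (savg L' s' w)%:E)%E by rewrite lee_fin sign_avg_ge0.
under eq_integral do rewrite EFinM EFinD.
rewrite ge0_integralZl//; last 2 first.
- by apply/emeasurable_funD; apply/measurable_EFinP.
- by move=> w _; rewrite adde_ge0.
rewrite ge0_integralD//; [|exact/measurable_EFinP|exact/measurable_EFinP].
have LF' q : q \in L -> bmeas q.2 /\ q.2 `<=` F.
  by move=> qL; apply: LF; rewrite inE qL orbT.
have pF := LF p (mem_head _ _).
have ind0 z : 0 <= \1_(p.2) z :> R by rewrite indicE.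
have h1 : (\int[P]_w (savg L (p :: s) w)%:E <= eta%:E)%E.
  apply: IH => // [q|z]; first by rewrite inE => /orP[/eqP->|/sF].
  apply: le_trans (hs z); rewrite big_cons addrA lerD2r /leval big_cons addrC.
  by apply: le_trans (ler_normD _ _) _; rewrite lerD2r normrM [X in _ * X]ger0_norm.
have h2 : (\int[P]_w (savg L ((- p.1, p.2)%R :: s) w)%:E <= eta%:E)%E.
  apply: IH => // [q|z]; first by rewrite inE => /orP[/eqP->|/sF].
  apply: le_trans (hs z); rewrite big_cons addrA lerD2r /leval big_cons addrC /=.
  apply: le_trans (ler_normD _ _) _.
  by rewrite lerD2r mulNr normrN normrM [X in _ * X]ger0_norm.
apply: le_trans (lee_wpmul2l _ (leeD h1 h2)) _; first by rewrite lee_fin invr_ge0.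
by rewrite -EFinD -EFinM lee_fin; lra.
Qed.

(** The expected sign average is at most 3p + y^2 by contraction, and at least 1/4 of the
    probability that the sum of squares reaches 1; this is the factor 4. *)
Lemma prob_square_sum (L : seq (R * set E)) (x y p : R) : 0 < x -> 0 <= y ->
  (forall q, q \in L -> bmeas q.2 /\ q.2 `<=` F) ->
  (forall B, bmeas B -> B `<=` F -> oprob P [set w | x < `|m B w|] <= p) ->
  (forall z, \sum_(q <- L) `|q.1| * \1_(q.2) z <= y / (9 * x)) ->
  oprob P [set w | 1 <= \sum_(q <- L) (q.1 * m q.2 w) ^+ 2] <= 4 * (3 * p + y ^+ 2).
Proof.
move=> x0 y0 LF hx hL.
have h : (\int[P]_w (savg L [::] w)%:E <= (3 * p + y ^+ 2)%:E)%E.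
  apply: (@expect_sign_avg L [::] (y / (9 * x))) => //.
    by move=> z; rewrite /leval big_nil normr0 add0r.
  move=> s sF hs; apply: le_trans (expect_min (lint_measurable m s) y0) _.
  by rewrite lee_fin lerD2r; exact: (lint_small Hm bF x0).
set A := [set w | _].
have mA : measurable A.
  rewrite (_ : A = (fun w => \sum_(q <- L) (q.1 * m q.2 w) ^+ 2) @^-1` `[1, +oo[).
    rewrite -[X in measurable X]setTI.
    have : measurable_fun setT (fun w => \sum_(q <- L) (q.1 * m q.2 w) ^+ 2).
      apply: measurable_sum => q; apply: measurable_funX; apply: measurable_funM.
        exact: measurable_cst.
      exact: measurable_funPT.
    by apply.
  by apply/seteqP; split=> w /=; rewrite in_itv/= andbT.
have : ((4^-1 * oprob P A)%:E <= \int[P]_w (savg L [::] w)%:E)%E.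
  have -> : (4^-1 * oprob P A)%:E = (4^-1%:E * \int[P]_w (\1_A w)%:E)%E.
    by rewrite integral_indic// setIT EFinM EFin_oprob.
  rewrite -ge0_integralZl//; last first.
    by apply/measurable_EFinP; exact: measurable_indic.
  apply: ge0_le_integral => //.
  - by apply/measurable_EFinP; apply: measurable_funM;
    [exact: measurable_cst|exact: measurable_indic].
  - exact/measurable_EFinP.
  - move=> w _; rewrite -EFinM lee_fin indicE.
    have [|_] := boolP (w \in A); last by rewrite mulr0 sign_avg_ge0.
    rewrite inE mulr1 /savg /lint big_nil => Aw; apply: sign_avg_ge.
    by rewrite big_map.
move=> /le_trans /(_ h); rewrite lee_fin; lra.
Qed.

End paley_zygmund.

(** * Levy-valued random measures *)

Lemma continuous_borel (U V : topologicalType) (f : U -> V) (B : set V) :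
  continuous f -> borel V B -> borel U (f @^-1` B).
Proof.
move=> cf; move: B; apply: smallest_sub; last first.
  by move=> B oB; apply: sub_sigma_algebra; apply: open_comp => // x _; exact: cf.
have [h0 hC hU] := smallest_sigma_algebra setT (@open U).
split=> [|A hA|F hF] /=; first by rewrite preimage_set0.
  by rewrite setTD preimage_setC -setTD; exact: hC.
by rewrite preimage_bigcup; exact: hU.
Qed.

Section levy_random_measure.
Context (R : realType) (disp : measure_display) (T : measurableType disp).
Variable P : probability T R.
Context (d : nat).
Local Notation E := 'rV[R]_d.
Local Notation bmeas A := (@measurable _ (borelType E) A).
Variables (O : set E) (M : R -> set E -> {RV P >-> R}).
Hypothesis LM : levy_valued_random_measure O M.

Lemma borel_box n (B : 'I_n -> set R) : (forall i, measurable (B i)) ->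
  borel 'rV[R]_n [set x | forall i, B i (x 0 i)].
Proof.
move=> mB.
rewrite [X in borel _ X](_ : _ =
    \bigcap_(i in [set: 'I_n]) (fun x : 'rV[R]_n => x 0 i) @^-1` B i).
2: by apply/seteqP; split=> [x h i _|x h i]; [exact: h|exact: (h i I)].
apply: (@fin_bigcap_measurable _ (borelType 'rV[R]_n)); first exact: finite_finset.
move=> i _; apply: continuous_borel; first exact: coord_continuous.
by rewrite borel_measurableE; exact: mB.
Qed.

Section family.
Context (I : eqType) (A : I -> set E).
Hypothesis bA : forall i, Bb O (A i).

Let vec (s : seq I) :=
  LM.2 (size s) (fun i => A (tnth (in_tuple s) i)) (fun i => bA _).

Let boxE (s : seq I) (B : I -> set R) (f : I -> R) :
  ([set x : 'rV[R]_(size s) | forall i, B (tnth (in_tuple s) i) (x 0 i)] : set _)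
    (\row_i f (tnth (in_tuple s) i)) <-> forall i, i \in s -> B i (f i).
Proof.
split=> h.
  by move=> i /(tnthP (in_tuple s))[j ->]; have := h j; rewrite mxE.
by move=> i /=; rewrite mxE; apply: h; exact: mem_tnth.
Qed.

(** Transfers the stationarity of the vector-valued processes to finite lists of indices of an
    arbitrary family, the form suited to the countable family of cells. *)
Lemma levy_box_stationary (s : seq I) (B : I -> set R) (u h : R) : 0 <= u -> 0 <= h ->
  (forall i, measurable (B i)) ->
  P [set w | forall i, i \in s -> B i (M (u + h) (A i) w - M u (A i) w)] =
  P [set w | forall i, i \in s -> B i (M h (A i) w - M 0 (A i) w)].
Proof.
move=> u0 h0 mB; have [_ _ _ st _] := vec s.
have := st u h u0 h0 _ (borel_box (fun i => mB (tnth (in_tuple s) i))).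
have e r r' : [set w | [set x : 'rV[R]_(size s) | forall i, B (tnth (in_tuple s) i) (x 0 i)]
     (\row_i M r (A (tnth (in_tuple s) i)) w - \row_i M r' (A (tnth (in_tuple s) i)) w)] =
   [set w | forall i, i \in s -> B i (M r (A i) w - M r' (A i) w)].
  apply/seteqP; split=> w /=.
    move=> hw; apply/(boxE s B (fun i => M r (A i) w - M r' (A i) w)).
    by move=> i; have := hw i; rewrite !mxE.
  move=> /(boxE s B (fun i => M r (A i) w - M r' (A i) w)) hw i.
  by have := hw i; rewrite !mxE.
by rewrite !e.
Qed.

Lemma levy_box_independent (s : seq I) (t : nat -> R) (J : seq nat) (B : nat -> I -> set R) :
  0 <= t 0%N -> (forall k, t k <= t k.+1) -> uniq J -> (forall k i, measurable (B k i)) ->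
  P [set w | forall k, k \in J -> forall i, i \in s ->
    B k i (M (t k.+1) (A i) w - M (t k) (A i) w)] =
  (\prod_(k <- J) P [set w | forall i, i \in s ->
    B k i (M (t k.+1) (A i) w - M (t k) (A i) w)%R])%E.
Proof.
move=> t0 tS uJ mB; have [_ _ ind _ _] := vec s.
have := ind t t0 tS J (fun k => [set x : 'rV[R]_(size s) | forall i,
  B k (tnth (in_tuple s) i) (x 0 i)])
  uJ (fun k => borel_box (fun i => mB k (tnth (in_tuple s) i))).
have e k : (fun w => \row_i M (t k.+1) (A (tnth (in_tuple s) i)) w - \row_i M (t k) (A (tnth
  (in_tuple s) i)) w) @^-1`
    [set x : 'rV[R]_(size s) | forall i, B k (tnth (in_tuple s) i) (x 0 i)] =
   [set w | forall i, i \in s -> B k i (M (t k.+1) (A i) w - M (t k) (A i) w)].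
  apply/seteqP; split=> w /=.
    move=> hw; apply/(boxE s (B k) (fun i => M (t k.+1) (A i) w - M (t k) (A i) w)).
    by move=> i; have := hw i; rewrite !mxE.
  move=> /(boxE s (B k) (fun i => M (t k.+1) (A i) w - M (t k) (A i) w)) hw i.
  by have := hw i; rewrite !mxE.
under eq_bigr do rewrite e.
move=> <-; congr (P _); apply/seteqP; split=> w hw k Jk.
  by rewrite e; exact: hw.
by have := hw k Jk; rewrite e.
Qed.

End family.

Section one_set.
Variable A : set E.
Hypothesis bA : Bb O A.

Let X t w := M t A w.
Let mX t : measurable_fun setT (X t). Proof. exact: measurable_funPT. Qed.

Lemma levy_rm0 : {ae P, forall w, M 0 A w = 0}.
Proof.
have [_ + _ _ _] := LM.2 1%N (fun=> A) (fun=> bA).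
by apply: filterS => w /rowP/(_ ord0); rewrite !mxE.
Qed.

Let indX (s u : R) : 0 <= s -> s <= u ->
  forall C D : set R, measurable C -> measurable D ->
  P (X s @^-1` C `&` (X u \- X s) @^-1` D) =
  (P (X s @^-1` C) * P ((X u \- X s)%R @^-1` D))%E.
Proof.
move=> s0 su C D mC mD.
(* The time grid 0, s, u, u, ...: its first increment is [X s] almost surely, since [X 0]
   vanishes. *)
pose t k := if k is k'.+1 then if k' is 0%N then s else u else 0 : R.
have := @levy_box_independent unit (fun=> A) (fun=> bA) [:: tt] t [:: 0%N; 1%N]
  (fun k _ => if k is 0%N then C else D).
rewrite !big_cons big_nil mule1 lexx => /(_ isT _ isT) h.
have {}h := h (ltac:(by case=> [|[|k]] /=)) (ltac:(by case)).
have mXs : measurable (X s @^-1` C) by rewrite -[X in measurable X]setTI; exact: mX.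
have mXus : measurable ((X u \- X s)%R @^-1` D).
  by rewrite -[X in measurable X]setTI; exact: measurable_funB.
have mXs0 : measurable ((X s \- X 0)%R @^-1` C).
  by rewrite -[X in measurable X]setTI; exact: measurable_funB.
have e1 : [set w | forall i, i \in [:: tt] -> D (M (t 2%N) A w - M (t 1%N) A w)] =
  (X u \- X s) @^-1` D.
  by apply/seteqP; split=> w hw //; apply: (hw tt).
have e2 : [set w | forall i, i \in [:: tt] -> C (M (t 1%N) A w - M (t 0%N) A w)] =
  (X s \- X 0) @^-1` C.
  by apply/seteqP; split=> w hw //; apply: (hw tt).
move: h; rewrite e1 e2 => h.
have e3 : P (X s @^-1` C) = P ((X s \- X 0) @^-1` C).
  rewrite -!EFin_oprob//; congr (_%:E); apply/eqP; rewrite eq_le; apply/andP.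
  by split; apply: le_oprob_ae; apply: filterS levy_rm0 => w /=; rewrite /X => ->;
    rewrite subr0.
rewrite e3 -h -!EFin_oprob//; last 2 first.
- rewrite [X in measurable X](_ : _ = (X s \- X 0) @^-1` C `&` (X u \- X s) @^-1` D).
    exact: measurableI.
  apply/seteqP; split=> w hw.
    split; first by apply: (hw 0%N _ tt).
    by apply: (hw 1%N _ tt).
  by case: hw => hC hD k; rewrite !inE => /orP[]/eqP-> i _.
- exact: measurableI.
congr (_%:E); apply/eqP; rewrite eq_le; apply/andP; split; apply: le_oprob_ae.
  apply: filterS levy_rm0 => w /= X0 [hC hD] k; rewrite !inE => /orP[]/eqP-> i _ //=.
  by rewrite X0 subr0.
apply: filterS levy_rm0 => w /= X0 hh; split; last by apply: (hh 1%N _ tt).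
by have := hh 0%N (mem_head _ _) tt (mem_head _ _); rewrite /= X0 subr0.
Qed.

Let statX (s h a c : R) : 0 <= s -> 0 <= h ->
  oprob P [set w | c < `|X (s + h) w - X s w - a|] =
  oprob P [set w | c < `|X h w - a|].
Proof.
move=> s0 h0; pose B := [set x : R | c < `|x - a|].
have mB : measurable B.
  by apply: measurable_norm_gt; apply: measurable_funB => //; exact: measurable_cst.
have := @levy_box_stationary unit (fun=> A) (fun=> bA) [:: tt] (fun=> B) s h s0 h0 (fun=> mB).
have e r r' : [set w | forall i, i \in [:: tt] -> B (M r A w - M r' A w)] =
    [set w | c < `|X r w - X r' w - a|].
  by apply/seteqP; split=> w hw //; apply: (hw tt).
have mE r r' : measurable [set w | c < `|X r w - X r' w - a|].
  apply: measurable_norm_gt; apply: measurable_funB; last exact: measurable_cst.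
  exact: measurable_funB.
rewrite !e -!EFin_oprob// => -[->].
apply/eqP; rewrite eq_le; apply/andP; split; apply: le_oprob_ae.
  by apply: filterS levy_rm0 => w /=; rewrite /X => ->; rewrite subr0.
by apply: filterS levy_rm0 => w /=; rewrite /X => ->; rewrite subr0.
Qed.

Lemma levy_rm_cvg0 (e r : R) : 0 < e -> 0 < r -> exists2 h0 : R, 0 < h0 &
  forall h : R, 0 <= h -> h <= h0 -> oprob P [set w | e < `|M h A w|] <= r.
Proof.
move=> e0 r0; have [_ _ _ _ cv] := LM.2 1%N (fun=> A) (fun=> bA).
pose V := [set x : 'rV[R]_1 | `|x 0 0| < e].
have oV : open V.
  rewrite (_ : V = (fun x : 'rV[R]_1 => `|x 0 0|) @^-1` [set y | y < e]).
    apply: open_comp; last exact: open_lt.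
    by move=> x _; apply: continuous_comp; [exact: coord_continuous|exact: norm_continuous].
  by [].
have V0 : V 0 by rewrite /V /= mxE normr0.
have := cv 0 V (lexx 0) oV V0.
move=> /fine_cvgP[_ /cvgrPdist_lt /(_ _ r0)].
rewrite near_withinE near_simpl => /nbhs_normP[h1 /= h10 hh].
exists (h1 / 2); first exact: divr_gt0.
move=> h h0 hh1; have hlt : `|0 - h| < h1.
  by rewrite sub0r normrN ger0_norm//; apply: le_lt_trans hh1 _; lra.
have := hh h hlt h0; rewrite sub0r normrN => /ltW; apply: le_trans.
set B := [set w | ~ _]; rewrite ger0_norm; last exact: fine_ge0.
have BE : B = ~` [set w | `|M h A w - M 0 A w| < e].
  by apply/seteqP; split=> w; rewrite /B /V /= !mxE.
have mB : measurable B.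
  rewrite BE (_ : [set _ | _] = (fun w => `|M h A w - M 0 A w|) @^-1` `]-oo, e[).
    apply: measurableC; rewrite -[X in measurable X]setTI.
    by apply: (measurableT_comp (@normr_measurable R setT)) => //; exact: measurable_funB.
  by apply/seteqP; split=> w; rewrite /= in_itv.
rewrite -oprobE//; apply: le_oprob_ae; apply: filterS levy_rm0 => w h0w /= hw.
by rewrite BE /= h0w subr0 => /ltW; rewrite leNgt hw.
Qed.

Lemma levy_rm_maximal (t l q h : R) : 0 < l -> q <= 4^-1 -> 0 <= h -> h <= t ->
  oprob P [set w | l < `|M t A w|] < q -> oprob P [set w | 16 * l < `|M h A w|] < q.
Proof. exact: levy_maximal mX indX statX levy_rm_cvg0 _. Qed.

(** The control measure only speaks about time 1. Stationary increments carry nullity to all integer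
    times, and the maximal estimate, with arbitrarily small level and probability, carries it back
    to every earlier time. *)
Lemma levy_rm_null : {ae P, forall w, M 1 A w = 0} -> forall t : R, 0 <= t ->
  {ae P, forall w, M t A w = 0}.
Proof.
move=> M1 t t0.
have Mn n : {ae P, forall w, M n%:R A w = 0}.
  elim: n => [|n IH]; first exact: levy_rm0.
  have h : {ae P, forall w, M (n%:R + 1) A w - M n%:R A w = 0}.
    apply: ae_oprob; have := statX 0 0 (ler0n _ n) ler01.
    rewrite [RHS](_ : _ = 0).
      move=> h; apply/eqP; rewrite eq_le oprob_ge0 andbT -[leRHS]h; apply: le_oprob => w /=.
      by rewrite /X subr0 normr_gt0 => /eqP.
    apply/eqP; rewrite eq_le oprob_ge0 andbT -[leRHS](oprob_ae M1); apply: le_oprob => w /=.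
    by rewrite /X subr0 normr_gt0 => /eqP.
  by rewrite -natr1; apply: filterS2 IH h => w ->; rewrite subr0.
pose n := (Num.trunc t).+1.
have tn : t <= n%:R by exact/ltW/archimedean.Num.Theory.truncnS_gt.
apply: ae_oprob; apply/eqP; rewrite eq_le oprob_ge0 andbT.
have hk (k : nat) (q : R) : 0 < q -> q <= 4^-1 ->
  oprob P [set w | k.+1%:R^-1 < `|M t A w|] <= q.
  move=> q0 q4; apply/ltW; rewrite (_ : k.+1%:R^-1 = 16 * (k.+1%:R^-1 / 16)); last by field.
  apply: levy_rm_maximal t0 tn _ => //.
  apply: le_lt_trans q0; rewrite -[leRHS](oprob_ae (Mn n)); apply: le_oprob => w /= + Mw.
  by rewrite Mw normr0 ltNge divr_ge0// invr_ge0.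
apply: (@le_trans _ _ (oprob P (\bigcup_k [set w | k.+1%:R^-1 < `|M t A w|]))).
  apply: le_oprob => w /= /eqP; rewrite -normr_gt0 => h.
  exists (Num.trunc (`|M t A w|^-1)) => //=.
  by rewrite invf_plt ?posrE// archimedean.Num.Theory.truncnS_gt.
have mk k : measurable [set w | k.+1%:R^-1 < `|M t A w|] by apply: measurable_norm_gt.
have nk k : P [set w | k.+1%:R^-1 < `|M t A w|] = 0%E.
  rewrite -EFin_oprob//; congr (_%:E); apply/eqP; rewrite eq_le oprob_ge0 andbT.
  apply/ler_addgt0Pr => e e0; rewrite add0r.
  apply: (@le_trans _ _ (Num.min e 4^-1)); last by rewrite ge_min lexx.
  apply: hk; last by rewrite ge_min lexx orbT.
  by rewrite lt_min e0/=; lra.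
rewrite -[leRHS](@oprob_ae _ _ _ P (~` \bigcup_k [set w | k.+1%:R^-1 < `|M t A w|])) ?setCK//.
have := @negligible_bigcup _ _ _ P (fun k => [set w | k.+1%:R^-1 < `|M t A w|]).
move=> h; apply: negligibleS (h _); first by move=> w /contrapT.
by move=> k; exists [set w | k.+1%:R^-1 < `|M t A w|]; split => //; exact: nk.
Qed.

End one_set.
(** One bound at the final time serves all earlier times, at the price of the factor 16. *)
Lemma levy_rm_bounded_range (F : set E) (t e : R) : Bb O F -> 0 <= t -> 0 < e ->
  exists2 x : R, 0 < x & forall h : R, 0 <= h -> h <= t ->
  forall A, bmeas A -> A `<=` F -> oprob P [set w | x < `|M h A w|] <= e.
Proof.
move=> bF t0 e0; pose q := Num.min e 4^-1.
have q0 : 0 < q by rewrite lt_min e0 /=; lra.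
have [x x0 hx] := rm_bounded_range (LM.1 t t0) bF (divr_gt0 q0 (ltr0n _ 2)).
exists (16 * x); first exact: mulr_gt0.
move=> h h0 ht A mA AF; apply: (@le_trans _ _ q); last by rewrite ge_min lexx.
apply/ltW/(levy_rm_maximal (Bb_sub bF mA AF) x0 _ h0 ht).
  by rewrite ge_min lexx orbT.
by apply: le_lt_trans (hx A mA AF) _; lra.
Qed.

Lemma levy_rm_square_sum (F : set E) (t e r : R) : Bb O F -> 0 <= t -> 0 < e -> 0 < r ->
  exists2 dl : R, 0 < dl & forall h : R, 0 <= h -> h <= t ->
  forall L : seq (R * set E), (forall q, q \in L -> bmeas q.2 /\ q.2 `<=` F) ->
  (forall z, \sum_(q <- L) `|q.1| * \1_(q.2) z <= dl) ->
  oprob P [set w | r <= \sum_(q <- L) (q.1 * M h q.2 w) ^+ 2] <= e.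
Proof.
move=> bF t0 e0 r0.
(* With the range bound taken at probability e/24, 4 (3 e/24 + y^2) is at most e. *)
pose y := Num.min 1 (e / 8).
have y0 : 0 < y by rewrite lt_min ltr01 divr_gt0.
have y2 : y ^+ 2 <= e / 8.
  apply: (@le_trans _ _ y); last by rewrite ge_min lexx orbT.
  by rewrite expr2 ler_piMl// ?(ltW y0)// /y ge_min lexx.
have [x x0 hx] := levy_rm_bounded_range bF t0 (divr_gt0 e0 (ltr0n _ 24)).
(* Since c^2 >= 1/r, scaling the coefficients by [c] raises the threshold from [r] to at least 1. *)
pose c := 1 + r^-1.
have r10 : 0 < r^-1 by rewrite invr_gt0.
have c0 : 0 < c by rewrite addr_gt0.
have c2 : r^-1 <= c ^+ 2 by rewrite /c; have := sqr_ge0 r^-1; lra.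
exists (y / (9 * x) / c); first by rewrite !divr_gt0// mulr_gt0.
move=> h h0 ht L LF hL.
have := @prob_square_sum _ _ _ _ P (M h) O F (LM.1 h h0) bF (lscale c L) x y (e / 24) x0 (ltW
  y0).
have lF q : q \in lscale c L -> bmeas q.2 /\ q.2 `<=` F.
  by move=> /mapP[q' /LF h' ->].
move=> /(_ lF (hx h h0 ht)) hh.
apply: (@le_trans _ _ (4 * (3 * (e / 24) + y ^+ 2))); last by lra.
apply: le_trans (hh _); last first.
  move=> z; have := hL z; rewrite ler_pdivlMr// => /(le_trans _); apply.
  rewrite big_map mulr_suml; apply: ler_sum => p _ /=.
  by rewrite normrM gtr0_norm// mulrAC [leRHS]mulrC mulrA mulrAC.
apply: le_oprob => w /= rw; rewrite big_map.
apply: (@le_trans _ _ (c ^+ 2 * \sum_(q <- L) (q.1 * M h q.2 w) ^+ 2)).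
  apply: (@le_trans _ _ (r^-1 * r)); first by rewrite mulVf// gt_eqF.
  by apply: ler_pM => //; rewrite ltW.
by rewrite mulr_sumr; apply: ler_sum => p _ /=; rewrite -exprMn mulrA.
Qed.

End levy_random_measure.

(** * Dyadic expansion of test functions *)

Lemma telescope_from0 (V : zmodType) (G : nat -> V) n :
  \sum_(0 <= k < n.+1) (G k - (if k is k'.+1 then G k' else 0)) = G n.
Proof.
elim: n => [|n IH]; first by rewrite big_nat1 subr0.
by rewrite big_nat_recr//= IH subrKC.
Qed.

Section dyadic.
Context (R : realType) (d : nat).
Local Notation E := 'rV[R]_d.
Implicit Types (i : 'I_d) (l : seq 'I_d) (m : seq nat) (f : E -> R) (y z : E).

Definition dfloor (n : nat) (a : R) : R := (Num.floor (2 ^+ n * a))%:~R / 2 ^+ n.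

Lemma dfloor_le n a : dfloor n a <= a.
Proof. by rewrite /dfloor ler_pdivrMr ?exprn_gt0// mulrC;
  exact: archimedean.Num.Theory.floor_le. Qed.

Lemma dfloor_gt n a : a - (2 ^+ n)^-1 < dfloor n a.
Proof.
rewrite ltrBlDr /dfloor -[X in _ < _ + X]mul1r -mulrDl ltr_pdivlMr ?exprn_gt0// mulrC.
by have := archimedean.Num.Theory.floorD1_gt (2 ^+ n * a); rewrite intrD.
Qed.

Lemma floor_double n (a b : R) :
  Num.floor (2 ^+ n.+1 * a) = Num.floor (2 ^+ n.+1 * b) ->
  Num.floor (2 ^+ n * a) = Num.floor (2 ^+ n * b).
Proof.
wlog : a b / Num.floor (2 ^+ n * a) <= Num.floor (2 ^+ n * b).
  move=> h ab; have [|/ltW] := leP (Num.floor (2 ^+ n * a)) (Num.floor (2 ^+ n * b)).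
    by move=> /h; exact.
  by move=> /h <-.
move=> le_ab ab; apply/eqP; rewrite eq_le le_ab andTb.
have := archimedean.Num.Theory.floor_le (2 ^+ n * b).
set q := Num.floor (2 ^+ n * b) => hq.
rewrite archimedean.Num.Theory.floor_ge_int.
have : 2 * q <= Num.floor (2 ^+ n.+1 * a).
  rewrite ab archimedean.Num.Theory.floor_ge_int intrM exprS -mulrA.
  by rewrite ler_pM2l.
by rewrite archimedean.Num.Theory.floor_ge_int intrM exprS -mulrA ler_pM2l.
Qed.

Lemma dfloor_double n (a b : R) :
  Num.floor (2 ^+ n.+1 * a) = Num.floor (2 ^+ n.+1 * b) -> dfloor n a = dfloor n b.
Proof. by rewrite /dfloor => /floor_double ->. Qed.

Definition upd y i (b : R) : E := \row_k (if k == i then b else y 0 k).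

Lemma updE y i b k : upd y i b 0 k = if k == i then b else y 0 k.
Proof. by rewrite mxE. Qed.

Lemma upd_comm y i k a b : i != k -> upd (upd y i a) k b = upd (upd y k b) i a.
Proof.
move=> ik; apply/rowP => r; rewrite !updE; case: eqP => [->|//].
by rewrite eq_sym (negbTE ik).
Qed.

Variable j : nat.

(* Mixed difference, in the coordinates [l], between the dyadic levels [j + k]
   and [j + k - 1] ([k] in [m]); for [k = 0] only the value at level [j]. *)
Fixpoint mdiff l m f y : R :=
  match l, m with
  | i :: l', k :: m' => mdiff l' m' f (upd y i (dfloor (j + k) (y 0 i))) -
      (if k is k'.+1 then mdiff l' m' f (upd y i (dfloor (j + k') (y 0 i))) else 0)
  | _, _ => f y
  end.

Fixpoint sample (n : nat) l y : E :=
  if l is i :: l' then sample n l' (upd y i (dfloor (j + n) (y 0 i))) else y.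

Fixpoint levels (c n : nat) : seq (seq nat) :=
  if c is c'.+1 then [seq k :: m | k <- iota 0 n.+1, m <- levels c' n] else [:: [::]].

Lemma size_levels c n m : m \in levels c n -> size m = c.
Proof.
elim: c m => [|c IH] m; first by rewrite inE => /eqP->.
by move=> /allpairsP[[k m'] [_ /IH /= <- ->]].
Qed.

Lemma uniq_levels c n : uniq (levels c n).
Proof.
elim: c => // c IH; apply: allpairs_uniq => //; first exact: iota_uniq.
by move=> [a b] [a' b'] _ _ [-> ->].
Qed.

Lemma sub_levels c n n' m : (n <= n')%N -> m \in levels c n -> m \in levels c n'.
Proof.
move=> nn'; elim: c m => // c IH m /allpairsP[[k m'] [kn /IH hm ->]].
apply/allpairsP; exists (k, m'); split=> //.
by move: kn; rewrite !mem_iota !ltnS => /leq_trans; exact.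
Qed.

Lemma sum_levels_prod c n (F : nat -> R) :
  \sum_(m <- levels c n) \prod_(k <- m) F k = (\sum_(0 <= k < n.+1) F k) ^+ c.
Proof.
elim: c => [|c IH]; first by rewrite big_seq1 big_nil expr0.
rewrite big_allpairs_dep exprS -IH mulr_suml /index_iota subn0; apply: eq_bigr => k _.
by rewrite mulr_sumr; apply: eq_bigr => m _; rewrite big_cons.
Qed.

(** In each coordinate the differences telescope, which leaves the value at the point rounded down
    to the finest level. *)
Lemma sum_mdiff n l f y : \sum_(m <- levels (size l) n) mdiff l m f y = f (sample n l y).
Proof.
elim: l y => [|i l IH] y; first by rewrite big_seq1.
rewrite [levels _ _]/(levels (size l).+1 n) big_allpairs_dep.
pose G k := f (sample n l (upd y i (dfloor (j + k) (y 0 i)))).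
transitivity (\sum_(k <- iota 0 n.+1) (G k - (if k is k'.+1 then G k' else 0))).
  apply: eq_bigr => k _; rewrite big_split /= IH; congr (_ + _).
  rewrite sumrN; congr (- _); case: k => [|k]; last exact: IH.
  by rewrite big1.
by rewrite -[in LHS](subn0 n.+1) -/(index_iota 0 n.+1) telescope_from0.
Qed.

Lemma sampleE n l y k : uniq l ->
  sample n l y 0 k = if k \in l then dfloor (j + n) (y 0 k) else y 0 k.
Proof.
elim: l y => [//|i l IH] y /= /andP[il ul]; rewrite IH// updE inE.
by have [->|] := eqVneq k i; first by rewrite (negbTE il).
Qed.

(* [y] lies in the dyadic cell [q] of level [j + m]. *)
Fixpoint in_cell l m (q : seq int) y : bool :=
  match l, m, q with
  | i :: l', k :: m', z :: q' =>
      (Num.floor (2 ^+ (j + k) * y 0 i) == z) && in_cell l' m' q' y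
  | [::], [::], [::] => true
  | _, _, _ => false
  end.

Fixpoint cell_of l m y : seq int :=
  match l, m with
  | i :: l', k :: m' => Num.floor (2 ^+ (j + k) * y 0 i) :: cell_of l' m' y
  | _, _ => [::]
  end.

Lemma in_cellE l m q y : size m = size l -> in_cell l m q y = (q == cell_of l m y).
Proof.
elim: l m q => [|i l IH] [|k m] [|z q] //= [sm].
by rewrite IH// eqseq_cons eq_sym.
Qed.

Lemma in_cell_upd l m q y i b : i \notin l -> in_cell l m q (upd y i b) = in_cell l m q y.
Proof.
elim: l m q => [|k l IH] [|r m] [|z q] //=; rewrite inE negb_or => /andP[ik il].
by rewrite IH// updE (eq_sym k) (negbTE ik).
Qed.

(** The mixed difference sees a sampled coordinate only through its roundings at levels j + k and j
    + k - 1, and the finer one determines the coarser one. *)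
Lemma mdiff_cell l m q f y z : uniq l -> in_cell l m q y -> in_cell l m q z ->
  (forall i, i \notin l -> y 0 i = z 0 i) -> mdiff l m f y = mdiff l m f z.
Proof.
elim: l m q y z => [|i l IH] [|k m] [|b q] y z //=.
  by move=> _ _ _ yz; congr f; apply/rowP => i; exact: yz.
move=> /andP[il ul] /andP[/eqP yb yq] /andP[/eqP zb zq] yz.
have agree c : mdiff l m f (upd y i c) = mdiff l m f (upd z i c).
  apply: (IH _ q); rewrite ?in_cell_upd// => r rl; rewrite !updE.
  by case: eqVneq => // ri; apply: yz; rewrite inE negb_or ri.
rewrite (_ : dfloor (j + k) (y 0 i) = dfloor (j + k) (z 0 i)); last first.
  by rewrite /dfloor yb zb.
rewrite agree; congr (_ - _); case: k yb zb => // k; rewrite addnS => yb zb.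
by rewrite (@dfloor_double _ _ (z 0 i)) ?yb ?zb.
Qed.

Lemma mdiff_linear l m (a : R) f g y :
  mdiff l m (a *: f + g) y = a * mdiff l m f y + mdiff l m g y.
Proof.
elim: l m y => [|i l IH] [|k m] y //=.
rewrite IH; case: k => [|k]; first by rewrite !subr0.
by rewrite IH mulrBr; ring.
Qed.

(** [f] is only evaluated at points obtained by rounding coordinates down at level [j] or finer,
    hence at distance less than 2^-j below the original ones. *)
Lemma mdiff_eq0 l m f y : uniq l ->
  (forall z, (forall i, i \in l -> y 0 i - (2 ^+ j)^-1 < z 0 i <= y 0 i) ->
             (forall i, i \notin l -> z 0 i = y 0 i) -> f z = 0) ->
  mdiff l m f y = 0.
Proof.
elim: l m y => [|i l IH] [|k m] y /=.
- by move=> _; apply.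
- by move=> _; apply.
- move=> _; apply => [r _|//]; rewrite lexx andbT ltrBlDr ltrDl.
  by rewrite invr_gt0 exprn_gt0.
move=> /andP[il ul] hf.
have sub n : mdiff l m f (upd y i (dfloor (j + n) (y 0 i))) = 0.
  apply: IH => // z zl znl; apply: hf => r.
    rewrite inE; case: (eqVneq r i) => [-> _|ri /= rl].
      rewrite (znl _ il) updE eqxx dfloor_le andbT.
      apply: le_lt_trans (dfloor_gt _ _).
      by rewrite lerD2l lerN2 lef_pV2 ?posrE ?exprn_gt0// ler_weXn2l ?ler1n// leq_addr.
    by have := zl r rl; rewrite updE (negbTE ri).
  rewrite inE negb_or => /andP[ri rl].
  by rewrite (znl _ rl) updE (negbTE ri).
by rewrite sub; case: k => [|k]; rewrite ?sub subr0.
Qed.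

Lemma derive_upd f y i t : smooth f ->
  is_derive t (1 : R) (fun s : R => f (upd y i s)) ('D_(delta_mx 0 i) f (upd y i t)).
Proof.
move=> sf; have [_ /(_ i (upd y i t)) df] := sf [::].
have E : (fun h : R => h^-1 *: (f (upd y i (h *: (1 : R) + t)) - f (upd y i t))) =
         (fun h : R => h^-1 *: (f (h *: delta_mx 0 i + upd y i t) - f (upd y i t))).
  apply/funext => h; congr (_ *: (f _ - _)); apply/rowP => k.
  rewrite /upd !mxE; case: (eqVneq k i) => [_|_]; last by rewrite mulr0 add0r.
  by congr (_ + _); rewrite mulr1; exact: mulr1.

split; first by rewrite /derivable /= E.
by rewrite /derive /= E.
Qed.

(** The coordinate [i] is not sampled by [l], so moving along it commutes with every rounding, and
    differentiation passes through the mixed difference. *)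
Lemma derive_mdiff l m f y i t : i \notin l -> smooth f ->
  is_derive t (1 : R) (fun s : R => mdiff l m f (upd y i s))
    (mdiff l m (fun x => 'D_(delta_mx 0 i) f x) (upd y i t)).
Proof.
move=> + sf; elim: l m y => [|k l IH] m y; first by case: m => *; exact: derive_upd.
case: m => [|r m]; first by move=> _; exact: derive_upd.
rewrite inE negb_or => /andP[ik il] /=.
have e s c : upd (upd y i s) k (dfloor c (upd y i s 0 k)) =
  upd (upd y k (dfloor c (y 0 k))) i s.
  by rewrite upd_comm// updE (eq_sym k) (negbTE ik).
under eq_fun do rewrite e; rewrite e; apply: is_deriveB; first exact: IH.
case: r => [|r]; first exact: is_derive_cst.
by under eq_fun do rewrite e; rewrite e; exact: IH.
Qed.

Lemma iter_partial_rcons s f i :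
  iter_partial (rcons s i) f = iter_partial s (fun x => 'D_(delta_mx 0 i) f x).
Proof. by rewrite /iter_partial foldr_rcons. Qed.

Lemma smooth_partial f i : smooth f -> smooth (fun x => 'D_(delta_mx 0 i) f x).
Proof. by move=> sf s; rewrite -iter_partial_rcons; exact: sf. Qed.

Lemma mvt_bound (g dg : R -> R) (C a b : R) :
  (forall t, is_derive t (1 : R) g (dg t)) -> (forall t, `|dg t| <= C) ->
  `|g a - g b| <= C * `|a - b|.
Proof.
move=> hg hC; wlog ab : a b / a < b.
  move=> h; have [ab|ba|->] := ltgtP a b; first exact: h.
    by rewrite distrC (distrC a); exact: h.
  by rewrite !subrr normr0 mulr0.
have cg : {within `[a, b], continuous g}.
  apply: continuous_subspaceT => t; apply: differentiable_continuous.
  by apply/derivable1_diffP; have [] := hg t.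
have [c _ e] := MVT ab (fun t _ => hg t) cg.
by rewrite distrC (distrC a) e normrM; apply: ler_wpM2r.
Qed.

(** A difference in one coordinate costs one derivative by the mean value theorem: the two roundings
    at levels j + k + 1 and j + k differ by at most 2^-k = 2 / 2^(k+1). At level 0 nothing is
    differenced, and the factor 2 is only a convenient bound for 1. *)
Lemma mdiff_bound l m f y (e : R) : uniq l -> size m = size l -> smooth f ->
  (forall s, (size s <= size l)%N -> forall x, `|iter_partial s f x| <= e) ->
  `|mdiff l m f y| <= e * \prod_(k <- m) (2 / 2 ^+ k).
Proof.
elim: l m f y => [|i l IH] [|k m] f y //=.
  by move=> _ _ _ he; rewrite big_nil mulr1; exact: (he [::]).
move=> /andP[il ul] [sm] sf he; rewrite big_cons.
have pm0 : 0 <= \prod_(k <- m) (2 / 2 ^+ k) :> R.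
  by rewrite big_seq; apply: prodr_ge0 => r _; apply: divr_ge0 => //; exact: exprn_ge0.
have e0 : 0 <= e by apply: le_trans (he [::] isT 0).
case: k => [|k].
  rewrite subr0 expr0 divr1.
  apply: (@le_trans _ _ (e * \prod_(k <- m) (2 / 2 ^+ k))).
    by apply: IH => // s ss x; apply: he; exact: leqW.
  by apply: ler_wpM2l => //; rewrite ler_peMl// ler1n.
have := @mvt_bound _ _ (e * \prod_(k <- m) (2 / 2 ^+ k)) (dfloor (j + k.+1) (y 0 i))
  (dfloor (j + k) (y 0 i)) (fun t => derive_mdiff m y t il sf).
have hC t : `|mdiff l m (fun x => 'D_(delta_mx 0 i) f x) (upd y i t)| <=
  e * \prod_(k <- m) (2 / 2 ^+ k).
  apply: IH => //; first exact: smooth_partial.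
  by move=> s ss x; rewrite -iter_partial_rcons; apply: he; rewrite size_rcons.
move=> /(_ hC) /le_trans; apply; rewrite -mulrA; apply: ler_wpM2l => //.
rewrite mulrC; apply: ler_wpM2r => //.
apply: (@le_trans _ _ ((2 ^+ (j + k))^-1)).
  have := dfloor_le (j + k) (y 0 i); have := dfloor_gt (j + k) (y 0 i).
  have := dfloor_le (j + k.+1) (y 0 i); have := dfloor_gt (j + k.+1) (y 0 i).
  have : (2 ^+ (j + k.+1))^-1 <= (2 ^+ (j + k))^-1 :> R.
    by rewrite lef_pV2 ?posrE ?exprn_gt0// ler_weXn2l ?ler1n// addnS.
  by rewrite ler_norml; lra.
rewrite exprS invfM mulrA divff// mul1r lef_pV2 ?posrE ?exprn_gt0//.
by rewrite ler_weXn2l ?ler1n// leq_addl.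
Qed.

End dyadic.

Lemma rv_coord_le (R : realType) d (x : 'rV[R]_d) i : `|x 0 i| <= `|x|.
Proof.
have /mapP[k _ ->] : `|x 0 i| \in [seq `|x p.1 p.2| | p : 'I_1 * 'I_d].
  by apply/mapP; exists (ord0, i) => //=; rewrite mem_enum.
by rewrite [leRHS]/Num.norm /= mx_normrE; apply/bigmax_geP; right => /=; exists k.
Qed.

Lemma rv_norm_lt (R : realType) d (x : 'rV[R]_d) (c : R) : 0 < c ->
  (forall i, `|x 0 i| < c) -> `|x| < c.
Proof.
move=> c0 h; rewrite [ltLHS]/Num.norm /= mx_normrE; apply/bigmax_ltP; split=> //.
by move=> [a b] _ /=; rewrite ord1.
Qed.

Lemma geometric_sum_le (R : realType) (x : R) n : 0 <= x -> x < 1 ->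
  \sum_(0 <= k < n) x ^+ k <= (1 - x)^-1.
Proof.
move=> x0 x1; have x1' : 0 < 1 - x by rewrite subr_gt0.
suff -> : \sum_(0 <= k < n) x ^+ k = (1 - x ^+ n) / (1 - x).
  by rewrite ler_pdivrMr// mulVf ?gt_eqF// gerBl exprn_ge0.
elim: n => [|n IH]; first by rewrite big_geq// expr0 subrr mul0r.
by rewrite big_nat_recr//= IH exprS; field; rewrite gt_eqF.
Qed.

(** * A compact exhaustion and its shells *)

Section exhaustion.
Context (R : realType) (d : nat) (O : set 'rV[R]_d).
Local Notation E := 'rV[R]_d.
Local Notation bmeas A := (@measurable _ (borelType E) A).

(** Points of norm at most [j] whose distance to the complement of [O] is at least 2^-j. The margin
    is of the size of the coarsest grid used in shell [j], which keeps rounding from crossing more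
    than one shell. *)
Definition exh (j : nat) : set E :=
  [set x | `|x| <= j%:R /\ forall y, `|y - x| < (2 ^+ j)^-1 -> O y].

Lemma exh_sub j : exh j `<=` O.
Proof. by move=> x [_]; apply; rewrite subrr normr0 invr_gt0 exprn_gt0. Qed.

Lemma exh_closed j : closed (exh j).
Proof.
have -> : exh j = [set x | `|x| <= j%:R] `&` \bigcap_(y in ~` O) [set x | (2 ^+ j)^-1 <=
  `|y - x|].
  apply/seteqP; split=> x.
    by move=> [xj h]; split=> // y Oy /=; rewrite leNgt; apply/negP => /h.
  move=> [xj h]; split=> // y; apply: contraPP => Oy; apply/negP.
  by rewrite -leNgt; exact: h.
apply: closedI.
  apply: (@closed_comp _ _ (fun x : E => `|x|) [set r | r <= j%:R]); last exact: closed_le.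
  by move=> x _; exact: norm_continuous.
apply: closed_bigI => y _.
rewrite (_ : [set x | _] = ~` ball y (2 ^+ j)^-1).
  by apply: open_closedC; exact: ball_open.
by rewrite -ball_normE; apply/seteqP; split=> x /=; rewrite leNgt => /negP.
Qed.

Lemma exh_compact j : compact (exh j).
Proof.
apply: bounded_closed_compact; last exact: exh_closed.
exists j%:R; split; first exact: num_real.
by move=> r jr x [xj _]; apply: le_trans xj (ltW jr).
Qed.

Lemma exh_step j x x' : exh j x -> `|x' - x| < (2 ^+ j.+1)^-1 -> exh j.+1 x'.
Proof.
move=> [xj h] xx'; split.
  have := ler_normD (x' - x) x; rewrite subrK => /le_trans; apply.
  rewrite -natr1 addrC lerD// (le_trans (ltW xx'))// invf_le1 ?exprn_gt0//.
  by apply: exprn_ege1; rewrite ler1n.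
move=> y yx'; apply: h.
have := ler_distD x' y x; have := xx'; have := yx'.
rewrite exprS invfM; lra.
Qed.

Lemma exh_nondecreasing j k : (j <= k)%N -> exh j `<=` exh k.
Proof.
move=> jk; rewrite -(subnK jk); elim: (k - j)%N => // n IH x /IH h.
by rewrite addSn; apply: (exh_step h); rewrite subrr normr0 invr_gt0 exprn_gt0.
Qed.

Lemma exh_Bb j : Bb O (exh j).
Proof. by apply: Bb_compact; [exact: exh_compact|exact: exh_sub]. Qed.

Hypothesis oO : open O.

Lemma exh_cover x : O x -> exists j, exh j x.
Proof.
move=> Ox; have /nbhs_normP[r /= r0 h] : nbhs x O by exact: open_nbhs_nbhs.
pose n := maxn (Num.trunc (r^-1)).+1 (Num.trunc `|x|).+1.
exists n; split.
  apply: le_trans (ltW (archimedean.Num.Theory.truncnS_gt _)) _.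
  by rewrite ler_nat leq_maxr.
move=> y yx; apply: h; rewrite /= distrC; apply: lt_trans yx _.
rewrite invf_plt ?posrE ?exprn_gt0//.
apply: lt_le_trans (archimedean.Num.Theory.truncnS_gt _) _.
by rewrite -natrX ler_nat (leq_trans (leq_maxl _ (Num.trunc `|x|).+1))// ltnW// ltn_expl.
Qed.

(** The sets [exh j] are closed, so the cover uses their open neighbourhoods of radius 2^-(j+1),
    which [exh_step] places inside [exh j.+1]. *)
Lemma compact_exh C : compact C -> C `<=` O -> exists j, C `<=` exh j.
Proof.
rewrite compact_cover => cC CO.
pose U j := \bigcup_(z in exh j) ball z (2 ^+ j.+1)^-1.
have oU j : open (U j).
  apply: bigcup_open => z _; exact: ball_open.
have [|D _ CD] := cC nat setT U (fun j _ => oU j).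
  move=> x /CO /exh_cover[j xj]; exists j => //; exists x => //.
  by apply: ballxx; rewrite invr_gt0 exprn_gt0.
exists (\max_(k <- finmap.enum_fset D) k).+1 => x /CD[k /= kD [z zk]].
rewrite -ball_normE /= => xz.
have := exh_step zk (_ : `|x - z| < _); rewrite distrC => /(_ xz).
by apply: exh_nondecreasing; rewrite ltnS; exact: leq_bigmax_seq.
Qed.

Definition shell (j : nat) : set E := seqD exh j.

Lemma shell_sub j : shell j `<=` exh j.
Proof. by case: j => // j x []. Qed.

Lemma shell_cover x : O x -> exists j, shell j x.
Proof.
move=> /exh_cover xj; have : (\bigcup_n seqD exh n) x.
  by rewrite eq_bigcup_seqD; case: xj => j xj; exists j.
by move=> [j _ h]; exists j.
Qed.

Lemma shell_meas j : bmeas (shell j).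
Proof.
case: j => [|j]; first exact: Bb_meas (exh_Bb 0).
by apply: measurableD; exact: Bb_meas (exh_Bb _).
Qed.

Lemma shell_disjoint j k x : shell j x -> shell k x -> j = k.
Proof.
have : trivIset setT shell.
  by apply: trivIset_seqD; move=> m n mn; apply/subsetPset; exact: exh_nondecreasing.
by move=> t xj xk; apply: t => //; exists x.
Qed.

End exhaustion.

(* A cell is indexed by the number of the shell, the levels [m] and the integer
   coordinates [q]. *)
Definition item : eqType := (nat * (seq nat * seq int))%type.

(** * Cells, coefficients and weights *)

Section cells.
Context (R : realType) (d : nat).
Local Notation E := 'rV[R]_d.
Local Notation bmeas A := (@measurable _ (borelType E) A).
Local Notation coords := (enum 'I_d).

(** The integers of [-N, N) with N = (j+1) 2^(j+k) in each coordinate; at level j + k these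
    intervals cover [-j, j] and so every point of [exh j]. *)
Fixpoint cells (j : nat) (m : seq nat) : seq (seq int) :=
  if m is k :: m' then
    [seq z :: q | z <- [seq (i%:Z - (j.+1 * 2 ^ (j +
      k))%:Z)%R | i <- iota 0 (2 * (j.+1 * 2 ^ (j + k)))],
                  q <- cells j m']
  else [:: [::]].

Lemma uniq_cells j m : uniq (cells j m).
Proof.
elim: m => // k m IH /=; apply: allpairs_uniq => //.
  by rewrite map_inj_uniq ?iota_uniq// => a b /addIr[].
by move=> [a b] [a' b'] _ _ [-> ->].
Qed.

Lemma size_cells j m : (size (cells j m))%:R =
  \prod_(k <- m) (2 * j.+1%:R * 2 ^+ j * 2 ^+ k) :> R.
Proof.
elim: m => [|k m IH]; first by rewrite big_nil.
rewrite big_cons [cells _ _]/= size_allpairs size_map size_iota natrM IH; congr (_ * _).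
by rewrite !natrM natrX exprD; ring.
Qed.

Lemma cell_of_cells j l m (x : E) : size m = size l -> `|x| <= j%:R ->
  cell_of j l m x \in cells j m.
Proof.
move=> + xj; elim: l m => [|i l IH] [|k m] // [sm].
apply/allpairsP; exists (Num.floor (2 ^+ (j + k) * x 0 i), cell_of j l m x).
split=> //; last exact: IH.
set N := (j.+1 * 2 ^ (j + k))%N; set z := Num.floor _.
have xi : `|x 0 i| <= j%:R by apply: le_trans xj; exact: rv_coord_le.
have p0 : 0 < 2 ^+ (j + k) :> R by rewrite exprn_gt0.
have p1 : 1 <= 2 ^+ (j + k) :> R by apply: exprn_ege1; rewrite ler1n.
have NE : N%:R = (j%:R + 1) * 2 ^+ (j + k) :> R by rewrite /N natrM natrX natr1.
have xN : - N%:R <= 2 ^+ (j + k) * x 0 i /\ 2 ^+ (j + k) * x 0 i < N%:R.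
  move: xi; rewrite ler_norml NE => /andP[x1 x2]; split.
    rewrite -mulNr [leRHS]mulrC ler_pM2r//; lra.
  by rewrite [ltLHS]mulrC ltr_pM2r//; lra.
have zN : - N%:Z <= z.
  by rewrite archimedean.Num.Theory.floor_ge_int rmorphN /= pmulrn; case: xN.
have zN' : z < N%:Z.
  by rewrite archimedean.Num.Theory.floor_lt_int -pmulrn; case: xN.
have zN0 : 0 <= z + N%:Z by rewrite -lerBlDr sub0r.
apply/mapP; exists (absz (z + N%:Z)).
  rewrite mem_iota add0n; apply/andP; split=> //.
  by rewrite -ltz_nat gez0_abs// mul2n -addnn PoszD ltrD2r.
by rewrite gez0_abs ?addrK.
Qed.

Lemma in_cell_meas j l m q : bmeas [set x : E | in_cell j l m q x].
Proof.
have cst_meas (b : bool) : bmeas [set x : E | b].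
  case: b; first by rewrite (_ : [set _ | _] = setT)//; apply/seteqP; split.
  by rewrite (_ : [set _ | _] = set0)//; rewrite -subset0.
elim: l m q => [|i l IH] [|k m] [|z q]; try exact: (cst_meas true); try exact: (cst_meas false).
rewrite (_ : [set _ | _] = [set x : E | in_cell j l m q x] `&`
    (fun x : E => x 0 i) @^-1` [set a | Num.floor (2 ^+ (j + k) * a) == z]); last first.
  by apply/seteqP; split=> x /=; [move=> /andP[]|move=> [-> ->]].
apply: measurableI; first exact: IH.
apply: continuous_borel; first exact: coord_continuous.
have p0 : 0 < 2 ^+ (j + k) :> R by rewrite exprn_gt0.
rewrite (_ : [set a | _] = `[z%:~R / 2 ^+ (j + k), (z + 1)%:~R / 2 ^+ (j + k)[%classic).
  by rewrite borel_measurableE; exact: measurable_itv.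
apply/seteqP; split=> a /=; rewrite in_itv/= ler_pdivrMr// ltr_pdivlMr// ![a * _]mulrC.
  move=> /eqP <-; rewrite archimedean.Num.Theory.floor_le/=.
  by have := archimedean.Num.Theory.floorD1_gt (2 ^+ (j + k) * a).
by move=> h; apply/eqP; apply: archimedean.Num.Theory.floor_def.
Qed.

(** The level vectors whose largest entry is exactly [n]. Grouped in this way, the partial sums of
    the expansion run over full cubes of levels, where [sum_mdiff] telescopes. *)
Definition new_levels (n : nat) : seq (seq nat) :=
  if n is n'.+1 then [seq m <- levels d n | m \notin levels d n'] else levels d 0.

Lemma sum_new_levels (V : nmodType) n (F : seq nat -> V) :
  \sum_(0 <= k < n.+1) \sum_(m <- new_levels k) F m = \sum_(m <- levels d n) F m.
Proof.
elim: n => [|n IH]; first by rewrite big_nat1.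
rewrite big_nat_recr//= IH big_filter [RHS](bigID (mem (levels d n)))/=; congr (_ + _).
rewrite -[RHS]big_filter; apply: perm_big; apply: uniq_perm.
- exact: uniq_levels.
- by rewrite filter_uniq// uniq_levels.
- move=> m; rewrite mem_filter /=; case: (boolP (m \in levels d n)) => //= h.
  exact/esym/(sub_levels _ h).
Qed.

Lemma new_levels_sub n m : m \in new_levels n -> m \in levels d n.
Proof. by case: n => // n; rewrite mem_filter => /andP[]. Qed.

Variable O : set E.

Definition cell_set (p : item) : set E :=
  shell O p.1 `&` [set x | in_cell p.1 coords p.2.1 p.2.2 x].

Lemma cell_set_shell p : cell_set p `<=` shell O p.1. Proof. by move=> x []. Qed.

Lemma cell_set_Bb p : Bb O (cell_set p).
Proof.
apply: (Bb_sub (exh_Bb O p.1)).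
  by apply: measurableI; [exact: shell_meas|exact: in_cell_meas].
by move=> x [/shell_sub].
Qed.

(** Evaluated at an arbitrary point of the cell; by [coefE] the choice is immaterial. Cells that
    miss the shell get coefficient 0. *)
Definition coef (p : item) (f : E -> R) : R :=
  if `[< cell_set p !=set0 >] then mdiff p.1 coords p.2.1 f (xget 0 (cell_set p)) else 0.

(** Per coordinate at level k there are of order 2^k cells with squared coefficients of order 4^-k;
    dividing by (9/16)^k leaves (8/9)^k. Any base strictly between 1/sqrt 2 and 1 would be summable
    in both senses. *)
Definition weight (p : item) : R := \prod_(k <- p.2.1) (3 / 4) ^+ k.

Definition block (j n : nat) : seq item :=
  [seq (j, (m, q)) | m <- new_levels n, q <- cells j m].

Lemma weight_gt0 p : 0 < weight p.
Proof. by apply: prodr_gt0 => k _; rewrite exprn_gt0// divr_gt0. Qed.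

Lemma coefE p f x : cell_set p x -> coef p f = mdiff p.1 coords p.2.1 f x.
Proof.
move=> px; rewrite /coef asboolT; last by exists x.
have [_ h] : cell_set p (xget 0 (cell_set p)) by apply: (@xgetPex _ 0); exists x.
apply: mdiff_cell h px.2 _; first exact: enum_uniq.
by move=> i; rewrite mem_enum.
Qed.

Lemma coef_linear p (a : R) f g : coef p (a *: f + g) = a * coef p f + coef p g.
Proof.
by rewrite /coef; case: ifP => _; [exact: mdiff_linear|rewrite mulr0 addr0].
Qed.

Lemma coef_bound p f (e : R) : smooth f -> size p.2.1 = d -> 
  (forall s, (size s <= d)%N -> forall x, `|iter_partial s f x| <= e) ->
  `|coef p f| <= e * \prod_(k <- p.2.1) (2 / 2 ^+ k).
Proof.
move=> sf sp he; have e0 : 0 <= e by apply: le_trans (he [::] isT 0).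
rewrite /coef; case: ifP => _; last first.
  rewrite normr0; apply: mulr_ge0 => //; rewrite big_seq.
  by apply: prodr_ge0 => k _; apply: divr_ge0 => //; exact: exprn_ge0.
by apply: mdiff_bound => //; rewrite ?enum_uniq ?size_enum_ord.
Qed.

(** If [f] were nonzero at a sampled point z near x, then z would lie in [exh r] with r + 2 the
    index of the shell; rounding moves x by less than 2^-(r+1), so x would lie in [exh r.+1], which
    the shell excludes. *)
Lemma coef_eq0 p f k : (forall x, f x != 0 -> exh O k x) -> (k.+1 < p.1)%N -> coef p f = 0.
Proof.
move=> fk kp; rewrite /coef; case: ifP => // /asboolP px.
have [xs _] : cell_set p (xget 0 (cell_set p)) by apply: (@xgetPex _ 0).
set x := xget _ _ in xs *; apply: mdiff_eq0; first exact: enum_uniq.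
move=> z hz _; apply/eqP; apply: contrapT => /negP /fk zk.
case E : p.1 kp xs hz => [//|[//|r]] kr [_ nx] hz; apply: nx.
have zr : exh O r z by apply: exh_nondecreasing zk.
apply: (exh_step zr); apply: rv_norm_lt => [|i]; first by rewrite invr_gt0 exprn_gt0.
rewrite !mxE; have /andP[h1 h2] := hz i (mem_enum _ i).
have : (2 ^+ r.+2)^-1 <= (2 ^+ r.+1)^-1 :> R.
  by rewrite lef_pV2 ?posrE ?exprn_gt0// ler_weXn2l ?ler1n.
rewrite ger0_norm; lra.
Qed.

(* Within a fixed level [m] the cells are disjoint. *)
Lemma sum_cells j m x (F : item -> R) : size m = d ->
  (shell O j x -> \sum_(q <- cells j m) F (j, (m, q)) * \1_(cell_set (j, (m, q))) x =
     F (j, (m, cell_of j coords m x))) /\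
  (~ shell O j x -> \sum_(q <- cells j m) F (j, (m, q)) * \1_(cell_set (j, (m, q))) x = 0).
Proof.
move=> sm; have sc : size m = size coords by rewrite size_enum_ord.
split=> [sx|nsx]; last first.
  rewrite big1_seq// => q _; rewrite indicE memNset ?mulr0//.
  by move=> [].
have cx : cell_of j coords m x \in cells j m.
  by apply: cell_of_cells => //; case: (shell_sub sx).
rewrite (bigD1_seq _ cx (uniq_cells j m))/= big1_seq ?addr0.
  rewrite indicE mem_set ?mulr1//; split=> //=.
  by rewrite in_cellE.
move=> q /andP[qx _]; rewrite indicE memNset ?mulr0//.
by move=> [_ /=]; rewrite in_cellE// (negbTE qx).
Qed.

Lemma sum_block j n (F : item -> R) :
  \sum_(p <- block j n) F p = \sum_(m <- new_levels n) \sum_(q <- cells j m) F (j, (m, q)).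
Proof. by rewrite big_allpairs_dep. Qed.

Lemma mem_block j n p : p \in block j n ->
  [/\ p.1 = j, p.2.1 \in levels d n & size p.2.1 = d].
Proof.
move=> /allpairsPdep[m [q [/new_levels_sub hm _ ->]]] /=.
by split=> //; exact: size_levels hm.
Qed.

Lemma sum_coef j n f x :
  \sum_(0 <= k < n.+1) \sum_(p <- block j k) coef p f * \1_(cell_set p) x =
  \1_(shell O j) x * f (sample j n coords x).
Proof.
under eq_bigr do rewrite sum_block.
rewrite sum_new_levels.
have [sx|nsx] := pselect (shell O j x); last first.
  rewrite indicE memNset// mul0r big1_seq// => m /andP[_ /size_levels sm].
  by rewrite (sum_cells j x (coef^~ f) sm).2.
rewrite indicE mem_set// mul1r -sum_mdiff size_enum_ord.
apply: eq_big_seq => m /size_levels sm.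
rewrite (sum_cells j x (coef^~ f) sm).1// (@coefE _ _ x)//; split=> //=.
by rewrite in_cellE// size_enum_ord.
Qed.

Lemma cvg_sample j (f : E -> R) x : continuous f ->
  f (sample j n coords x) @[n --> \oo] --> f x.
Proof.
move=> cf; apply: continuous_cvg; first exact: cf.
apply/cvgrPdist_lt => e e0.
exists (Num.trunc e^-1).+1 => // n /= hn; apply: rv_norm_lt => // i.
rewrite !mxE sampleE ?enum_uniq// mem_enum/=.
have := dfloor_le (j + n) (x 0 i); have := dfloor_gt (j + n) (x 0 i).
suff : (2 ^+ (j + n))^-1 < e by move=> *; rewrite ger0_norm; lra.
rewrite invf_plt ?posrE ?exprn_gt0//.
apply: lt_le_trans (archimedean.Num.Theory.truncnS_gt _) _.
rewrite -natrX ler_nat (leq_trans hn)// ltnW//.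
by apply: leq_trans (ltn_expl n (ltnSn 1)) _; rewrite leq_exp2l// leq_addl.
Qed.

(** A point meets at most one cell of each level vector, so the number of cells does not enter. *)
Lemma sum_weight_le j (n n' : nat) z :
  \sum_(n <= k < n') \sum_(p <- block j k) weight p * \1_(cell_set p) z <=
  \sum_(n <= k < n') \sum_(m <- new_levels k) \prod_(r <- m) (3 / 4) ^+ r.
Proof.
apply: ler_sum => k _; rewrite sum_block big_seq [leRHS]big_seq;
  apply: ler_sum => m /new_levels_sub hm.
have [h1 h2] := sum_cells j z weight (size_levels hm).
have [sx|nsx] := pselect (shell O j z); first by rewrite h1.
by rewrite h2//; apply: prodr_ge0 => r _; rewrite exprn_ge0// divr_ge0.
Qed.

Definition level_mass (k : nat) : R := \sum_(m <- new_levels k) \prod_(r <- m) (3 / 4) ^+ r.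

Lemma level_mass_ge0 k : 0 <= level_mass k.
Proof. by apply: sumr_ge0 => m _; apply: prodr_ge0 => r _; rewrite exprn_ge0// divr_ge0. Qed.

Lemma sum_level_mass n : \sum_(0 <= k < n) level_mass k <= 4 ^+ d.
Proof.
case: n => [|n]; first by rewrite big_geq// exprn_ge0.
rewrite sum_new_levels sum_levels_prod lerXn2r ?nnegrE//.
  by apply: sumr_ge0 => r _; rewrite exprn_ge0// divr_ge0.
have e4 : (1 - 3 / 4)^-1 = 4 :> R by field.
by rewrite -[leRHS]e4; apply: geometric_sum_le; lra.
Qed.

Lemma level_mass_tail (e : R) : 0 < e ->
  exists N, forall n, \sum_(N <= k < n) level_mass k <= e.
Proof.
move=> e0; have cv : cvgn (series level_mass).
  apply: nondecreasing_is_cvgn.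
    by apply: nondecreasing_series => k _ _; exact: level_mass_ge0.
  by exists (4 ^+ d) => _ [n _ <-]; exact: sum_level_mass.
have /cvgrPdist_lt/(_ _ e0)[N _ hN] := cv.
have hl n : series level_mass n <= lim (series level_mass @ \oo).
  apply: nondecreasing_cvgn_le => //.
  by apply: nondecreasing_series => k _ _; exact: level_mass_ge0.
exists N => n; have [nN|Nn] := leqP n N; first by rewrite big_geq// ltW.
have := hN N (leqnn N); have := hl n; rewrite /series /=.
rewrite (big_cat_nat (n := N))// 1?ltnW//=.
set L := lim _; set S := \sum_(0 <= k < N) _; set S' := \sum_(N <= k < n) _.
by move=> h1 /ltr_normlW; lra.
Qed.

(** Per coordinate, 2 (j+1) 2^j from the number of cells, 4 from the squared factor 2 of
    [mdiff_bound], and 9 = 1 / (1 - 8/9) from the geometric series. *)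
Definition coef_const (j : nat) : R := (8 * j.+1%:R * 2 ^+ j * 9) ^+ d.

Lemma sum_coef_square j n (f : E -> R) (e : R) : smooth f ->
  (forall s, (size s <= d)%N -> forall x, `|iter_partial s f x| <= e) ->
  \sum_(0 <= k < n) \sum_(p <- block j k) (coef p f / weight p) ^+ 2 <= e ^+ 2 * coef_const j.
Proof.
move=> sf he; have cc0 : 0 <= coef_const j by rewrite exprn_ge0// !mulr_ge0// exprn_ge0.
case: n => [|n]; first by rewrite big_geq// mulr_ge0// sqr_ge0.
under eq_bigr do rewrite sum_block.
rewrite sum_new_levels.
pose F k : R := 8 * j.+1%:R * 2 ^+ j * (8 / 9) ^+ k.
apply: (@le_trans _ _ (\sum_(m <- levels d n) e ^+ 2 * \prod_(k <- m) F k)).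
  rewrite big_seq [leRHS]big_seq; apply: ler_sum => m /size_levels sm.
  pose B : R := (e * \prod_(k <- m) (2 / 2 ^+ k)) / (\prod_(k <- m) (3 / 4) ^+ k).
  apply: (@le_trans _ _ (\sum_(q <- cells j m) B ^+ 2)).
    apply: ler_sum => q _; set p := (j, (m, q)) : item.
    rewrite -[(coef p f / weight p) ^+ 2]real_normK ?num_real// lerXn2r ?nnegrE//.
      apply: divr_ge0; last exact/ltW/(weight_gt0 p).
      exact: le_trans (normr_ge0 _) (coef_bound sf sm he (p := p)).
    rewrite normrM normfV (gtr0_norm (weight_gt0 p)) ler_pM2r ?invr_gt0 ?weight_gt0//.
    exact: (coef_bound sf sm he (p := p)).
  rewrite big_const_seq count_predT iter_addr addr0 -mulr_natl size_cells.
  have -> : \prod_(k <- m) (2 * j.+1%:R * 2 ^+ j * 2 ^+ k) * B ^+ 2 = e ^+ 2 *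
      (\prod_(k <- m) (2 * j.+1%:R * 2 ^+ j * 2 ^+ k) *
       ((\prod_(k <- m) (2 / 2 ^+ k)) ^+ 2 / (\prod_(k <- m) (3 / 4) ^+ k) ^+ 2)).
    by rewrite /B expr_div_n exprMn; ring.
  apply: ler_wpM2l; first exact: sqr_ge0.
  elim: m {sm B} => [|k m IH]; first by rewrite !big_nil !expr1n invr1 !mulr1.
  rewrite !big_cons.
  set a := \prod_(r <- m) _ in IH *; set b := \prod_(r <- m) (2 / _) in IH *.
  set c := \prod_(r <- m) (3 / 4) ^+ r in IH *.
  have -> : 2 * j.+1%:R * 2 ^+ j * 2 ^+ k * a * ((2 / 2 ^+ k * b) ^+ 2 / ((3 / 4) ^+ k * c)
    ^+ 2) =
      F k * (a * (b ^+ 2 / c ^+ 2)).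
    rewrite /F !expr_div_n; set x := 2 ^+ k; set y := 3 ^+ k; set v := 4 ^+ k.
    have -> : 8 ^+ k = x ^+ 3 :> R by rewrite -exprM mulnC exprM; congr (_ ^+ k); ring.
    have -> : 9 ^+ k = y ^+ 2 :> R by rewrite -exprM mulnC exprM; congr (_ ^+ k); ring.
    have -> : v = x ^+ 2 by rewrite -exprM mulnC exprM; congr (_ ^+ k); ring.
    have x0 : x != 0 by rewrite expf_neq0.
    have y0 : y != 0 by rewrite expf_neq0.
    have c0 : c != 0.
      by rewrite gt_eqF//; apply: prodr_gt0 => r _; rewrite exprn_gt0// divr_gt0.
    field; by rewrite x0 y0 c0.
  by apply: ler_wpM2l => //; rewrite /F !mulr_ge0// exprn_ge0// divr_ge0.
rewrite -mulr_sumr; apply: ler_wpM2l; first exact: sqr_ge0.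
rewrite sum_levels_prod /coef_const lerXn2r ?nnegrE//.
  by apply: sumr_ge0 => k _; rewrite /F !mulr_ge0// exprn_ge0// divr_ge0.
rewrite -mulr_sumr; apply: ler_wpM2l; first by rewrite !mulr_ge0// exprn_ge0.
have e9 : (1 - 8 / 9)^-1 = 9 :> R by field.
by rewrite -[leRHS]e9; apply: geometric_sum_le; lra.
Qed.

End cells.

(** * Test functions and their strong dual *)

Section testfun_topology.
Context (R : realType) (d : nat) (O : set 'rV[R]_d).
Local Notation E := 'rV[R]_d.
Local Notation V := (testfun O).

Lemma testfunP (f : V) : [/\ smooth f, compact (tsupport f) & tsupport f `<=` O].
Proof. by case: f => f /= /asboolP. Qed.

Lemma testfun_smooth (f : V) : smooth f. Proof. by case: (testfunP f). Qed.

Lemma iter_partialZ s a (f : E -> R) : smooth f ->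
  iter_partial s (a *: f) = a *: iter_partial s f.
Proof.
move=> sf; have -> : a *: f = (a - 1) *: f + f by rewrite -[in X in _ +
  X](scale1r f) -scalerDl subrK.
by rewrite iter_partialP// -[X in _ + X]scale1r -scalerDl subrK.
Qed.

Lemma testfun_support (f : V) x : f x != 0 -> tsupport f x.
Proof. by move=> h; apply: subset_closure. Qed.

Lemma convex_setP (W : set V) : (forall x y a, 0 <= a -> a <= 1 -> W x -> W y ->
  W (a *: x + (1 - a) *: y))
   <-> convex_set W.
Proof.
split=> [h x y l /set_mem Wx /set_mem Wy|h x y a a0 a1 Wx Wy].
  by apply/mem_set; apply: h.
have := h x y (Itv01 a0 a1) (mem_set Wx) (mem_set Wy).
by move=> /set_mem.
Qed.

Lemma tsupportZ a (f : V) : tsupport (a *: f : V) `<=` tsupport f.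
Proof.
apply: closure_subset => x /=; apply: contra => /eqP fx.
by change (a * f x == 0); rewrite fx mulr0.
Qed.

Lemma lf_nbhs0_scale (W : set V) (C : R) : lf_nbhs0 W -> lf_nbhs0 [set g | W (C *: g)].
Proof.
move=> [cW bW nW]; split.
- apply/convex_setP => x y a a0 a1 /= Wx Wy; move/convex_setP : cW => /(_ _ _ a a0 a1 Wx Wy).
  by rewrite scalerDr !scalerA ![_ * C]mulrC.
- by move=> a f a1 /= Wf; rewrite scalerA mulrC -scalerA; exact: bW.
move=> K cK KO; have [m [e [e0 h]]] := nW K cK KO.
have C1 : 0 < 1 + `|C| by rewrite ltr_pwDl.
exists m, (e / (1 + `|C|)); split; first exact: divr_gt0.
move=> f fK hf; apply: h; first exact: subset_trans (tsupportZ (a := C) (f := f)) fK.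
move=> s x sm; have -> : testfun_fun (C *: f) = C *: testfun_fun f by [].
rewrite iter_partialZ; last exact: testfun_smooth.
have -> : (C *: iter_partial s f) x = C * iter_partial s f x by [].
rewrite normrM; have := hf s x sm; rewrite ler_pdivlMr// mulrDr mulr1 [`|C| * _]mulrC.
by apply: le_trans; rewrite lerDr.
Qed.

Lemma lf_nbhs0_0 (W : set V) : lf_nbhs0 W -> W 0.
Proof.
move=> [_ _ /(_ set0 compact0 (fun _ => False_ind _)) [m [e [e0]]]]; apply.
  rewrite /tsupport (_ : [set _ | _] = set0) ?closure0 //.
  by apply/seteqP; split=> x //=; rewrite eqxx.
move=> s x _.
have -> : testfun_fun (0 : V) = 0 *: testfun_fun (0 : V) by rewrite scale0r.
rewrite iter_partialZ; last exact: testfun_smooth.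
by rewrite scale0r normr0 ltW.
Qed.

(** The set f + W need not be open. Its points h with s (h - f) in [W] for some s > 1 form an open
    subset: for 1 < s' < s, s' (h + g - f) is a convex combination of s (h - f) and a multiple of g,
    and that multiple lies in [W] for g in a smaller neighbourhood. *)
Lemma lf_nbhs0_nbhs (W : set V) (f : V) : lf_nbhs0 W -> nbhs f [set f + g | g in W].
Proof.
move=> nW; have [cW bW _] := nW.
pose U : set V := [set h | exists2 s : R, 1 < s & W (s *: (h - f))].
exists U; split.
- move=> h [s s1 Ws]; have s0 : 0 < s by apply: lt_trans s1.
  pose s' := (1 + s) / 2; pose r := s' / s.
  have r1 : 0 < 1 - r by rewrite subr_gt0 ltr_pdivrMr// mul1r /s'; lra.
  have s'1 : 1 < s' by rewrite /s'; lra.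
  have r0 : 0 <= r by rewrite divr_ge0//; lra.
  exists [set g | W ((s' / (1 - r)) *: g)]; first exact: lf_nbhs0_scale.
  move=> _ [g Wg <-]; exists s' => //.
  have -> : s' *: (h + g - f) = r *: (s *: (h - f)) + (1 - r) *: ((s' / (1 - r)) *: g).
    have e1 : r * s = s' by rewrite /r divfK// lt0r_neq0.
    have e2 : (1 - r) * (s' / (1 - r)) = s' by rewrite mulrC divfK// lt0r_neq0.
    by rewrite !scalerA e1 e2 -scalerDr addrAC.
  by move/convex_setP : cW; apply=> //; lra.
- by exists 2; rewrite ?ltr1n// subrr scaler0; exact: lf_nbhs0_0.
move=> h [s s1 Ws]; exists (h - f); last by rewrite addrC subrK.
have s0 : 0 < s by apply: lt_trans s1.
rewrite -[h - f]scale1r -(mulVf (lt0r_neq0 s0)) -scalerA; apply: bW => //.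
by rewrite normfV gtr0_norm// invf_le1// ltW.
Qed.

(** The universal property of the inductive limit: by linearity the sublevel sets of |phi| are
    convex and balanced, so only their traces on each D(K) need checking. *)
Lemma scalar_continuous (phi : V -> R) : scalar phi ->
  (forall K : set E, compact K -> K `<=` O -> forall e, 0 < e ->
    nbhs0_on K [set g : V | `|phi g| <= e]) -> continuous phi.
Proof.
move=> lphi nphi.
have phiZ a g : phi (a *: g) = a * phi g.
  have phi0 : phi 0 = 0 by have := lphi (-1) 0 0; rewrite scaler0 addr0; lra.
  by have := lphi a g 0; rewrite addr0 phi0 addr0.
have phiD g g' : phi (g + g') = phi g + phi g' by have := lphi 1 g g'; rewrite scale1r mul1r.
move=> f; have F : Filter (nbhs f) by exact: nbhs_filter.
apply/cvgrPdist_le => e e0.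
have nW : lf_nbhs0 [set g : V | `|phi g| <= e].
  split.
  - apply/convex_setP => x y a a0 a1 /= xe ye; rewrite phiD !phiZ.
    have a1' : 0 <= 1 - a by rewrite subr_ge0.
    rewrite (le_trans (ler_normD _ _))// !normrM (ger0_norm a0) (ger0_norm a1').
    by have := ler_wpM2l a0 xe; have := ler_wpM2l a1' ye; lra.
  - by move=> a g a1 /= ge; rewrite phiZ normrM (le_trans _ ge)// ler_piMl.
  - by move=> K cK KO; exact: nphi.
apply: filterS (lf_nbhs0_nbhs f nW) => _ [g /= ge <-].
by rewrite phiD opprD addrA subrr sub0r normrN.
Qed.

Lemma vn_bounded_lf (B W : set V) : vn_bounded B -> lf_nbhs0 W ->
  exists2 r : R, 0 < r & forall v, B v -> W (r *: v).
Proof.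
move=> bB nW; have [r r0 h] := bB _ (lf_nbhs0_nbhs 0 nW).
exists r^-1; first by rewrite invr_gt0.
move=> v /(h r); rewrite gtr0_norm// => /(_ (lexx _))[_ [g Wg <-] <-].
by rewrite add0r scalerA mulVf ?scale1r// lt0r_neq0.
Qed.

Lemma vn_bounded_partial (B : set V) m : vn_bounded B -> exists2 e : R, 0 < e &
  forall f, B f -> forall s, (size s <= m)%N -> forall x, `|iter_partial s f x| <= e.
Proof.
move=> bB; pose W : set V := [set f | forall s, (size s <= m)%N ->
  forall x, `|iter_partial s f x| <= 1].
have [|r r0 h] := @vn_bounded_lf B W bB.
  split.
  - apply/convex_setP => f g a a0 a1 /= Wf Wg s sm x.
    have -> : testfun_fun (a *: f + (1 - a) *: g) =
      a *: testfun_fun f + testfun_fun ((1 - a) *: g) by [].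
    rewrite iter_partialP; [|exact: testfun_smooth|exact: testfun_smooth].
    have -> : testfun_fun ((1 - a) *: g) = (1 - a) *: testfun_fun g by [].
    rewrite iter_partialZ; last exact: testfun_smooth.
    have a1' : 0 <= 1 - a by rewrite subr_ge0.
    rewrite fctE [X in `|X + _|](_ : _ = a * iter_partial s f x)// [X in `|_ + X|](_ : _ =
      (1 - a) * iter_partial s g x)//.
    rewrite (le_trans (ler_normD _ _))// !normrM (ger0_norm a0) (ger0_norm a1').
    by have := ler_wpM2l a0 (Wf s sm x); have := ler_wpM2l a1' (Wg s sm x); lra.
  - move=> a f a1 /= Wf s sm x.
    have -> : testfun_fun (a *: f) = a *: testfun_fun f by [].
    rewrite iter_partialZ; last exact: testfun_smooth.
    rewrite [X in `|X|](_ : _ = a * iter_partial s f x)// normrM mulr_ile1//; exact: Wf.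
  - by move=> K cK KO; exists m, 1; split=> // f _ h s sm x; exact: h.
exists r^-1; first by rewrite invr_gt0.
move=> f /h Wf s sm x; have := Wf s sm x.
have -> : testfun_fun (r *: f) = r *: testfun_fun f by [].
rewrite iter_partialZ; last exact: testfun_smooth.
rewrite [X in `|X|](_ : _ = r * iter_partial s f x)// normrM (gtr0_norm r0).
by rewrite -ler_pdivlMl// mulr1.
Qed.

Hypothesis oO : open O.

(** Otherwise there are f_j in [B] and x_j outside [exh j] with f_j(x_j) nonzero. The conditions
    (j+1) |g(x_j)| <= |f_j(x_j)| define a neighbourhood of 0, because a compact set contains x_j for
    finitely many j only; yet no positive multiple of [B] fits into it. *)
Lemma vn_bounded_support (B : set V) : vn_bounded B ->
  exists j, forall f, B f -> forall x, f x != 0 -> exh O j x.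
Proof.
move=> bB; apply: contrapT => hn.
have /choice[F hF] : forall j, exists fx : V * E, [/\ B fx.1, fx.1 fx.2 != 0 & ~ exh O j fx.2].
  move=> j; apply: contrapT => hj; apply: hn; exists j => f Bf x fx.
  by apply: contrapT => nx; apply: hj; exists (f, x).
pose x j := (F j).2; pose a j : R := `|(F j).1 (x j)|.
have a0 j : 0 < a j by rewrite normr_gt0; have [] := hF j.
pose W : set V := [set g | forall j, j.+1%:R * `|g (x j)| <= a j].
have [|r r0 h] := @vn_bounded_lf B W bB.
  split.
  - apply/convex_setP => f g b b0 b1 /= Wf Wg j.
    rewrite [X in `|X|](_ : _ = b * f (x j) + (1 - b) * g (x j))//.
    have b1' : 0 <= 1 - b by rewrite subr_ge0.
    have := ler_normD (b * f (x j)) ((1 - b) * g (x j));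
      rewrite !normrM (ger0_norm b0) (ger0_norm b1').
    move=> /(ler_wpM2l (ler0n R j.+1)) /le_trans; apply.
    by have := ler_wpM2l b0 (Wf j); have := ler_wpM2l b1' (Wg j); lra.
  - move=> b f b1 /= Wf j; rewrite [X in `|X|](_ : _ = b * f (x j))// normrM.
    by apply: le_trans (Wf j); rewrite ler_pM2l// ler_piMl.
  - move=> K cK KO; have [J KJ] := compact_exh oO cK KO.
    have [e e0 he] : exists2 e : R, 0 < e & forall j, (j < J)%N -> j.+1%:R * e <= a j.
      elim: (J) => [|n [e e0 he]]; first by exists 1.
      exists (Num.min e (a n / n.+1%:R)); first by rewrite lt_min e0 divr_gt0.
      move=> j; rewrite ltnS leq_eqVlt => /predU1P[->|jn].
        by rewrite mulrC -ler_pdivlMr// ge_min lexx orbT.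
      by apply: le_trans (he j jn); rewrite ler_pM2l// ge_min lexx.
    exists 0%N, e; split=> // f fK hf j; have [jJ|Jj] := ltnP j J.
      by apply: le_trans (he j jJ); rewrite ler_pM2l//; exact: (hf [::]).
    suff -> : f (x j) = 0 by rewrite normr0 mulr0 ltW.
    apply/eqP; apply: contrapT => /negP /testfun_support /fK /KJ xJ.
    by have [_ _] := hF j; apply; exact: exh_nondecreasing xJ.
(* With this [j] one has (j+1) r > 1, so r f_j violates the condition at x_j. *)
have := h; pose j := Num.trunc r^-1.
move=> /(_ (F j).1); have [Bj _ _] := hF j => /(_ Bj)/(_ j).
rewrite [X in `|X|](_ : _ = r * (F j).1 (x j))// normrM gtr0_norm// mulrA.
rewrite -/(a j) -[leRHS]mul1r ler_pM2r// leNgt => /negP; apply.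
by rewrite -ltr_pdivrMr// mul1r; exact: archimedean.Num.Theory.truncnS_gt.
Qed.

End testfun_topology.

(** * Pairing square summable sequences with test functions *)

Section pairing.
Context (R : realType) (d : nat) (O : set 'rV[R]_d).
Local Notation E := 'rV[R]_d.
Local Notation V := (testfun O).
Hypothesis oO : open O.

Lemma partial_support (K : set E) (f : E -> R) i : closed K -> (forall x, ~ K x -> f x = 0) ->
  forall x, ~ K x -> 'D_(delta_mx 0 i) f x = 0.
Proof.
move=> cK fK x Kx; rewrite (@near_eq_derive _ _ _ f (cst 0)) ?derive_cst//.
have : nbhs x (~` K) by apply: open_nbhs_nbhs; split=> //; exact: closed_openC.
  by apply: filterS => y Ky; exact: fK.
Qed.

Lemma partial_bounded (K : set E) m : compact K -> forall f : E -> R, smooth f ->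
  (forall x, ~ K x -> f x = 0) -> exists2 e : R, 0 < e &
  forall s, (size s <= m)%N -> forall x, `|iter_partial s f x| <= e.
Proof.
move=> cK; have clK : closed K by apply: compact_closed => //; exact: norm_hausdorff.
elim: m => [|m IH] f sf fK.
  have [cf _] := sf [::].
  have /compact_bounded[M [_ hM]] : compact (f @` K).
    by apply: continuous_compact => //; apply: continuous_subspaceT.
  exists (`|M| + 1); first by rewrite ltr_wpDl.
  move=> [|//] _ x /=; have [Kx|/fK ->] := pselect (K x).
    by apply: (hM (`|M| + 1)); [rewrite ltr_pwDr// ler_norm|exists x].
  by rewrite normr0 addr_ge0.
have /choice[e he] : forall i : 'I_d, exists e : R, 0 < e /\ forall s, (size s <= m)%N ->
  forall x,
    `|iter_partial s (fun x => 'D_(delta_mx 0 i) f x) x| <= e.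
  move=> i; have [e e0 he] := IH _ (smooth_partial i sf) (partial_support _ clK fK).
  by exists e.
have [e0 e00 he0] := IH _ sf fK.
have s0 : 0 <= \sum_i e i by apply: sumr_ge0 => i _; have [/ltW] := he i.
exists (e0 + \sum_i e i); first by rewrite ltr_pwDl.
move=> s; case/lastP: s => [|s i] sm x.
  by apply: le_trans (he0 [::] _ x) _ => //; rewrite lerDl.
rewrite iter_partial_rcons; have [_ h] := he i.
rewrite size_rcons in sm; apply: le_trans (h s sm x) _.
rewrite (bigD1 i)//= addrCA lerDl addr_ge0 ?(ltW e00)//.
by apply: sumr_ge0 => k _; have [/ltW] := he k.
Qed.

Lemma testfun_partial_bounded (f : V) m : exists2 e : R, 0 < e &
  forall s, (size s <= m)%N -> forall x, `|iter_partial s f x| <= e.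
Proof.
have [sf cf _] := testfunP f; apply: (@partial_bounded _ m cf _ sf) => x nx.
by apply/eqP; apply: contrapT => /negP /testfun_support.
Qed.

Lemma testfun_exh (f : V) : exists j, forall x, f x != 0 -> exh O j x.
Proof.
have [_ cf fO] := testfunP f; have [j hj] := compact_exh oO cf fO.
by exists j => x /testfun_support /hj.
Qed.

Implicit Types (u v : item -> R) (f g : V).

Definition sqsum j n u : R := \sum_(0 <= k < n) \sum_(p <- block d j k) u p ^+ 2.

Definition sq_summable u := forall j, exists C, forall n, sqsum j n u <= C.

Definition pair_term j u f (k : nat) : R :=
  \sum_(p <- block d j k) coef O p f / weight R p * u p.

Definition pair_shell j u f : R := limn (series (pair_term j u f)).

(** Cauchy-Schwarz in the form 2|bx| <= la b^2 + x^2 / la, which avoids square roots; [la] is left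
    free to balance the two sums. *)
Lemma pair_term_bound j u f n (la e : R) : 0 < la ->
  (forall s, (size s <= d)%N -> forall x, `|iter_partial s f x| <= e) ->
  2 * \sum_(0 <= k < n) `|pair_term j u f k| <= la * e ^+ 2 * coef_const R d j +
    la^-1 * sqsum j n u.
Proof.
move=> la0 he; rewrite -mulrA.
apply: le_trans (lerD (ler_wpM2l (ltW la0) (sum_coef_square O j n (testfun_smooth f) he))
  (lexx _)).
rewrite /sqsum !mulr_sumr -big_split/=; apply: ler_sum => k _.
rewrite (le_trans (ler_wpM2l _ (ler_norm_sum _ _ _)))//.
rewrite !mulr_sumr -big_split/=; apply: ler_sum => p _.
set b := _ / _; set x := u p; rewrite normrM.
rewrite -[b ^+ 2]real_normK ?num_real// -[x ^+ 2]real_normK ?num_real//.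
set B := `|b|; set X := `|x|.
have : 0 <= la^-1 * (la * B - X) ^+ 2 by rewrite mulr_ge0 ?invr_ge0 ?sqr_ge0// ltW.
have -> : la^-1 * (la * B - X) ^+ 2 = la * B ^+ 2 + la^-1 * X ^+ 2 - 2 * (B * X).
  by field; rewrite lt0r_neq0.
lra.
Qed.

Lemma cvg_pair_shell j u f C : (forall n, sqsum j n u <= C) -> cvgn (series (pair_term j u f)).
Proof.
move=> hC; have [e _ he] := testfun_partial_bounded f d.
apply: normed_cvg; apply: nondecreasing_is_cvgn.
  by apply: nondecreasing_series => k _ _; exact: normr_ge0.
exists (1 * e ^+ 2 * coef_const R d j + 1^-1 * C) => _ [n _ <-].
rewrite [leLHS](_ : _ = \sum_(0 <= k < n) `|pair_term j u f k|)//.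
have := pair_term_bound j u n ltr01 he; have := hC n; rewrite invr1 !mul1r.
have : 0 <= \sum_(0 <= k < n) `|pair_term j u f k| by apply: sumr_ge0.
by lra.
Qed.

Lemma pair_shell_bound j u f (la e C : R) : 0 < la ->
  (forall s, (size s <= d)%N -> forall x, `|iter_partial s f x| <= e) ->
  (forall n, sqsum j n u <= C) ->
  2 * `|pair_shell j u f| <= la * e ^+ 2 * coef_const R d j + la^-1 * C.
Proof.
move=> la0 he hC; have cv := @cvg_pair_shell j u f C hC.
set B := leRHS.
have hB n : `|series (pair_term j u f) n| <= B / 2.
  rewrite ler_pdivlMr// mulrC.
  apply: le_trans (ler_wpM2l _ (ler_norm_sum _ _ _)) _ => //.
  apply: le_trans (pair_term_bound _ _ _ la0 he) _.
  by rewrite /B lerD2l ler_pM2l ?invr_gt0.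
rewrite mulrC -ler_pdivlMr// ler_norml; apply/andP; split.
  by apply: limr_ge => //; apply: nearW => n; have := hB n; rewrite ler_norml => /andP[].
by apply: limr_le => //; apply: nearW => n; have := hB n; rewrite ler_norml => /andP[].
Qed.

Lemma pair_shell_linear_test j u C : (forall n, sqsum j n u <= C) -> scalar (pair_shell j u).
Proof.
move=> hC a f g; rewrite /pair_shell.
have -> : series (pair_term j u (a *: f + g)) =
    (fun n => a * series (pair_term j u f) n + series (pair_term j u g) n).
  apply/funext => n; rewrite /series /= mulr_sumr -big_split/=; apply: eq_bigr => k _.
  rewrite /pair_term mulr_sumr -big_split/=; apply: eq_bigr => p _.
  rewrite [coef O p _](_ : _ = a * coef O p f + coef O p g); last exact: coef_linear.
  by ring.
apply/cvg_lim => //; apply: cvgD; last exact: cvg_pair_shell hC.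
by apply: cvgMr; exact: cvg_pair_shell hC.
Qed.

Lemma pair_shellB j u v f C : (forall n, sqsum j n u <= C) -> (forall n, sqsum j n v <= C) ->
  pair_shell j (u - v) f = pair_shell j u f - pair_shell j v f.
Proof.
move=> hu hv; rewrite /pair_shell.
have -> : series (pair_term j (u - v) f) =
    (fun n => series (pair_term j u f) n - series (pair_term j v f) n).
  apply/funext => n; rewrite /series /= -sumrB; apply: eq_bigr => k _.
  by rewrite /pair_term -sumrB; apply: eq_bigr => p _; rewrite fctE mulrBr.
by apply/cvg_lim => //; apply: cvgB; exact: cvg_pair_shell.
Qed.

Lemma pair_shell_eq0 j u f k : (forall x, f x != 0 -> exh O k x) -> (k.+1 < j)%N ->
  pair_shell j u f = 0.
Proof.
move=> fk kj; rewrite /pair_shell (_ : series _ = cst 0) ?lim_cst//.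
apply/funext => n; rewrite /series /= big1// => r _;
  rewrite /pair_term big1_seq// => p /andP[_ /mem_block[pj _ _]].
by rewrite (coef_eq0 fk) ?mul0r// pj.
Qed.

(** The sequence is eventually constant for each test function, because only finitely many shells
    meet a neighbourhood of its support. The limit spares the definition a bound depending on
    [f]. *)
Definition pair_fun u f : R := limn (fun N => \sum_(0 <= j < N) pair_shell j u f).

Lemma pair_funE u f k N : (forall x, f x != 0 -> exh O k x) -> (k.+1 < N)%N ->
  pair_fun u f = \sum_(0 <= j < N) pair_shell j u f.
Proof.
move=> fk kN; apply: lim_near_cst => //; exists N => // n /= Nn.
rewrite (big_cat_nat (n := N))//= [X in _ + X]big_nat_cond [X in _ + X]big1 ?addr0// => j.
move=> /andP[/andP[Nj _] _]; apply: (pair_shell_eq0 _ fk).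
exact: leq_trans kN Nj.
Qed.

Lemma pair_fun_bound u f k (la e : R) (C : nat -> R) : (forall x, f x != 0 -> exh O k x) ->
  0 < la ->
  (forall s, (size s <= d)%N -> forall x, `|iter_partial s f x| <= e) ->
  (forall j, (j < k.+2)%N -> forall n, sqsum j n u <= C j) ->
  2 * `|pair_fun u f| <= \sum_(0 <= j < k.+2) (la * e ^+ 2 * coef_const R d j + la^-1 * C j).
Proof.
move=> fk la0 he hC; rewrite (pair_funE _ fk (leqnn _)).
rewrite (le_trans (ler_wpM2l _ (ler_norm_sum _ _ _)))// mulr_sumr.
rewrite big_nat_cond [leRHS]big_nat_cond; apply: ler_sum => j /andP[/andP[_ jk] _].
exact: pair_shell_bound (hC j jk).
Qed.

Lemma sq_summableB u v : sq_summable u -> sq_summable v -> sq_summable (u - v).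
Proof.
move=> su sv j; have [Cu hu] := su j; have [Cv hv] := sv j.
exists (2 * Cu + 2 * Cv) => n.
apply: (@le_trans _ _ (2 * sqsum j n u + 2 * sqsum j n v)); last first.
  by have := hu n; have := hv n; lra.
rewrite /sqsum !mulr_sumr -big_split/=; apply: ler_sum => k _.
rewrite !mulr_sumr -big_split/=; apply: ler_sum => p _.
by rewrite [(u - v) p](_ : _ = u p - v p)//; have := sqr_ge0 (u p + v p); lra.
Qed.

Lemma pair_fun_scalar u : sq_summable u -> scalar (pair_fun u).
Proof.
move=> su a f g; have [k1 h1] := testfun_exh f; have [k2 h2] := testfun_exh g.
pose k := maxn k1 k2.
have fk x : f x != 0 -> exh O k x by move/h1; apply: exh_nondecreasing; exact: leq_maxl.
have gk x : g x != 0 -> exh O k x by move/h2; apply: exh_nondecreasing; exact: leq_maxr.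
have hk x : (a *: f + g : V) x != 0 -> exh O k x.
  have [fx0|/fk //] := eqVneq (f x) 0.
  by move=> h; apply: gk; apply: contra h => /eqP gx0; change (a * f x + g x == 0);
    rewrite fx0 gx0 mulr0 addr0.
rewrite !(@pair_funE _ _ k k.+2)// mulr_sumr -big_split/=; apply: eq_bigr => j _.
by have [C hC] := su j; rewrite (pair_shell_linear_test hC).
Qed.

Lemma pair_funB u v f : sq_summable u -> sq_summable v ->
  pair_fun (u - v) f = pair_fun u f - pair_fun v f.
Proof.
move=> su sv; have [k h] := testfun_exh f.
rewrite !(@pair_funE _ _ k k.+2)// -sumrB; apply: eq_bigr => j _.
have [Cu hu] := su j; have [Cv hv] := sv j.
apply: (@pair_shellB _ _ _ _ (Num.max Cu Cv)) => n;
  apply: le_trans (_ : _ <= Num.max Cu Cv) => //.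
  by rewrite le_max lexx.
by rewrite le_max lexx orbT.
Qed.

Lemma pair_fun_continuous u : sq_summable u -> continuous (pair_fun u).
Proof.
move=> su; have lu := pair_fun_scalar su.
have /choice[C hC] : forall j, exists C, forall n, sqsum j n u <= C by [].
apply: scalar_continuous => // K cK KO e e0; have [k Kk] := compact_exh oO cK KO.
(* A bound for test functions supported in [K] with derivatives at most 1, to which [f] is rescaled;
   the absolute value and the added 1 make it positive. *)
pose D : R := `|\sum_(0 <= j < k.+2) (1 * 1 ^+ 2 * coef_const R d j + 1^-1 * C j)| + 1.
have D0 : 0 < D by rewrite ltr_wpDl.
exists d, (e / D); split; first exact: divr_gt0.
move=> f fK hf /=; pose g : V := (D / e) *: f.
have gE : pair_fun u g = D / e * pair_fun u f.
  have lu0 : pair_fun u 0 = 0 by have := lu (-1) 0 0; rewrite scaler0 addr0; lra.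
  by have := lu (D / e) f 0; rewrite lu0 !addr0.
have De : 0 < D / e by rewrite divr_gt0.
have : 2 * `|pair_fun u g| <= D; last first.
  rewrite gE normrM gtr0_norm// mulrCA mulrAC ler_pdivrMr// ler_pM2l//.
  by have := normr_ge0 (pair_fun u f); lra.
apply: (@le_trans _ _ (D - 1)); last by rewrite gerBl.
rewrite /D addrK; apply: le_trans (ler_norm _).
apply: pair_fun_bound => //.
- move=> x; have [fx0|fx _] := eqVneq (f x) 0; last by apply/Kk/fK; exact: testfun_support.
  by move=> /negP h; exfalso; apply: h; change (D / e * f x == 0); rewrite fx0 mulr0.
- move=> s sd x; have -> : testfun_fun g = (D / e) *: testfun_fun f by [].
  rewrite iter_partialZ; last exact: testfun_smooth.
  rewrite [X in `|X|](_ : _ = D / e * iter_partial s f x)// normrM gtr0_norm//.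
  have := hf s x sd; rewrite -(ler_pM2l De) => /le_trans; apply.
  by rewrite mulrA divfK ?mulfV// lt0r_neq0.
Qed.

(** The default 0 makes the map total, so that composing it with a random sequence yields a
    functional at every [w]. *)
Definition pairing u : strong_dual V :=
  if pselect (sq_summable u) is left su then
    StrongDual (introT (asboolP _) (conj (pair_fun_scalar su) (pair_fun_continuous su)) :
      pair_fun u \in @dual_pred R V)
  else 0.

Lemma pairingE u f : sq_summable u -> pairing u f = pair_fun u f.
Proof. by rewrite /pairing; case: pselect. Qed.

Lemma pairingB u v : sq_summable u -> sq_summable v -> pairing (u - v) = pairing u - pairing v.
Proof.
move=> su sv; apply/val_inj/funext => f.
change (pairing (u - v) f = pairing u f - pairing v f).
by rewrite !pairingE ?pair_funB//; exact: sq_summableB.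
Qed.

(** A bounded set of test functions has a common compact support and common bounds on derivatives up
    to order [d], so strong neighbourhoods only test finitely many shells. *)
Lemma pairing_continuous u (U : set (strong_dual V)) : sq_summable u -> open U ->
  U (pairing u) ->
  exists J, exists2 rho : R, 0 < rho & forall v, sq_summable v ->
    (forall j, (j < J)%N -> forall n, sqsum j n (v - u) <= rho) -> U (pairing v).
Proof.
move=> su oU Uu.
have [U' [oU' U'u U'U]] : nbhs (pairing u) U by apply: open_nbhs_nbhs; split.
have [B [e [bB e0 hU]]] := oU' _ U'u.
have [k hk] := vn_bounded_support oO bB; have [c c0 hc] := vn_bounded_partial d bB.
pose S : R := c ^+ 2 * \sum_(0 <= j < k.+2) coef_const R d j.
have S0 : 0 <= S.
  by rewrite mulr_ge0 ?sqr_ge0//; apply: sumr_ge0 => j _;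
    rewrite exprn_ge0// !mulr_ge0// exprn_ge0.
(* Then la S <= e, and the k + 2 shells, each with sum of squares at most [rho], contribute (k+2)
   rho / la = e; the total 2e bounds twice the difference. *)
pose la := e / (S + 1); have la0 : 0 < la by rewrite divr_gt0// ltr_wpDl.
exists k.+2, (la * e / k.+2%:R); first by apply: divr_gt0 => //; exact: mulr_gt0.
move=> v sv hv; apply/U'U/hU => /= f Bf.
rewrite !pairingE// -pair_funB//.
have := pair_fun_bound (hk f Bf) la0 (hc f Bf) hv.
rewrite big_split/= -mulr_sumr -mulr_sumr sumr_const_nat subn0 -(mulr_natr (la * e / _))
  divfK ?pnatr_eq0//.
rewrite mulKf ?lt0r_neq0//.
have : la * c ^+ 2 * \sum_(0 <= j < k.+2) coef_const R d j <= e.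
  by rewrite -mulrA -/S /la mulrAC ler_pdivrMr ?ltr_wpDl// ler_pM2l//; lra.
lra.
Qed.

End pairing.

(** * Borel measurability through a countable dense set *)

Section pairing_measurable.
Context (R : realType) (d : nat) (O : set 'rV[R]_d).
Local Notation V := (testfun O).
Hypothesis oO : open O.
Implicit Types (u v : item -> R).

Let rat_seq := seq ((nat * (seq nat * seq int)) * rat).

(** Association lists encode the finitely supported rational sequences, which form a countable type;
    indices that are not listed get 0. *)
Definition rat_point (a : rat_seq) : item -> R :=
  fun p => ratr (nth 0 (unzip2 a) (index p (unzip1 a))).

Lemma rat_point_map (L : seq item) (q : item -> rat) p :
  rat_point [seq (p, q p) | p <- L] p = if p \in L then ratr (q p) else 0.
Proof.
rewrite /rat_point /unzip1 /unzip2 -!map_comp /= map_id.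
case: ifPn => [pL|pL]; first by rewrite (nth_map p) ?index_mem// nth_index.
by rewrite nth_default ?raddf0// size_map; move: pL; rewrite -index_mem -leqNgt.
Qed.

(** The second bound keeps the error below |x| at listed indices as well, so that the tail estimate
    need not ask which indices are listed. *)
Lemma rat_approx (x e : R) : 0 < e -> exists q : rat,
  `|x - ratr q| <= e /\ `|x - ratr q| <= `|x|.
Proof.
move=> e0; have [->|x0] := eqVneq x 0.
  by exists 0; rewrite raddf0 subr0 normr0; split=> //; exact: ltW.
pose m := Num.min e `|x|; have m0 : 0 < m by rewrite lt_min e0 normr_gt0.
have xm : x - m < x + m by lra.
have [q] := rat_in_itvoo xm; rewrite in_itv/= => /andP[q1 q2].
exists q; have : `|x - ratr q| <= m by rewrite ler_norml; apply/andP; split; lra.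
by rewrite le_min => /andP[].
Qed.

Lemma sqsum_tail j u (e : R) : sq_summable d u -> 0 < e -> exists N, forall n,
  \sum_(N <= k < n) \sum_(p <- block d j k) u p ^+ 2 <= e.
Proof.
move=> /(_ j)[C hC] e0; pose a k : R := \sum_(p <- block d j k) u p ^+ 2.
have a0 k : 0 <= a k by apply: sumr_ge0 => p _; exact: sqr_ge0.
have cv : cvgn (series a).
  apply: nondecreasing_is_cvgn; first by apply: nondecreasing_series => k _ _.
  by exists C => _ [n _ <-]; exact: hC.
have /cvgrPdist_lt/(_ _ e0)[N _ hN] := cv.
have hl n : series a n <= lim (series a @ \oo).
  by apply: nondecreasing_cvgn_le => //; apply: nondecreasing_series => k _ _.
exists N => n; have [nN|Nn] := leqP n N; first by rewrite big_geq// ltW.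
have := hN N (leqnn N); have := hl n; rewrite /series /=.
rewrite (big_cat_nat (n := N))// 1?ltnW//=.
set L := lim _; set S := \sum_(0 <= k < N) _; set S' := \sum_(N <= k < n) _.
by move=> h1 /ltr_normlW; lra.
Qed.

Lemma rat_point_dense u J (e : R) : sq_summable d u -> 0 < e ->
  exists a, forall j, (j < J)%N -> forall n, sqsum d j n (u - rat_point a) <= e.
Proof.
move=> su e0; have e20 : 0 < e / 2 by rewrite divr_gt0.
have /choice[Nj hNj] : forall j, exists N, forall n,
  \sum_(N <= k < n) \sum_(p <- block d j k) u p ^+ 2 <= e / 2.
  by move=> j; exact: sqsum_tail.
pose N := \max_(j < J) Nj j.
pose L := flatten [seq flatten [seq block d j k | k <- iota 0 N] | j <- iota 0 J].
pose c := (\sum_(j < J) \sum_(0 <= k < N) size (block d j k))%N.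
pose D : R := e / 2 / c.+1%:R.
have D0 : 0 < D by rewrite divr_gt0.
have /choice[q hq] : forall p, exists q : rat,
  `|u p - ratr q| <= Num.sqrt D /\ `|u p - ratr q| <= `|u p|.
  by move=> p; apply: rat_approx; rewrite sqrtr_gt0.
exists [seq (p, q p) | p <- L] => j jJ n.
set v := rat_point _.
have h1 p : (u p - v p) ^+ 2 <= u p ^+ 2.
  rewrite /v rat_point_map; case: ifP => _; last by rewrite subr0.
  by rewrite -real_normK ?num_real// -[leRHS]real_normK ?num_real// lerXn2r ?nnegrE//;
    have [] := hq p.
have h2 p : p \in L -> (u p - v p) ^+ 2 <= D.
  move=> pL; rewrite /v rat_point_map pL -real_normK ?num_real//.
  by rewrite -(sqr_sqrtr (ltW D0)) lerXn2r ?nnegrE ?sqrtr_ge0//; have [] := hq p.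
have jL k : (k < N)%N -> {subset block d j k <= L}.
  move=> kN p pk; apply/flattenP; exists (flatten [seq block d j k | k <- iota 0 N]).
    by apply/mapP; exists j => //; rewrite mem_iota.
  apply/flattenP; exists (block d j k) => //.
  by apply/mapP; exists k => //; rewrite mem_iota.
have NjN : (Nj j <= N)%N by rewrite /N (bigD1 (Ordinal jJ))//= leq_maxl.
pose F k : R := \sum_(p <- block d j k) (u p - v p) ^+ 2.
have F0 k : 0 <= F k by apply: sumr_ge0 => p _; exact: sqr_ge0.
pose m := maxn n N.
have -> : sqsum d j n (u - v) = \sum_(0 <= k < n) F k by [].
have e1 : \sum_(0 <= k < n) F k <= \sum_(0 <= k < m) F k.
  by rewrite (big_cat_nat (n := n) (p := m))//= ?leq_maxl// lerDl sumr_ge0.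
have e2 : \sum_(0 <= k < m) F k = \sum_(0 <= k < N) F k + \sum_(N <= k < m) F k.
  by rewrite (big_cat_nat (n := N))//= leq_maxr.
have e3 : \sum_(0 <= k < N) F k <= e / 2.
  apply: (@le_trans _ _ (\sum_(0 <= k < N) (size (block d j k))%:R * D)).
    rewrite big_nat_cond [leRHS]big_nat_cond; apply: ler_sum => k /andP[/andP[_ kN] _].
    rewrite mulr_natl -[X in _ *+ X]count_predT -[leRHS]addr0 -iter_addr -big_const_seq.
    by rewrite /F big_seq [leRHS]big_seq; apply: ler_sum => p /(jL _ kN)/h2.
  rewrite -mulr_suml -natr_sum /D mulrCA ler_piMr ?(ltW e20)// ler_pdivrMr// mul1r.
  by rewrite ler_nat ltnW// ltnS /c (bigD1 (Ordinal jJ))//= leq_addr.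
have e4 : \sum_(N <= k < m) F k <= e / 2.
  apply: le_trans (hNj j m).
  apply: (@le_trans _ _ (\sum_(N <= k < m) \sum_(p <- block d j k) u p ^+ 2)).
    by apply: ler_sum => k _; apply: ler_sum => p _; exact: h1.
  rewrite [leRHS](big_cat_nat (n := N))//= ?leq_maxr// lerDr.
  by apply: sumr_ge0 => k _; apply: sumr_ge0 => p _; exact: sqr_ge0.
lra.
Qed.

(** A Lindelof argument on the side of the sequences: the preimage of an open set is the union of
    the countably many rational balls that the pairing maps into it, and ball membership is given by
    countably many conditions on finite sums of squares. *)
Lemma pairing_measurable disp (T : measurableType disp) (u : T -> item ->
  R) (B : set (strong_dual V)) :
  (forall p, measurable_fun setT (fun w => u w p)) -> (forall w, sq_summable d (u w)) ->
  borel (strong_dual V) B -> measurable [set w | B (pairing oO (u w))].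
Proof.
move=> mu su; move: B; apply: smallest_sub.
  split=> [|A hA|F hF] /=.
  - by rewrite (_ : [set _ | _] = set0)//; exact/seteqP.
  - rewrite (_ : [set _ | _] = ~` [set w | A (pairing oO (u w))]).
      exact: measurableC.
    by apply/seteqP; split=> w /=; [move=> []|move=> h; split].
  - rewrite (_ : [set _ | _] = \bigcup_i [set w | F i (pairing oO (u w))]).
      exact: bigcupT_measurable.
    by apply/seteqP; split=> w /= [i _ h]; exists i.
move=> U oU /=.
pose ball_ (a : rat_seq) J k (v : item -> R) : Prop :=
  forall j, (j < J)%N -> forall n, sqsum d j n (v - rat_point a) <= k.+1%:R^-1.
pose good (i : (rat_seq * nat * nat)%type) := forall v, sq_summable d v ->
  ball_ i.1.1 i.1.2 i.2 v -> U (pairing oO v).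
rewrite (_ : [set _ | _] = \bigcup_(i : (rat_seq * nat * nat)%type)
    [set w | good i /\ ball_ i.1.1 i.1.2 i.2 (u w)]).
  apply: countable_bigcupT_measurable; first exact: countableP.
  move=> [[a J] k] /=.
  have [g|ng] := pselect (good (a, J, k)); last first.
    by rewrite (_ : [set _ | _] = set0)// -subset0 => w [].
  rewrite (_ : [set _ | _] = \bigcap_j \bigcap_n
    [set w | (j < J)%N -> sqsum d j n (u w - rat_point a) <= k.+1%:R^-1]); last first.
    apply/seteqP; split=> w /=; first by move=> [_ h] j _ n _ /= jJ; exact: h.
    by move=> h; split=> // j jJ n; exact: (h j I n I).
  apply: bigcapT_measurable => j; apply: bigcapT_measurable => n.
  have [jJ|Jj] := boolP (j < J)%N; last first.
    by rewrite (_ : [set _ | _] = setT)//; apply/seteqP; split.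
  rewrite (_ : [set _ | _] = setT `&` (fun w => sqsum d j n (u w - rat_point a)) @^-1` [set`
    `]-oo, (k.+1%:R^-1 : R)]]).
    suff mf : measurable_fun setT (fun w => sqsum d j n (u w - rat_point a)) by apply: mf.
    apply: measurable_sum => r; apply: measurable_sum => p; apply: measurable_funX.
    exact: measurable_funB.
  by apply/seteqP; split=> w /=; rewrite in_itv/=; [move=> /(_ isT) ->|move=> [] //].
apply/seteqP; split=> w /=; last by move=> [i _ [g h]]; exact: g.
move=> Uw; have [J [rho rho0 h]] := pairing_continuous (su w) oU Uw.
(* The distance of two points of a ball is estimated by |v - u|^2 <= 2 |v - a|^2 + 2 |u - a|^2,
   hence the 4. *)
pose k := Num.trunc (4 / rho).
have kr : 4 * k.+1%:R^-1 <= rho.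
  rewrite ler_pdivrMr// mulrC -ler_pdivrMr//.
  by rewrite ltW//; exact: archimedean.Num.Theory.truncnS_gt.
have k0 : 0 < k.+1%:R^-1 :> R by rewrite invr_gt0.
have [a ha] := rat_point_dense J (su w) k0.
exists (a, J, k) => //; split=> // v sv hv; apply: h => // j jJ n.
apply: (@le_trans _ _ (2 * sqsum d j n (v - rat_point a) +
  2 * sqsum d j n (u w - rat_point a))).
  rewrite /sqsum !mulr_sumr -big_split/=; apply: ler_sum => r _.
  rewrite !mulr_sumr -big_split/=; apply: ler_sum => p _.
  rewrite [(v - u w) p](_ : _ = v p - u w p)// [(v - _) p](_ : _ = v p - rat_point a p)//.
  rewrite [(u w - _) p](_ : _ = u w p - rat_point a p)//.
  by have := sqr_ge0 (v p + u w p - 2 * rat_point a p); lra.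
have hv' : sqsum d j n (v - rat_point a) <= k.+1%:R^-1 := hv j jJ n.
have ha' : sqsum d j n (u w - rat_point a) <= k.+1%:R^-1 := ha j jJ n.
move: kr hv' ha'; set y := _^-1; set z := sqsum _ _ _ _; set z' := sqsum _ _ _ _; lra.
Qed.

End pairing_measurable.

(** * The Levy process *)

Section product_laws.
Context (R : realType) (disp : measure_display) (T : measurableType disp).
Variable P : probability T R.

Lemma prob_ae_eq (A B : set T) : measurable A -> measurable B ->
  {ae P, forall w, A w <-> B w} -> P A = P B.
Proof.
move=> mA mB h; rewrite -!EFin_oprob//; congr _%:E; apply/eqP; rewrite eq_le.
by apply/andP; split; apply: le_oprob_ae; apply: filterS h => w [].
Qed.

Lemma oprob_bigcup (F : nat -> set T) (e : R) : (forall n, measurable (F n)) ->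
  (forall n, F n `<=` F n.+1) -> (forall n, oprob P (F n) <= e) -> oprob P (\bigcup_n F n) <= e.
Proof.
move=> mF sF hF; have mU : measurable (\bigcup_n F n) by exact: bigcupT_measurable.
rewrite -lee_fin EFin_oprob//.
have ndF : nondecreasing_seq F.
  by apply/nondecreasing_seqP => n; apply/subsetPset.
have cv := nondecreasing_cvg_mu mF mU ndF (mu := P).
rewrite -(cvg_lim _ cv)//; apply: lime_le; first by apply/cvg_ex; exists (P (\bigcup_n F n)).
by apply: nearW => n /=; rewrite -EFin_oprob// lee_fin.
Qed.

Lemma ae_forall_countable (I : countType) (Q : I -> T -> Prop) :
  (forall i, {ae P, forall w, Q i w}) -> {ae P, forall w, forall i, Q i w}.
Proof.
move=> h; have /ae_foralln : forall n, {ae P, forall w,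
  if unpickle n is Some i then Q i w else True}.
  by move=> n; case: (unpickle n) => [i|]; [exact: h|apply: aeW].
by apply: filterS => w hw i; have := hw (pickle i); rewrite pickleK.
Qed.

(** The generators are replaced by sigma-algebras one index at a time, each replacement being a
    pi-lambda argument. *)
Lemma independent_generated (G : nat -> set (set T)) (J : seq nat) (A : nat -> set T) :
  (forall i, setI_closed (G i)) -> (forall i B, G i B -> measurable B) ->
    (forall i, G i setT) ->
  (forall (J : seq nat) (B : nat -> set T), uniq J -> (forall i, G i (B i)) ->
    P (\bigcap_(i in [set` J]) B i) = (\prod_(i <- J) P (B i))%E) ->
  uniq J -> (forall i, <<s G i>> (A i)) ->
  P (\bigcap_(i in [set` J]) A i) = (\prod_(i <- J) P (A i))%E.
Proof.
move=> GI mG GT hG uJ sA.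
have mA i B : <<s G i>> B -> measurable B.
  by apply: smallest_sub; [exact: sigma_algebra_measurable|exact: mG].
have capS (s : seq nat) i (B : nat -> set T) :
    \bigcap_(k in [set` i :: s]) B k = B i `&` \bigcap_(k in [set` s]) B k.
  apply/seteqP; split=> w.
    move=> h; split; first by apply: h; rewrite /= mem_head.
    by move=> k /= ks; apply: h; rewrite /= inE ks orbT.
  by move=> [h1 h2] k /=; rewrite inE => /predU1P[->//|]; exact: h2.
(* [s1] lists the indices already extended, [s2] those still in the generator. To extend one more
   index [i], its event is replaced by a generator [D], and the induction hypothesis applies with
   [i] moved to the second list. *)
suff claim (s1 s2 : seq nat) (B : nat -> set T) : uniq (s1 ++ s2) ->
    (forall i, i \in s1 -> <<s G i>> (B i)) -> (forall i, i \notin s1 -> G i (B i)) ->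
    P (\bigcap_(i in [set` s1 ++ s2]) B i) = (\prod_(i <- s1 ++ s2) P (B i))%E.
  have := claim J [::] (fun i => if i \in J then A i else setT).
  rewrite cats0 => /(_ uJ) h.
  transitivity (P (\bigcap_(i in [set` J]) (if i \in J then A i else setT))).
    by congr (P _); apply: eq_bigcapr => i /= ->.
  rewrite h; last 2 first.
  - by move=> i iJ; rewrite iJ.
  - by move=> i /negbTE ->.
  by apply: eq_big_seq => i ->.
elim: s1 s2 B => [|i s1 IH] s2 B us h1 h2.
  by apply: hG => // i; exact: h2.
have mB k : measurable (B k).
  by have [/h1/mA|/h2/mG] := boolP (k \in i :: s1).
have mC : measurable (\bigcap_(k in [set` s1 ++ s2]) B k).
  by apply: fin_bigcap_measurable => //; exact: finite_seq.
move: us; rewrite [(_ :: s1) ++ s2]/= cons_uniq => /andP[is_ us].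
have prodE : P (\bigcap_(k in [set` s1 ++ s2]) B k) = (\prod_(k <- s1 ++ s2) P (B k))%E.
  pose B' k := if k == i then setT else B k.
  have BB' k : k \in s1 ++ s2 -> B' k = B k.
    by rewrite /B'; case: eqP => // ->; rewrite (negbTE is_).
  transitivity (P (\bigcap_(k in [set` s1 ++ s2]) B' k)).
    by congr (P _); apply: eq_bigcapr => k /= /BB'.
  rewrite IH//; first by apply: eq_big_seq => k /BB' ->.
  - by move=> k ks; rewrite BB' ?mem_cat ?ks//; apply: h1; rewrite inE ks orbT.
  - move=> k ks; rewrite /B'; case: eqP => // /eqP ki; apply: h2.
    by rewrite inE negb_or ki.
rewrite capS big_cons -prodE.
have Bi : <<s G i>> (B i) by apply: h1; rewrite mem_head.
apply: (indep_generated1 (GI i) mC _ Bi).2 => D GD; split; first exact: mG GD.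
pose B' k := if k == i then D else B k.
have BB' k : k \in s1 ++ s2 -> B' k = B k.
  by rewrite /B'; case: eqP => // ->; rewrite (negbTE is_).
have B'i : B' i = D by rewrite /B' eqxx.
have usi : uniq (s1 ++ i :: s2).
  by rewrite -cat_rcons (perm_uniq (_ : perm_eq _ (i :: (s1 ++ s2)))) ?cons_uniq ?is_//
    -cat_cons perm_cat2r perm_rcons.
have := IH (i :: s2) B' usi.
have -> : (\prod_(k <- s1 ++ i :: s2) P (B' k) = P D * \prod_(k <- s1 ++ s2) P (B k))%E.
  rewrite (perm_big (i :: (s1 ++ s2)))/=; last by rewrite -cat_rcons -cat_cons perm_cat2r
    perm_rcons.
  by rewrite big_cons B'i; congr (_ * _)%E; apply: eq_big_seq => k /BB' ->.
have -> : \bigcap_(k in [set` s1 ++ i :: s2]) B' k = D `&` \bigcap_(k in [set` s1 ++ s2]) B k.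
  rewrite -B'i -(_ : \bigcap_(k in [set` s1 ++ s2]) B' k =
    \bigcap_(k in [set` s1 ++ s2]) B k); last first.
    by apply: eq_bigcapr => k /= /BB'.
  rewrite -capS; congr (\bigcap_(k in _) _); apply/seteqP; split=> k /=;
    by rewrite !(inE, mem_cat) orbCA.
rewrite prodE; apply.
- by move=> k ks; rewrite BB' ?mem_cat ?ks//; apply: h1; rewrite inE ks orbT.
- move=> k ks; rewrite /B'; case: eqP => [->//|/eqP ki]; apply: h2.
  by rewrite inE negb_or ki.
Qed.

End product_laws.

Section boxes.
Context (R : realType) (I : eqType).

(** The finite-dimensional boxes, a pi-system generating the product sigma-algebra. *)
Definition box : set (set (I -> R)) :=
  [set Q | exists (s : seq I) (B : I -> set R), (forall i, measurable (B i)) /\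
    Q = [set v | forall i, i \in s -> B i (v i)]].

Lemma setI_closed_box : setI_closed box.
Proof.
move=> _ _ [s1 [B1 [m1 ->]]] [s2 [B2 [m2 ->]]].
exists (s1 ++ s2), (fun i => (if i \in s1 then B1 i else setT) `&`
                        (if i \in s2 then B2 i else setT)); split.
  by move=> i; apply: measurableI; case: ifP.
apply/seteqP; split=> [v [h1 h2] i _|v h] /=.
  by split; case: ifP => //; [exact: h1|exact: h2].
by split=> i si; have := h i; rewrite mem_cat si ?orbT => /(_ isT)[].
Qed.

Lemma box_coord i : measurable_fun setT ((fun v => v i) : g_sigma_algebraType box -> R).
Proof.
move=> _ B mB; rewrite setTI; apply: sub_sigma_algebra.
exists [:: i], (fun=> B); split=> //.
by apply/seteqP; split=> [v Bv j|v /(_ i)] /=; rewrite inE ?eqxx; [move/eqP->|exact].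
Qed.

Context (disp : measure_display) (T : measurableType disp) (P : probability T R).

Lemma box_preimage (X : T -> I -> R) (Q : set (I -> R)) :
  (forall i, measurable_fun setT (X^~ i)) -> <<s box >> Q ->
  <<s cylinder (fun i w => X w i) setT >> (X @^-1` Q).
Proof.
move=> mX; move: Q; apply: smallest_sub.
  have [h0 hC hU] := smallest_sigma_algebra setT (cylinder (fun i w => X w i) setT).
  split=> [|A hA|F hF] /=; first by rewrite preimage_set0.
    by rewrite setTD preimage_setC -setTD; exact: hC.
  by rewrite preimage_bigcup; exact: hU.
by move=> _ [s [B [mB ->]]]; apply: sub_sigma_algebra; exists s, B; split.
Qed.

Lemma box_preimage_measurable (X : T -> I -> R) (Q : set (I -> R)) :
  (forall i, measurable_fun setT (X^~ i)) -> <<s box >> Q -> measurable (X @^-1` Q).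
Proof. by move=> mX hQ; apply: sigma_cylinder_measurable (box_preimage mX hQ). Qed.

(** Finite-dimensional marginals determine the law; measurability of the preimages is carried along
    the Dynkin argument. *)
Lemma box_law_eq (X Y : T -> I -> R) (Q : set (I -> R)) :
  (forall i, measurable_fun setT (X^~ i)) -> (forall i, measurable_fun setT (Y^~ i)) ->
  (forall (s : seq I) (B : I -> set R), (forall i, measurable (B i)) ->
    P [set w | forall i, i \in s -> B i (X w i)] = P [set w | forall i, i \in s ->
      B i (Y w i)]) ->
  <<s box >> Q -> P (X @^-1` Q) = P (Y @^-1` Q).
Proof.
move=> mX mY h hQ.
suff /(_ _ hQ)[] : forall Q, <<s box >> Q ->
  [/\ measurable (X @^-1` Q), measurable (Y @^-1` Q) & P (X @^-1` Q) = P (Y @^-1` Q)] by [].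
move=> {}Q {}hQ; split; [exact: box_preimage_measurable|exact: box_preimage_measurable|].
move: Q hQ; rewrite -setI_closed_g_dynkin_g_sigma_algebra; last exact: setI_closed_box.
suff H : forall Q, <<d box >> Q ->
  [/\ measurable (X @^-1` Q), measurable (Y @^-1` Q) & P (X @^-1` Q) = P (Y @^-1` Q)].
  by move=> Q /H[].
apply: smallest_sub.
  split=> [|A [mA mA' hA]|F tF hF].
  - by rewrite !preimage_setT.
  - split; [exact: (measurableC mA)|exact: (measurableC mA')|].
    change (P (~` (X @^-1` A)) = P (~` (Y @^-1` A))).
    by rewrite (probability_setC P mA) (probability_setC P mA') hA.
  - rewrite !preimage_bigcup.
    have m1 n : measurable (X @^-1` F n) by case: (hF n).
    have m2 n : measurable (Y @^-1` F n) by case: (hF n).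
    split; [exact: bigcupT_measurable|exact: bigcupT_measurable|].
    rewrite !measure_bigcup//; last 2 first.
    + by move=> i j _ _ [w [wi wj]]; apply: tF => //; exists (Y w).
    + by move=> i j _ _ [w [wi wj]]; apply: tF => //; exists (X w).
    by apply: eq_eseriesr => n _; case: (hF n).
move=> _ [s [B [mB ->]]]; split.
- by apply: box_preimage_measurable => //; apply: sub_sigma_algebra; exists s, B; split.
- by apply: box_preimage_measurable => //; apply: sub_sigma_algebra; exists s, B; split.
- exact: h.
Qed.

End boxes.

Section square_truncation.
Context (R : realType) (d : nat).

(** Alters the sequence on the exceptional null set only, so that every path yields an element of
    the dual. *)
Definition sq_trunc (u : item -> R) : item -> R :=
  if `[< sq_summable d u >] then u else 0.

Lemma sq_summable0 : sq_summable d (0 : item -> R).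
Proof.
move=> j; exists 0 => n; rewrite /sqsum big1// => k _; rewrite big1// => p _.
by rewrite expr2 mulr0.
Qed.

Lemma sq_truncP u : sq_summable d (sq_trunc u).
Proof. by rewrite /sq_trunc; case: asboolP => // _; exact: sq_summable0. Qed.

Lemma sq_trunc_id u : sq_summable d u -> sq_trunc u = u.
Proof. by rewrite /sq_trunc; case: asboolP. Qed.

Context (disp : measure_display) (T : measurableType disp).
Variable X : T -> item -> R.
Hypothesis mX : forall p, measurable_fun setT (X^~ p).

Lemma sqsum_measurable j n : measurable_fun setT (fun w => sqsum d j n (X w)).
Proof.
by apply: measurable_sum => r; apply: measurable_sum => p; apply: measurable_funX.
Qed.

Lemma sq_summable_measurable : measurable [set w | sq_summable d (X w)].
Proof.
rewrite (_ : [set _ | _] = \bigcap_j \bigcup_c \bigcap_n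
    [set w | sqsum d j n (X w) <= c%:R]); last first.
  apply/seteqP; split=> w /=.
    move=> h j _; have [C hC] := h j; exists (Num.trunc C).+1 => // n _ /=.
    by apply: le_trans (hC n) _; exact/ltW/archimedean.Num.Theory.truncnS_gt.
  by move=> h j; have [c _ hc] := h j I; exists c%:R => n; exact: (hc n I).
apply: bigcapT_measurable => j; apply: bigcupT_measurable => c; apply: bigcapT_measurable => n.
rewrite (_ : [set _ | _] = setT `&` (fun w => sqsum d j n (X w)) @^-1` [set` `]-oo,
  (c%:R : R)]]).
  by apply: sqsum_measurable.
by apply/seteqP; split=> w /=; rewrite in_itv/=; [move=> ->|move=> []].
Qed.

Lemma sq_trunc_measurable p : measurable_fun setT (fun w => sq_trunc (X w) p).
Proof.
rewrite (_ : (fun _ => _) = (fun w => \1_[set w | sq_summable d (X w)] w * X w p)).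
  by apply: measurable_funM => //; apply: measurable_indic; exact: sq_summable_measurable.
apply/funext => w; rewrite /sq_trunc indicE; case: asboolP => h.
  by rewrite mem_set// mul1r.
by rewrite memNset// mul0r.
Qed.

End square_truncation.

(** * The weighted noise over the cells *)

Section levy_noise.
Context (R : realType) (disp : measure_display) (T : measurableType disp).
Variable P : probability T R.
Context (d : nat).
Local Notation E := 'rV[R]_d.
Local Notation bmeas A := (@measurable _ (borelType E) A).
Variables (O : set E) (M : R -> set E -> {RV P >-> R}).
Hypotheses (LM : levy_valued_random_measure O M) (oO : open O).
Implicit Types (A : set E).

(** The set [A] is kept as a parameter because the integral has to converge over every Borel subset
    of [O]; the process itself takes A = O. *)
Definition noise A (t : R) (w : T) (p : item) : R := weight R p * M t (A `&` cell_set O p) w.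

Lemma noise_measurable A t p : measurable_fun setT (fun w => noise A t w p).
Proof. by apply: measurable_funM => //; exact: measurable_funPT. Qed.

Lemma cell_setI_Bb A p : bmeas A -> Bb O (A `&` cell_set O p).
Proof.
move=> mA; apply: (Bb_sub (cell_set_Bb O p)); last by move=> x [].
by apply: measurableI => //; exact: Bb_meas (cell_set_Bb O p).
Qed.

(** From some level on, the masses of the levels sum to less than the [dl] of [levy_rm_square_sum].
    That level depends neither on the time in [0, t] nor on [A]. *)
Lemma noise_tail j (t e r : R) : 0 <= t -> 0 < e -> 0 < r -> exists N,
  forall h, 0 <= h -> h <= t -> forall A, bmeas A -> forall n,
  oprob P [set w | r <= \sum_(N <= k < n) \sum_(p <- block d j k) noise A h w p ^+ 2] <= e.
Proof.
move=> t0 e0 r0; have [dl dl0 hdl] := levy_rm_square_sum LM (exh_Bb O j) t0 e0 r0.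
have [N hN] := level_mass_tail d dl0.
exists N => h h0 ht A mA n.
pose L := flatten [seq [seq (weight R p, A `&` cell_set O p) | p <- block d j k] | k <-
  index_iota N n].
have LE (F : R * set E -> R) : \sum_(q <- L) F q =
    \sum_(N <= k < n) \sum_(p <- block d j k) F (weight R p, A `&` cell_set O p).
  by rewrite big_flatten big_map; apply: eq_bigr => k _; rewrite big_map.
have := hdl h h0 ht L; rewrite /noise.
under eq_set do rewrite LE.
apply.
  move=> q /flattenP[_ /mapP[k _ ->]] /mapP[p /mem_block[pj _ _] ->] /=; split.
    exact: Bb_meas (cell_setI_Bb p mA).
  by move=> x [_ /cell_set_shell]; rewrite pj => /shell_sub.
move=> z; rewrite LE; apply: le_trans (hN n).
apply: le_trans (sum_weight_le O j N n z).
apply: ler_sum => k _; apply: ler_sum => p _ /=.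
rewrite gtr0_norm ?weight_gt0// ler_pM2l ?weight_gt0// indicI.
by rewrite ler_piMl// !indicE; case: (_ \in _).
Qed.

Lemma noise_tail_sup j (t e r : R) : 0 <= t -> 0 < e -> 0 < r -> exists N,
  forall h, 0 <= h -> h <= t -> forall A, bmeas A ->
  oprob P [set w | exists n, r <= \sum_(N <= k < n) \sum_(p <- block d j k) noise A h w p ^+
    2] <= e.
Proof.
move=> t0 e0 r0; have [N hN] := noise_tail j t0 e0 r0.
exists N => h h0 ht A mA.
pose F n := [set w | r <= \sum_(N <= k < n) \sum_(p <- block d j k) noise A h w p ^+ 2].
rewrite (_ : [set _ | _] = \bigcup_n F n); last first.
  by apply/seteqP; split=> w /=; [move=> [n hn]; exists n|move=> [n _ hn]; exists n].
apply: oprob_bigcup => [n|n w|n]; last exact: hN.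
- rewrite (_ : F n = setT `&` (fun w => \sum_(N <=
  k < n) \sum_(p <- block d j k) noise A h w p ^+ 2) @^-1` [set` `[r, +oo[]).
    suff mf : measurable_fun setT (fun w => \sum_(N <=
      k < n) \sum_(p <- block d j k) noise A h w p ^+ 2).
      exact: mf.
    apply: measurable_sum => k; apply: measurable_sum => p; apply: measurable_funX.
    exact: noise_measurable.
  by apply/seteqP; split=> w /=; rewrite in_itv/= andbT; [move=> h'; split|move=> []].
- rewrite /F /= => /le_trans; apply.
  have [nN|Nn] := ltnP n N; first by rewrite !big_geq// ltnW.
  by rewrite big_nat_recr//= lerDl; apply: sumr_ge0 => p _; exact: sqr_ge0.
Qed.

Lemma noise_summable A t : bmeas A -> 0 <= t -> {ae P, forall w, sq_summable d (noise A t w)}.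
Proof.
move=> mA t0; apply: ae_foralln => j; apply: ae_oprob; apply/eqP; rewrite eq_le oprob_ge0 andbT.
apply/ler_addgt0Pr => e e0; rewrite add0r.
have [N hN] := noise_tail_sup j t0 e0 ltr01.
apply: le_trans (le_oprob P _) (hN t t0 (lexx _) A mA).
move=> w /=; apply: contra_notP => h.
exists (\sum_(0 <= k < N) \sum_(p <- block d j k) noise A t w p ^+ 2 + 1) => n.
have F0 k : 0 <= \sum_(p <- block d j k) noise A t w p ^+ 2 by apply: sumr_ge0 => p _;
  exact: sqr_ge0.
rewrite /sqsum; have [nN|Nn] := leqP n N.
  rewrite [X in _ <= X + _](big_cat_nat (n := n))//= -addrA lerDl addr_ge0//.
  by apply: sumr_ge0 => k _.
rewrite (big_cat_nat (n := N))//= 1?ltnW// lerD2l ltW// ltNge; apply/negP => hn.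
by apply: h; exists n.
Qed.

Lemma noise_list_small (L : seq item) A (e r : R) : bmeas A -> 0 < e -> 0 < r ->
  exists2 h0 : R, 0 < h0 & forall h, 0 <= h -> h <= h0 ->
  oprob P [set w | e <= \sum_(p <- L) noise A h w p ^+ 2] <= r.
Proof.
move=> mA; elim: L e r => [|p L IH] e r e0 r0.
  exists 1 => // h _ _; rewrite (_ : [set _ | _] = set0) ?oprob0 ?(ltW r0)//.
  by rewrite -subset0 => w /=; rewrite big_nil leNgt e0.
have e20 : 0 < e / 2 by rewrite divr_gt0.
have r20 : 0 < r / 2 by rewrite divr_gt0.
have [h1 h10 hh1] := IH _ _ e20 r20.
pose y := Num.sqrt (e / 2) / 2 / weight R p.
have s0 : 0 < Num.sqrt (e / 2) by rewrite sqrtr_gt0.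
have y0 : 0 < y by rewrite !divr_gt0// weight_gt0.
have [h2 h20 hh2] := levy_rm_cvg0 LM (cell_setI_Bb p mA) y0 r20.
exists (Num.min h1 h2); first by rewrite lt_min h10.
move=> h h0; rewrite le_min => /andP[hh1' hh2'].
have -> : r = r / 2 + r / 2 by field.
apply: le_oprobU (hh1 h h0 hh1') (hh2 h h0 hh2') => w /=; rewrite big_cons => hw.
have [hL|hL] := leP (e / 2) (\sum_(p <- L) noise A h w p ^+ 2); [by left|right].
rewrite ltNge; apply/negP => hy.
have : noise A h w p ^+ 2 <= e / 2.
  rewrite -real_normK ?num_real// -(sqr_sqrtr (ltW e20)) lerXn2r ?nnegrE ?sqrtr_ge0//.
  rewrite /noise normrM (gtr0_norm (weight_gt0 _ _)) mulrC -ler_pdivlMr ?weight_gt0//.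
  by apply: le_trans hy _; rewrite /y ler_pM2r ?invr_gt0 ?weight_gt0//; lra.
lra.
Qed.

(** The tail is small uniformly over times in [0, 1]; the finitely many remaining cells are handled
    by stochastic continuity at 0. *)
Lemma noise_small j A (e r : R) : bmeas A -> 0 < e -> 0 < r ->
  exists2 h0 : R, 0 < h0 & forall h, 0 <= h -> h <= h0 ->
  oprob P [set w | exists n, e < sqsum d j n (noise A h w)] <= r.
Proof.
move=> mA e0 r0; have e20 : 0 < e / 2 by rewrite divr_gt0.
have r20 : 0 < r / 2 by rewrite divr_gt0.
have [N hN] := noise_tail_sup j ler01 r20 e20.
have [h0 h00 hh0] := noise_list_small (flatten [seq block d j k | k <- index_iota 0 N]) mA
  e20 r20.
exists (Num.min h0 1); first by rewrite lt_min h00 ltr01.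
move=> h hge; rewrite le_min => /andP[hh1 hh2].
have -> : r = r / 2 + r / 2 by field.
apply: le_oprobU (hh0 h hge hh1) (hN h hge hh2 A mA) => w /= [n].
rewrite big_flatten big_map.
have F0 k : 0 <= \sum_(p <- block d j k) noise A h w p ^+ 2 by apply: sumr_ge0 => p _;
  exact: sqr_ge0.
have [hl|hl] := leP (e / 2) (\sum_(0 <= k < N) \sum_(p <- block d j k) noise A h w p ^+ 2);
  first by left.
move=> hn; right; exists n; rewrite leNgt; apply/negP => hn'.
move: hn; rewrite /sqsum; apply/negP; rewrite -leNgt.
have [nN|Nn] := leqP n N; last first.
  by rewrite (big_cat_nat (n := N))//= 1?ltnW//; lra.
apply: (@le_trans _ _ (\sum_(0 <= k < N) \sum_(p <- block d j k) noise A h w p ^+ 2)); last lra.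
by rewrite [leRHS](big_cat_nat (n := n))//= lerDl; apply: sumr_ge0 => k _.
Qed.

End levy_noise.

(** * The Levy process in the dual *)

Section levy_functional.
Context (R : realType) (disp : measure_display) (T : measurableType disp).
Variable P : probability T R.
Context (d : nat).
Local Notation E := 'rV[R]_d.
Local Notation bmeas A := (@measurable _ (borelType E) A).
Variables (O : set E) (M : R -> set E -> {RV P >-> R}).
Hypotheses (LM : levy_valued_random_measure O M) (oO : open O).
Local Notation V := (testfun O).

Definition functional (A : set E) (t : R) (w : T) : strong_dual V :=
  pairing oO (sq_trunc d (noise O M A t w)).

Local Notation N t w := (sq_trunc d (noise O M O t w)).
Local Notation Y t w := (functional O t w).

Definition increment (s t : R) (w : T) : item -> R := N t w - N s w.

Let bO : bmeas O := bmeas_open oO.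

Lemma increment_measurable s t p : measurable_fun setT (fun w => increment s t w p).
Proof.
by apply: measurable_funB; apply: sq_trunc_measurable => q; exact: noise_measurable.
Qed.

Lemma increment_summable s t w : sq_summable d (increment s t w).
Proof. by apply: sq_summableB; exact: sq_truncP. Qed.

Lemma functionalB s t w : Y t w - Y s w = pairing oO (increment s t w).
Proof. by rewrite /increment pairingB//; exact: sq_truncP. Qed.

Lemma pairing0 : pairing oO 0 = 0.
Proof. by rewrite -[X in pairing _ X](subrr 0) pairingB ?subrr//; exact: sq_summable0. Qed.

Lemma increment_ae s t : 0 <= s -> 0 <= t -> {ae P, forall w, forall p,
  increment s t w p = weight R p * (M t (O `&` cell_set O p) w - M s (O `&` cell_set O p) w)}.
Proof.
move=> s0 t0; apply: filterS2 (noise_summable LM bO s0) (noise_summable LM bO t0).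
by move=> w hs ht p; rewrite /increment !sq_trunc_id// mulrBr.
Qed.

Lemma increment0_ae t : 0 <= t -> {ae P, forall w, increment 0 t w = noise O M O t w}.
Proof.
move=> t0; have h0 : {ae P, forall w, forall p : (nat * (seq nat * seq int))%type,
  M 0 (O `&` cell_set O p) w = 0}.
  by apply: ae_forall_countable => p; exact: (levy_rm0 LM (cell_setI_Bb O p bO)).
apply: filterS2 h0 (increment_ae (lexx 0) t0) => w h0w hw; apply/funext => p.
by rewrite hw h0w subr0.
Qed.

(** [pairing_measurable] with the sequence space itself as sample space: Borel events of the dual
    become events of the product sigma-algebra, whose probabilities the laws of the coordinates
    determine. *)
Lemma pairing_box (B : set (strong_dual V)) : borel (strong_dual V) B ->
  <<s @box R item >> [set v | B (pairing oO (sq_trunc d v))].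
Proof.
move=> bB; apply: (@pairing_measurable _ _ _ oO _ (g_sigma_algebraType (@box R item))
  (sq_trunc d) B) => //.
  by move=> p; apply: sq_trunc_measurable => q; exact: box_coord.
exact: sq_truncP.
Qed.

Lemma functional_event s t (B : set (strong_dual V)) :
  [set w | B (Y t w - Y s w)] = increment s t @^-1` [set v | B (pairing oO (sq_trunc d v))].
Proof.
apply/seteqP; split=> w /=; rewrite functionalB sq_trunc_id//; exact: increment_summable.
Qed.

Lemma functional_event_measurable s t (B : set (strong_dual V)) : borel (strong_dual V) B ->
  measurable [set w | B (Y t w - Y s w)].
Proof.
move=> bB; rewrite functional_event; apply: box_preimage_measurable; last exact: pairing_box.
exact: increment_measurable.
Qed.

Lemma functional_measurable A t (B : set (strong_dual V)) : borel (strong_dual V) B ->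
  measurable (functional A t @^-1` B).
Proof.
move=> bB; apply: pairing_measurable => // [p|w]; last exact: sq_truncP.
by apply: sq_trunc_measurable => q; exact: noise_measurable.
Qed.

Lemma increment_box s t (S : seq item) (B : item -> set R) : 0 <= s -> 0 <= t ->
  (forall p, measurable (B p)) ->
  P [set w | forall p, p \in S -> B p (increment s t w p)] =
  P [set w | forall p, p \in S -> [set x | B p (weight R p * x)]
       (M t (O `&` cell_set O p) w - M s (O `&` cell_set O p) w)].
Proof.
move=> s0 t0 mB; apply: prob_ae_eq.
- by apply: (@cylinder_measurable _ _ _ _ (fun p w => increment s t w p) _ setT);
    [exact: increment_measurable|exists S, B; split].
- apply: (@cylinder_measurable _ _ _ _ (fun p w =>
  M t (O `&` cell_set O p) w - M s (O `&` cell_set O p) w) _ setT).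
    by move=> p; apply: measurable_funB; exact: measurable_funPT.
  exists S, (fun p => [set x | B p (weight R p * x)]); split=> // p.
  rewrite -[X in measurable X]setTI.
  by apply: (measurable_funM (f := fun=> weight R p) (g := id)).
- apply: filterS (increment_ae s0 t0) => w hw.
  by split=> h p pS /=; have := h p pS; rewrite hw.
Qed.

Lemma increment_stationary s t (Q : set (item -> R)) : 0 <= s -> s <= t ->
  <<s @box R item >> Q ->
  P (increment s t @^-1` Q) = P (increment 0 (t - s) @^-1` Q).
Proof.
move=> s0 st hQ; apply: box_law_eq hQ; [exact: increment_measurable|exact:
  increment_measurable|].
have t0 : 0 <= t by apply: le_trans st.
have h0 : 0 <= t - s by rewrite subr_ge0.
move=> S B mB; rewrite !increment_box//.
have := @levy_box_stationary _ _ _ _ _ _ _ LM item (fun p => O `&` cell_set O p) (fun p =>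
  cell_setI_Bb O p bO)
  S (fun p => [set x | B p (weight R p * x)]) s (t - s) s0 h0.
rewrite addrC subrK; apply=> p.
rewrite -[X in measurable X]setTI.
by apply: (measurable_funM (f := fun=> weight R p) (g := id)).
Qed.

Lemma functional_stationary s h (B : set (strong_dual V)) : 0 <= s -> 0 <= h ->
  borel (strong_dual V) B ->
  P [set w | B (Y (s + h) w - Y s w)] = P [set w | B (Y h w - Y 0 w)].
Proof.
move=> s0 h0 bB; rewrite !functional_event increment_stationary ?lerDl//;
  last exact: pairing_box.
by rewrite addrC addKr.
Qed.

Lemma functional_independent (t : nat -> R) : 0 <= t 0%N -> (forall i, t i <= t i.+1) ->
  independent P (borel (strong_dual V)) (fun i w => Y (t i.+1) w - Y (t i) w).
Proof.
move=> t0 tS J B uJ bB.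
have tge0 i : 0 <= t i by elim: i => // i /le_trans; apply.
pose X k (p : item) w := increment (t k) (t k.+1) w p.
have eA k : (fun w => Y (t k.+1) w - Y (t k) w) @^-1` B k =
    increment (t k) (t k.+1) @^-1` [set v | B k (pairing oO (sq_trunc d v))].
  exact: functional_event.
under eq_bigcapr do rewrite eA.
under eq_bigr do rewrite eA.
apply: (@independent_generated _ _ _ P (fun k => cylinder (X k) setT)) => //.
- by move=> k; exact: setI_closed_cylinder.
- by move=> k D; apply: cylinder_measurable => p; exact: increment_measurable.
- by move=> k; exists [::], (fun=> setT); split=> //; apply/seteqP; split.
- move=> {B bB eA} {}J D {}uJ hD.
  have /choice[sB hsB] : forall k, exists sB : seq item * (item -> set R),
      (forall i, measurable (sB.2 i)) /\ D k = [set w | forall i, i \in sB.1 ->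
        sB.2 i (X k i w)].
    by move=> k; have [s [B [_ mB ->]]] := hD k; exists (s, B).
  (* The independence of the vector increments is stated for one list of cells common to all times;
     unconstrained cells receive [setT]. *)
  pose S := flatten [seq (sB k).1 | k <- J].
  pose B k p := if p \in (sB k).1 then (sB k).2 p else setT.
  have mB k p : measurable (B k p).
    by rewrite /B; case: ifP => // _; exact: (hsB k).1.
  have DE k : k \in J -> D k = [set w | forall p, p \in S ->
    B k p (increment (t k) (t k.+1) w p)].
    move=> kJ; rewrite (hsB k).2; apply/seteqP; split=> w /= h p.
      by move=> _; rewrite /B; case: ifP => //; exact: h.
    move=> pk; have := h p; rewrite /B pk; apply.
    by apply/flattenP; exists (sB k).1 => //; apply/mapP; exists k.
  pose B' k p := [set x | B k p (weight R p * x)].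
  have mB' k p : measurable (B' k p).
    rewrite -[X in measurable X]setTI.
    by apply: (measurable_funM (f := fun=> weight R p) (g := id)).
  have := @levy_box_independent _ _ _ _ _ _ _ LM item (fun p => O `&` cell_set O p)
    (fun p => cell_setI_Bb O p bO) S t J B' t0 tS uJ mB'.
  under eq_bigr => k _ do rewrite -increment_box//.
  rewrite (eq_big_seq (fun k => P (D k))); last by move=> k kJ; rewrite DE.
  move=> <-; apply: prob_ae_eq.
  + apply: fin_bigcap_measurable => [|k _]; first exact: finite_seq.
    by apply: cylinder_measurable (hD k) => p; exact: increment_measurable.
  + rewrite (_ : [set _ | _] = \bigcap_(k in [set` J]) [set w | forall p, p \in S ->
        B' k p (M (t k.+1) (O `&` cell_set O p) w - M (t k) (O `&` cell_set O p) w)]) //.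
    apply: fin_bigcap_measurable => [|k _]; first exact: finite_seq.
    apply: (@cylinder_measurable _ _ _ _ (fun p w =>
      M (t k.+1) (O `&` cell_set O p) w - M (t k) (O `&` cell_set O p) w) _ setT).
      by move=> p; apply: measurable_funB; exact: measurable_funPT.
    by exists S, (B' k); split.
  + have : {ae P, forall w, forall k, forall p,
        increment (t k) (t k.+1) w p = weight R p * (M (t k.+1) (O `&` cell_set O p) w - M (t
          k) (O `&` cell_set O p) w)}.
      by apply: ae_foralln => k; exact: increment_ae.
    apply: filterS => w hw; split=> h k kJ.
      by have := h k kJ; rewrite DE//= => h' p pS; have := h' p pS; rewrite hw.
    by rewrite DE//= => p pS; have := h k kJ p pS; rewrite /B' /= -hw.
- move=> k; apply: box_preimage; last exact: pairing_box.
  exact: increment_measurable.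
Qed.

Lemma functional0 : {ae P, forall w, Y 0 w = 0}.
Proof.
have h0 : {ae P, forall w, forall p : (nat * (seq nat * seq int))%type,
  M 0 (O `&` cell_set O p) w = 0}.
  by apply: ae_forall_countable => p; exact: (levy_rm0 LM (cell_setI_Bb O p bO)).
apply: filterS h0 => w hw; rewrite /functional -[RHS]pairing0; congr (pairing _ _).
rewrite (_ : noise O M O 0 w = 0) ?sq_trunc_id//; first exact: sq_summable0.
by apply/funext => p; rewrite /noise hw mulr0.
Qed.

(** The complement of a neighbourhood of 0 as produced by [pairing_continuous], so that stochastic
    continuity becomes a question about sequences. *)
Definition large_event (J : nat) (rho : R) : set (item -> R) :=
  [set v | exists2 j, (j < J)%N & exists n, rho < sqsum d j n v].

Lemma large_event_box J rho : <<s @box R item >> (large_event J rho).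
Proof.
have m (j n : nat) : <<s @box R item >> [set v | rho < sqsum d j n v].
  have := @sqsum_measurable R d _ (g_sigma_algebraType (@box R item)) id (fun p =>
    box_coord p) j n
    measurableT `]rho, +oo[%classic (measurable_itv _).
  by rewrite setTI (_ : _ @^-1` _ = [set v | rho < sqsum d j n v])//; apply/seteqP;
    split=> v /=; rewrite in_itv/= andbT.
rewrite (_ : large_event J rho = \bigcup_j \bigcup_n [set v | (j < J)%N /\ rho < sqsum d j n
  v]).
  apply: (@bigcupT_measurable _ (g_sigma_algebraType (@box R item))) => j.
  apply: (@bigcupT_measurable _ (g_sigma_algebraType (@box R item))) => n.
  have [jJ|Jj] := boolP (j < J)%N.
    by rewrite (_ : [set _ | _] = [set v | rho < sqsum d j n v]); [exact: m|apply/seteqP;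
      split=> v //= []].
  by rewrite (_ : [set _ | _] = set0); [exact: measurable0|rewrite -subset0 => v []].
apply/seteqP; split=> v /=.
  by move=> [j jJ [n h]]; exists j => //; exists n.
by move=> [j _ [n _ [jJ h]]]; exists j => //; exists n.
Qed.

Lemma increment_small J (rho e : R) : 0 < rho -> 0 < e -> exists2 h0 : R, 0 < h0 &
  forall h, 0 <= h -> h <= h0 -> (P (increment 0 h @^-1` large_event J rho) <= e%:E)%E.
Proof.
move=> rho0 e0; pose c := e / J.+1%:R; have e1 : 0 < c by rewrite divr_gt0.
have [h0 h00 hh] : exists2 h0 : R, 0 < h0 & forall h, 0 <= h -> h <= h0 ->
  forall j, (j < J)%N ->
    oprob P [set w | exists n, rho < sqsum d j n (noise O M O h w)] <= c.
  move: (c) e1 => c' c0; elim: (J) => [|n [h1 h10 hh1]]; first by exists 1.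
  have [h2 h20 hh2] := noise_small LM n bO rho0 c0.
  exists (Num.min h1 h2); first by rewrite lt_min h10.
  move=> h hge; rewrite le_min => /andP[l1 l2] j; rewrite ltnS leq_eqVlt => /predU1P[->|jn].
    exact: hh2.
  exact: hh1.
exists h0 => // h hge hh0.
have mQ : measurable (increment 0 h @^-1` large_event J rho).
  apply: box_preimage_measurable; last exact: large_event_box.
  exact: increment_measurable.
rewrite -EFin_oprob// lee_fin.
pose F j := [set w | exists n, rho < sqsum d j n (noise O M O h w)].
apply: (@le_trans _ _ (oprob P [set w | exists2 A, A \in [seq F j | j <- iota 0 J] & A w])).
  apply: le_oprob_ae; apply: filterS (increment0_ae hge) => w hw [j jJ].
  rewrite hw => hn; exists (F j) => //; apply/mapP; exists j => //.
  by rewrite mem_iota.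
apply: le_trans (oprob_sum P _) _; rewrite big_map.
apply: (@le_trans _ _ (\sum_(j <- iota 0 J) e / J.+1%:R)).
  rewrite big_seq [leRHS]big_seq; apply: ler_sum => j; rewrite mem_iota /= add0n => jJ.
  exact: hh.
rewrite big_const_seq count_predT size_iota iter_addr addr0 -[X in X <= _]mulr_natr.
rewrite mulrAC ler_pdivrMr// ler_pM2l// ler_nat; exact: leqnSn.
Qed.

(** Leaving [U] forces a large increment, and by stationarity its probability depends on |s - t|
    only. *)
Lemma functional_stochastic_continuity (t : R) (U : set (strong_dual V)) : 0 <= t ->
  open U -> U 0 ->
  P [set w | ~ U (Y s w - Y t w)] @[s --> within [set s | 0 <= s] (nbhs t)] --> 0%E.
Proof.
move=> t0 oU U0.
have Up : U (pairing oO 0) by rewrite pairing0.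
have [J [rho rho0 hU]] := pairing_continuous (@sq_summable0 R d) oU Up.
have mU s : measurable [set w | ~ U (Y s w - Y t w)].
  rewrite (_ : [set _ | _] = ~` [set w | U (Y s w - Y t w)])//; apply: measurableC.
  by apply: functional_event_measurable; exact: sub_sigma_algebra.
have mQ s s' : measurable (increment s s' @^-1` large_event J rho).
  apply: box_preimage_measurable; last exact: large_event_box.
  exact: increment_measurable.
have hle s : 0 <= s -> (P [set w | ~ U (Y s w - Y t w)%R] <=
    P (increment 0 `|s - t|%R @^-1` large_event J rho))%E.
  move=> s0; apply: (@le_trans _ _ (P (increment t s @^-1` large_event J rho))).
    apply: le_measure; rewrite ?inE//.
    move=> w /=; apply: contra_notP => hw; rewrite functionalB; apply: hU.
      exact: increment_summable.
    move=> j jJ n; rewrite subr0 leNgt; apply/negP => h; apply: hw.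
    by exists j => //; exists n.
  have [ts|st] := leP t s; first by rewrite increment_stationary ?ger0_norm ?subr_ge0//;
    exact: large_event_box.
  rewrite ltr0_norm ?subr_lt0// opprB -(increment_stationary (t := t)) ?(ltW st)//;
    last exact: large_event_box.
  (* For s < t the increment is taken backwards; sums of squares do not see the sign. *)
  rewrite (_ : increment t s @^-1` _ = increment s t @^-1` large_event J rho)//.
  have sqN j n w : sqsum d j n (increment t s w) = sqsum d j n (increment s t w).
    apply: eq_bigr => k _; apply: eq_bigr => p _; rewrite -sqrrN; congr (_ ^+ _).
    by rewrite /increment -[LHS]/(- (N s w p - N t w p)) opprB.
  by apply/seteqP; split=> w /= [j jJ [n h]]; exists j => //; exists n; rewrite ?sqN// -sqN.
apply/fine_cvgP; split; first by apply: nearW => s; exact: fin_prob.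
apply/cvgrPdist_le => e e0; have [h0 h00 hh] := increment_small J rho0 e0.
rewrite near_withinE near_simpl; apply/nbhs_normP; exists h0 => // s /= st s0.
rewrite sub0r normrN ger0_norm ?fine_ge0//.
rewrite -lee_fin fineK ?fin_prob//; apply: le_trans (hle s s0) (hh _ _ _) => //.
by rewrite distrC ltW.
Qed.

Lemma functional_levy : levy_process P (functional O).
Proof.
split.
- by move=> t _ B; exact: functional_measurable.
- exact: functional0.
- exact: functional_independent.
- by move=> s h s0 h0 B; exact: functional_stationary.
- by move=> t U; exact: functional_stochastic_continuity.
Qed.

End levy_functional.

(** * The integral of a test function *)

Lemma cvg_seq_sum (R : realType) (I : Type) (s : seq I) (u : I -> nat -> R) (l : I -> R) :
  (forall i, u i n @[n --> \oo] --> l i) -> \sum_(i <- s) u i n @[n --> \oo] --> \sum_(i <-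
    s) l i.
Proof.
move=> h; elim: s => [|i s IH].
  by under eq_cvg do rewrite big_nil; rewrite big_nil; exact: cvg_cst.
by under eq_cvg do rewrite big_cons; rewrite big_cons; apply: cvgD.
Qed.

Section canonical_integral.
Context (R : realType) (disp : measure_display) (T : measurableType disp).
Variable P : probability T R.
Context (d : nat).
Local Notation E := 'rV[R]_d.
Local Notation bmeas A := (@measurable _ (borelType E) A).
Variables (O : set E) (M : R -> set E -> {RV P >-> R}).

Definition sf_list (g : simple_fun O) : seq (R * set E) :=
  [seq (sf_coef k, @sf_set _ _ _ g k) | k <- enum 'I_(sf_size g)].

Lemma leval_sf_list g : leval (sf_list g) =1 sf_eval g.
Proof. by move=> x; rewrite /leval big_map big_enum. Qed.

Lemma lint_sf_list t A g w : lint (M t) (lrestr A (sf_list g)) w = sf_integral M t A g w.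
Proof. by rewrite /lint /lrestr -map_comp big_map big_enum. Qed.

Lemma sf_list_Bb g q : q \in sf_list g -> Bb O q.2.
Proof. by case: g => n c S bS tS /mapP[k _ ->]; exact: bS. Qed.

(** Simple functions require disjoint sets, whereas cells of different levels overlap; the atoms
    supply a disjoint representation. The atom with empty index may be unbounded and is replaced by
    the empty set, its value being 0. *)
Lemma leval_simple_fun (s : seq (R * set E)) F : Bb O F ->
  (forall q, q \in s -> bmeas q.2 /\ q.2 `<=` F) ->
  exists g : simple_fun O, sf_eval g =1 leval s.
Proof.
move=> bF sF; pose D (J : {set 'I_(size s)}) := if J == finset.set0 then set0 else atom J.
have bD J : Bb O (D J).
  rewrite /D; case: ifPn => [_|J0]; first exact: Bb0.
  exact: Bb_sub bF (atom_meas sF J) (atom_subF sF J0).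
pose m := #|{: {set 'I_(size s)}}|.
have tD : trivIset [set: 'I_m] (fun k => D (enum_val k)).
  apply/trivIsetP => i j _ _ ij.
  have {}ij : enum_val i != enum_val j by rewrite (inj_eq enum_val_inj).
  rewrite /D; case: ifPn => _; first by rewrite set0I.
  case: ifPn => _; first by rewrite setI0.
  exact: atom_disjoint.
exists (@SimpleFun R d O m (fun k => atom_value (enum_val k)) _ (fun k =>
  bD (enum_val k)) tD) => x.
rewrite /sf_eval /=; have xJ : atom (atom_tag s x) x by [].
rewrite (leval_atom xJ) (bigD1 (enum_rank (atom_tag s x)))//= enum_rankK big1 ?addr0.
  rewrite /D; case: ifPn => [/eqP ->|_]; last by rewrite indicE mem_set// mulr1.
  by rewrite indic0 mulr0 /atom_value big_set0.
move=> k kJ; rewrite /D; case: ifPn => [_|_]; first by rewrite indic0 mulr0.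
by rewrite indicE memNset ?mulr0// => xk; move: kJ;
  rewrite (_ : atom_tag s x = enum_val k)// enum_valK eqxx.
Qed.

Hypotheses (LM : levy_valued_random_measure O M) (oO : open O).
Variable f : testfun O.

Definition supp_bound : nat := xget 0%N [set k | forall x, f x != 0 -> exh O k x].

Lemma supp_boundP x : f x != 0 -> exh O supp_bound x.
Proof.
have : exists k, [set k | forall x, f x != 0 -> exh O k x] k by exact: testfun_exh.
by move=> /(@xgetPex _ 0%N) /(_ x).
Qed.

(** By [coef_eq0] the coefficients in all shells beyond [supp_bound.+1] vanish. *)
Definition expansion (n : nat) : seq (R * set E) :=
  flatten [seq flatten [seq [seq (coef O p f, cell_set O p) | p <- block d j k]
     | k <- index_iota 0 n.+1] | j <- index_iota 0 supp_bound.+2].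

Lemma sum_expansion n (F : R * set E -> R) : \sum_(q <- expansion n) F q =
  \sum_(0 <= j < supp_bound.+2) \sum_(0 <= k < n.+1) \sum_(p <- block d j k) F (coef O p f,
    cell_set O p).
Proof.
rewrite big_flatten big_map; apply: eq_bigr => j _.
by rewrite big_flatten big_map; apply: eq_bigr => k _; rewrite big_map.
Qed.

Lemma expansion_sub n q : q \in expansion n -> bmeas q.2 /\ q.2 `<=` exh O supp_bound.+1.
Proof.
move=> /flattenP[_ /mapP[j + ->]] /flattenP[_ /mapP[k _ ->]] /mapP[p /mem_block[pj _ _] ->] /=.
rewrite mem_index_iota => /= jS; split; first exact: Bb_meas (cell_set_Bb O p).
move=> x /cell_set_shell /shell_sub; rewrite pj.
by apply: exh_nondecreasing.
Qed.

Lemma cvg_expansion x : O x -> leval (expansion n) x @[n --> \oo] --> f x.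
Proof.
move=> Ox; have [j0 xj0] := shell_cover oO Ox.
have fE : f x = \sum_(0 <= j < supp_bound.+2) \1_(shell O j) x * f x.
  have [fx0|/supp_boundP xs] := eqVneq (f x) 0.
    by rewrite fx0 big1// => j _; rewrite mulr0.
  have j0s : (j0 < supp_bound.+2)%N.
    rewrite ltnS leqW// leqNgt; apply/negP => js.
    case: j0 xj0 js => // j0 [_ nx] js; apply: nx.
    exact: exh_nondecreasing xs.
  have j0i : j0 \in index_iota 0 supp_bound.+2 by rewrite mem_index_iota.
  rewrite (bigD1_seq j0 j0i (iota_uniq _ _)) /= -/(index_iota 0 supp_bound.+2).
  rewrite indicE mem_set// mul1r big1 ?addr0// => j jj0.
  rewrite indicE memNset ?mul0r// => xj; move: jj0.
  by rewrite (shell_disjoint xj xj0) eqxx.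
rewrite fE (_ : (fun n => _) = (fun n => \sum_(0 <=
  j < supp_bound.+2) \1_(shell O j) x * f (sample j n (enum 'I_d) x))).
  apply: cvg_seq_sum => j; apply: cvgMr; apply: cvg_sample.
  by have [] := testfun_smooth f [::].
apply/funext => n; rewrite /leval sum_expansion; apply: eq_bigr => j _.
exact: sum_coef.
Qed.

Definition integral_fun (t : R) (A : set E) (w : T) : R := functional M oO A t w f.

Lemma integral_funE t A w : sq_summable d (noise O M A t w) ->
  integral_fun t A w = \sum_(0 <= j < supp_bound.+2) pair_shell j (noise O M A t w) f.
Proof.
move=> h; rewrite /integral_fun /functional sq_trunc_id// pairingE//.
by apply: pair_funE => //; exact: supp_boundP.
Qed.

Lemma integral_fun_measurable t A : measurable_fun setT (integral_fun t A).
Proof.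
pose u w := sq_trunc d (noise O M A t w).
have mu p : measurable_fun setT (fun w => u w p).
  by apply: sq_trunc_measurable => q; exact: noise_measurable.
rewrite (_ : integral_fun t A = (fun w => \sum_(0 <= j < supp_bound.+2) pair_shell j (u w) f)).
  apply: measurable_sum => j.
  apply: (@measurable_fun_cvg _ _ _ _ (fun n w => series (pair_term j (u w) f) n)).
    move=> n; apply: measurable_sum => k; apply: measurable_sum => p.
    by apply: measurable_funM.
  move=> w _; have [C hC] := sq_truncP d (noise O M A t w) j.
  exact: cvg_pair_shell hC.
apply/funext => w; rewrite /integral_fun /functional pairingE; last exact: sq_truncP.
by apply: pair_funE => //; exact: supp_boundP.
Qed.

HB.instance Definition _ t A :=
  isMeasurableFun.Build _ _ _ _ (integral_fun t A) (integral_fun_measurable t A).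

Definition canonical_integral (t : R) (A : set E) : {RV P >-> R} := integral_fun t A.

(** The weights cancel, so the integrals of the partial sums are the partial sums of the series that
    define the functional. *)
Lemma cvg_lint_expansion t A : 0 <= t -> bmeas A ->
  {ae P, forall w, lint (M t) (lrestr A (expansion n)) w @[n --> \oo] --> integral_fun t A w}.
Proof.
move=> t0 mA; apply: filterS (noise_summable LM mA t0) => w hw.
rewrite integral_funE// (_ : (fun n => _) = (fun n =>
  \sum_(0 <= j < supp_bound.+2) series (pair_term j (noise O M A t w) f) n.+1)).
  apply: cvg_seq_sum => j; have [C hC] := hw j.
  have := cvg_pair_shell (f := f) hC.
  by rewrite -(cvg_shiftS (series _)).
apply/funext => n; rewrite /lint big_map sum_expansion; apply: eq_bigr => j _.
apply: eq_bigr => k _; apply: eq_bigr => p _ /=.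
by rewrite /noise mulrA divfK// lt0r_neq0// weight_gt0.
Qed.

End canonical_integral.

(** * Null sets of the control measure *)

Section levy_khintchine_null.
Context (R : realType) (disp : measure_display) (T : measurableType disp).
Variable P : probability T R.

Lemma cos_eq1 (x : R) : `|x| < 1 -> cos x = 1 -> x = 0.
Proof.
move=> x1 cx; suff h (y : R) : 0 < y -> `|y| < 1 -> cos y = 1 -> False.
  have [x0|x0|//] := ltrgt0P x; exfalso; first exact: h x0 x1 cx.
  by apply: (h (- x)); rewrite ?oppr_gt0 ?normrN ?cosN.
move=> y0; rewrite gtr0_norm// => y1 cy.
have sy : 0 < sin y by apply: sin2_gt0; rewrite y0 (lt_trans y1)// ltr1n.
have := cos2Dsin2 y; rewrite cy expr1n => /eqP; rewrite -subr_eq0 addrAC subrr add0r.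
by rewrite sqrf_eq0 gt_eqF.
Qed.

Lemma cos_expectation_eq1 (X : {RV P >-> R}) (u : R) :
  ('E_P[(fun w => cos (u * X w))] = 1)%E -> {ae P, forall w, cos (u * X w) = 1}.
Proof.
have mc : measurable_fun setT (fun w => cos (u * X w)).
  apply: (measurableT_comp (f := cos)).
    by apply: continuous_measurable_fun; exact: continuous_cos.
  by apply: measurable_funM => //; exact: measurable_funPT.
rewrite unlock => h.
have ic : P.-integrable setT (EFin \o (fun w => cos (u * X w))).
  apply: measurable_bounded_integrable => //; first by rewrite ltey_eq fin_num_measure.
  exists 1; split; first exact: num_real.
  by move=> r r1 w _ /=; apply: le_trans (ltW r1); rewrite ler_norml cos_geN1 cos_le1.
have i1 : P.-integrable setT (EFin \o (fun w : T => (1 : R))).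
  apply: measurable_bounded_integrable => //; first by rewrite ltey_eq fin_num_measure.
  exists 1; split; first exact: num_real.
  by move=> r r1 w _ /=; rewrite normr1 ltW.
have := integralB_EFin measurableT i1 ic.
rewrite [X in (_ = _ - X)%E -> _](_ : _ = 1)%E; last exact: h.
rewrite [X in (_ = X - _)%E -> _](_ : _ = 1)%E; last first.
  transitivity (1 * P setT)%E; first exact: integral_cst.
  by rewrite mul1e; exact: probability_setT.
rewrite subee// => h0.
have : (\int[P]_x `|(1 - cos (u * X x))%:E| = 0)%E.
  by rewrite -[RHS]h0; apply: eq_integral => w _;
    rewrite gee0_abs ?EFinB// lee_fin subr_ge0 cos_le1.
have m1 : measurable_fun setT (fun x => (1 - cos (u * X x))%:E).
  by apply/measurable_EFinP; exact: measurable_funB.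
move=> /(ae_eq_integral_abs P measurableT m1).1.
by apply: filterS => w /(_ I) [] /eqP; rewrite subr_eq0 => /eqP.
Qed.

(** For each u, 1 - cos(uX) is nonnegative with expectation 0. With u = 1/(n+1) and n + 1 > |X w|
    the argument lies in (-1, 1), where the cosine equals 1 only at 0. *)
Lemma cos_expectation_null (X : {RV P >-> R}) :
  (forall u : R, ('E_P[(fun w => cos (u * X w)%R)] = 1)%E) -> {ae P, forall w, X w = 0}.
Proof.
move=> h.
have : {ae P, forall w, forall n : nat, cos (n.+1%:R^-1 * X w) = 1}.
  by apply: ae_foralln => n; exact: cos_expectation_eq1.
apply: filterS => w hw; pose n := Num.trunc `|X w|.
have lt1 : `|n.+1%:R^-1 * X w| < 1.
  rewrite normrM normfV normr_nat mulrC ltr_pdivrMr// mul1r.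
  exact: archimedean.Num.Theory.truncnS_gt.
have := cos_eq1 lt1 (hw n) => /eqP.
by rewrite mulf_eq0 invr_eq0 pnatr_eq0 /= => /eqP.
Qed.

Lemma levy_khintchine_zero (X : {RV P >-> R}) (n : {measure set (measurableTypeR R) ->
  \bar R}) :
  levy_khintchine X 0 0 n -> (forall B, measurable B -> n B = 0%E) -> {ae P, forall w, X w = 0}.
Proof.
move=> [_ _ h] n0; apply: cos_expectation_null => u; have [-> _] := h u.
have i0 (f : R -> \bar R) : (\int[n]_y f y = 0)%E.
  rewrite (@eq_measure_integral _ _ _ setT mzero) ?integral_measure_zero// => B mB _.
  exact: n0.
have r0 (f : R -> R) : \int[n]_y f y = 0 by rewrite /Rintegral i0.
by rewrite /lk_re /lk_im !r0 !mul0r oppr0 mulr0 addr0 expR0 cos0 mulr1.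
Qed.

End levy_khintchine_null.

Section control_measure.
Context (R : realType) (disp : measure_display) (T : measurableType disp).
Variable P : probability T R.
Context (d : nat).
Local Notation E := 'rV[R]_d.
Local Notation bmeas A := (@measurable _ (borelType E) A).
Variables (O : set E) (M : R -> set E -> {RV P >-> R}) (gamma Sigma : set E -> R)
  (nu : {measure set (borelType E * measurableTypeR R) -> \bar R}).
Hypothesis ch : characteristics O M gamma Sigma nu.

Let gamma0 : gamma set0 = 0. Proof. by case: ch => -[]. Qed.
Let Sigma0 : Sigma set0 = 0. Proof. by case: ch => _ [[]]. Qed.

Lemma control_measure0 : control_measure O gamma Sigma nu measurable0 = 0%E.
Proof.
rewrite /control_measure.
have -> : Defs.total_variation O gamma set0 = 0%E.
  apply/eqP; rewrite eq_le; apply/andP; split.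
    apply: ge_ereal_sup => _ [n [B [hB _ ->]]]; rewrite lee_fin big1// => i _.
    by have [_] := hB i; rewrite subset0 => ->; rewrite gamma0 normr0.
  apply: ereal_sup_ubound; exists 0%N, (fun _ => set0).
  by split=> [[]//| |]; [move=> []//|rewrite big_ord0].
have -> : extension O Sigma set0 = 0%E.
  apply/eqP; rewrite eq_le; apply/andP; split.
    by apply: ge_ereal_sup => _ [B [_ B0] <-]; move: B0; rewrite subset0 => ->; rewrite Sigma0.
  by apply: ereal_sup_ubound; exists set0; [split=> //; exact: Bb0|rewrite Sigma0].
rewrite !add0e (@eq_measure_integral _ _ _ setT mzero) ?integral_measure_zero// => B mB _.
change (nu (set0 `*` B) = 0%E); rewrite set0X; exact: measure0.
Qed.

(** All three terms of the control measure vanish, hence so do the drift and variance of [A]. As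
    min(y^2, 1) is positive off 0, the jump measure has no mass there, and a Levy measure has none
    at 0; the characteristic function is then constant. *)
Lemma control_null (N : set E) (mN : bmeas N) : control_measure O gamma Sigma nu mN = 0%E ->
  forall A, Bb O A -> A `<=` N -> {ae P, forall w, M 1 A w = 0}.
Proof.
have [_ [_ Sge0] _ lk] := ch.
rewrite /control_measure => h A bA AN.
have tv0 : (0 <= Defs.total_variation O gamma N)%E.
  apply: ereal_sup_ubound; exists 0%N, (fun _ => set0).
  by split=> [[]//| |]; [move=> []//|rewrite big_ord0].
have ex0 : (0 <= extension O Sigma N)%E.
  by apply: ereal_sup_ubound; exists set0; [split=> //; exact: Bb0|rewrite Sigma0].
have in0 : (0 <= \int[slice nu mN]_y (Num.min (`|y| ^+ 2) 1)%:E)%E.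
  by apply: integral_ge0 => y _; rewrite lee_fin le_min ler01 andbT sqr_ge0.
move/eqP : h; have -> := padde_eq0 (adde_ge0 tv0 ex0) in0; have -> := padde_eq0 tv0 ex0.
move=> /andP[/andP[/eqP tv /eqP ex] /eqP int0].
have gA : gamma A = 0.
  apply/eqP; rewrite -normr_le0 -lee_fin [X in (_ <=
    X)%E](_ : _ = Defs.total_variation O gamma N)//.
  apply: ereal_sup_ubound; exists 1%N, (fun _ => A); split=> //.
    by move=> i j _ _ _; rewrite !ord1.
  by rewrite big_ord1.
have SA : Sigma A = 0.
  apply/eqP; rewrite eq_le Sge0// andbT -lee_fin [X in (_ <=
    X)%E](_ : _ = extension O Sigma N)//.
  by apply: ereal_sup_ubound; exists A.
have mA : bmeas A := Bb_meas bA.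
have [_ [n0 _] _] := lk A mA bA.
have := lk A mA bA; rewrite gA SA => /levy_khintchine_zero; apply.
have sl (B : set (measurableTypeR R)) : measurable B -> (slice nu mA B <= slice nu mN B)%E.
  move=> mB; apply: (@le_measure _ _ _ nu (A `*` B) (N `*` B)); rewrite ?inE.
  - exact: measurableX.
  - exact: measurableX.
  - by move=> [x y] [/= /AN].
have nz : slice nu mA (~` [set 0]) = 0%E.
  have mf : measurable_fun setT (fun y : R => (Num.min (`|y| ^+ 2) 1)%:E).
    apply/measurable_EFinP; apply: measurable_minr => //.
    by apply: measurable_funX; exact: normr_measurable.
  have : (\int[slice nu mN]_y `|(Num.min (`|y| ^+ 2) 1)%:E| = 0)%E.
    rewrite -[RHS]int0; apply: eq_integral => y _.
    by rewrite gee0_abs// lee_fin le_min ler01 andbT sqr_ge0.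
  move=> /(ae_eq_integral_abs (slice nu mN) measurableT mf).1 [Z [mZ Z0 hZ]].
  apply/eqP; rewrite eq_le measure_ge0 andbT.
  apply: (@le_trans _ _ (slice nu mN (~` [set 0]))).
    by apply: sl; apply: measurableC; exact: measurable_set1.
  rewrite -Z0; apply: le_measure; rewrite ?inE//.
    by apply: measurableC; exact: measurable_set1.
  move=> y /= y0; apply: hZ => /= /(_ I) [] /eqP.
  rewrite minEle; case: ifP => _; last by rewrite oner_eq0.
  by rewrite sqrf_eq0 normr_eq0 => /eqP.
move=> B mB; apply/eqP; rewrite eq_le measure_ge0 andbT.
apply: (@le_trans _ _ (slice nu mA ([set 0] `|` ~` [set 0]))).
  by rewrite setUv; apply: le_measure; rewrite ?inE.
apply: (le_trans (measureU2 _ _ _)) => //.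
- by apply: measurableC; exact: measurable_set1.
- have n0' : (slice nu mA [set 0%R] <= 0)%E by rewrite n0.
  have nz' : (slice nu mA (~` [set 0%R]) <= 0)%E by rewrite nz.
  by apply: le_trans (leeD n0' nz') _; rewrite adde0.
Qed.

End control_measure.

(** * Null sequences of simple functions with convergent integrals *)

Section integral_uniqueness.
Context (R : realType) (disp : measure_display) (T : measurableType disp).
Variable P : probability T R.
Context (d : nat).
Local Notation E := 'rV[R]_d.
Local Notation bmeas A := (@measurable _ (borelType E) A).
Variables (O : set E) (m : set E -> {RV P >-> R}).
Hypotheses (oO : open O) (Hm : infdiv_random_measure O m).

Lemma lint_restrU s A B C : (forall q, q \in s -> Bb O q.2) -> bmeas B -> bmeas C ->
  A = B `|` C -> B `&` C = set0 ->
  {ae P, forall w, lint m (lrestr A s) w = lint m (lrestr B s) w + lint m (lrestr C s) w}.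
Proof.
move=> bs mB mC AE BC0; have bF := Bb_seqU bs.
have mA : bmeas A by rewrite AE; exact: measurableU.
have sub D q : bmeas D -> q \in lrestr D s -> bmeas q.2 /\ q.2 `<=` seqU s snd.
  move=> mD /mapP[q' q's ->] /=; split.
    by apply: measurableI => //; exact: Bb_meas (bs _ q's).
  by move=> x [_ xq]; exists q'.
have := @lint_eq _ _ _ _ P m _ _ Hm bF (lrestr A s) (lrestr B s ++ lrestr C s).
move=> /(_ (fun q => sub A q mA)) h.
have {h} : {ae P, forall w, lint m (lrestr A s) w = lint m (lrestr B s ++ lrestr C s) w}.
  apply: h => [q|x].
    by rewrite mem_cat => /orP[]; exact: sub.
  rewrite leval_cat !leval_restr -mulrDl; congr (_ * _).
  by rewrite AE indicE in_setU !indicE; have [xB|//] := boolP (x \in B);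
    have [xC|xC] := boolP (x \in C); rewrite /= ?addr0 ?add0r//;
    move: xB xC; rewrite !inE => xB xC; have : (B `&` C) x by []; rewrite BC0.
by apply: filterS => w ->; rewrite lint_cat.
Qed.

Lemma leval_measurable s : (forall q, q \in s -> Bb O q.2) ->
  measurable_fun setT (leval s : borelType E -> R).
Proof.
elim: s => [_|q s IH bs].
  by rewrite (_ : leval _ = cst 0); [exact: measurable_cst|apply/funext => x;
    rewrite /leval big_nil].
rewrite (_ : leval _ = (fun x : borelType E => q.1 * \1_(q.2) x + leval s x)); last first.
  by apply/funext => x; rewrite /leval big_cons.
apply: measurable_funD; last by apply: IH => q' qs; apply: bs; rewrite inE qs orbT.
apply: measurable_funM; first exact: measurable_cst.
by apply: measurable_indic; apply: Bb_meas (bs _ _); exact: mem_head.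
Qed.

Variables (k : nat -> seq (R * set E)) (N : set E).
Hypotheses (bk : forall n q, q \in k n -> Bb O q.2) (mN : bmeas N)
  (null : forall A, Bb O A -> A `<=` N -> {ae P, forall w, m A w = 0})
  (ck : forall x, O x -> ~ N x -> leval (k n) x @[n --> \oo] --> 0).

(** These sets increase to [O] minus [N]; on each of them the whole sequence is uniformly bounded,
    which replaces the missing domination. *)
Definition tame (r : nat) : set E :=
  [set x | [/\ exh O r x, ~ N x & forall n, `|leval (k n) x| <= r%:R]].

Lemma tame_meas r : bmeas (tame r).
Proof.
rewrite (_ : tame r = exh O r `&` (~` N `&` \bigcap_n [set x | `|leval (k n) x| <= r%:R]));
  last first.
  apply/seteqP; split=> x; first by move=> [h1 h2 h3]; split=> //; split=> // n _; exact: h3.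
  by move=> [h1 [h2 h3]]; split=> // n; exact: (h3 n I).
apply: measurableI; first exact: Bb_meas (exh_Bb O r).
apply: measurableI; first exact: measurableC.
apply: bigcapT_measurable => n.
rewrite (_ : [set x | _] = ~` [set x | r%:R < `|leval (k n) x|]).
  by apply: measurableC; apply: measurable_norm_gt; apply: leval_measurable; exact: bk.
by apply/seteqP; split=> x /=; rewrite leNgt => /negP.
Qed.

Lemma tame_sub r : tame r `<=` exh O r. Proof. by move=> x []. Qed.

Lemma tame_nondecreasing r r' : (r <= r')%N -> tame r `<=` tame r'.
Proof.
move=> rr' x [xr Nx h]; split=> //; first exact: exh_nondecreasing xr.
by move=> n; apply: le_trans (h n) _; rewrite ler_nat.
Qed.

Lemma tame_cover x : O x -> ~ N x -> exists r, tame r x.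
Proof.
move=> Ox Nx; have [j xj] := exh_cover oO Ox.
have [M [_ hM]] := cvg_seq_bounded (cvgP _ (ck Ox Nx)).
pose r := maxn j (Num.trunc (`|M| + 1)).+1.
have rM : `|M| + 1 <= r%:R.
  apply: le_trans (ltW (archimedean.Num.Theory.truncnS_gt _)) _.
  by rewrite ler_nat leq_maxr.
exists r; split=> //; first by apply: exh_nondecreasing xj; exact: leq_maxl.
move=> n; apply: le_trans rM; apply: (hM (`|M| + 1)) => //.
by rewrite ltr_pwDr// ler_norm.
Qed.

Local Notation mu n A := (lint m (lrestr A (k n))).

(** For a fixed [n] only finitely many sets Q occur, and Q \ tame r decreases to a part of [N],
    where [m] vanishes; order continuity is uniform over subsets. *)
Lemma lint_tail n (e p : R) : 0 < e -> 0 < p -> exists r0, forall r, (r0 <= r)%N ->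
  forall A, bmeas A -> A `<=` O -> A `&` tame r = set0 ->
    oprob P [set w | e < `|mu n A w|] <= p.
Proof.
suff h : forall s : seq (R * set E), {subset s <= k n} -> forall e p : R, 0 < e -> 0 < p ->
  exists r0, forall r, (r0 <= r)%N ->
    forall A, bmeas A -> A `<=` O -> A `&` tame r = set0 ->
      oprob P [set w | e < `|lint m (lrestr A s) w|] <= p.
  exact: h.
elim=> [|[a Q] s IH] sk {}e {}p e0 p0.
  exists 0%N => r _ A _ _ _; rewrite (_ : [set w | _] = set0) ?oprob0 ?(ltW p0)//.
  by rewrite -subset0 => w /=; rewrite /lint big_nil normr0 ltNge ltW.
have e20 : 0 < e / 2 by rewrite divr_gt0.
have p20 : 0 < p / 2 by rewrite divr_gt0.
have [|r1 hr1] := IH _ _ _ e20 p20; first by move=> q qs; apply: sk; rewrite inE qs orbT.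
have bQ : Bb O Q by apply: (bk (n := n) (q := (a, Q))); apply: sk; rewrite mem_head.
pose x := e / 2 / (`|a| + 1); have a1 : 0 < `|a| + 1 by rewrite ltr_wpDl.
have x0 : 0 < x by rewrite divr_gt0.
have [||||r2 hr2] := rm_order_continuous Hm (B := fun r => Q `\` tame r) bQ _ _ _ _ x0 p20.
- by move=> y [].
- by move=> r; apply: measurableD; [exact: Bb_meas bQ|exact: tame_meas].
- by move=> r y [Qy ny]; split=> // ty; apply: ny; exact: tame_nondecreasing ty.
- move=> A mA AQ; apply: null.
    by apply: (Bb_sub bQ mA) => y /AQ /(_ 0%N I)[].
  move=> y Ay; apply: contrapT => Ny.
  have Oy : O y by have [Qy _] := AQ y Ay 0%N I; exact: BbO bQ _ Qy.
  by have [r ry] := tame_cover Oy Ny; have [_] := AQ y Ay r I; apply.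
exists (maxn r1 r2) => r; rewrite geq_max => /andP[r1r r2r] A mA AO At.
have -> : p = p / 2 + p / 2 by field.
have mAQ : bmeas (A `&` Q) by apply: measurableI => //; exact: Bb_meas bQ.
apply: le_oprobU (hr1 r r1r A mA AO At) (hr2 (A `&` Q) mAQ _); last first.
  move=> y [Ay Qy]; split=> // /(tame_nondecreasing r2r) ty.
  have : (A `&` tame r) y by []. by rewrite At.
move=> w /=; rewrite /lint big_cons /= -/(lint m _ w) => hw.
have [h1|h1] := ltP (e / 2) `|lint m (lrestr A s) w|; [by left|right].
rewrite ltNge; apply/negP => h2.
have := ler_normD (a * m (A `&` Q) w) (lint m (lrestr A s) w).
rewrite normrM.
have : `|a| * `|m (A `&` Q) w| <= e / 2.
  move: h2; rewrite /x ler_pdivlMr// mulrDr mulr1 mulrC.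
  by have := normr_ge0 (m (A `&` Q) w); lra.
lra.
Qed.

(** An Egorov argument: the set [D n] of points of [tame r] where some later function exceeds [dl]
    decreases to the empty set. On [D n0] the functions are bounded by r and [m] is small; off it
    the functions are small and [m] is bounded in probability. *)
Lemma lint_uniform_small r (e p : R) : 0 < e -> 0 < p -> exists n0, forall n, (n0 <= n)%N ->
  forall A, bmeas A -> A `<=` tame r -> oprob P [set w | e < `|mu n A w|] <= p.
Proof.
move=> e0 p0; have p60 : 0 < p / 6 by rewrite divr_gt0.
have e20 : 0 < e / 2 by rewrite divr_gt0.
have bF := exh_Bb O r.
have [x x0 hx] := rm_bounded_range Hm bF p60.
pose dl := e / 2 / (9 * x); have dl0 : 0 < dl by rewrite divr_gt0// mulr_gt0.
(* Chosen so that [lint_small] at level e/2 admits functions bounded by r + 1. *)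
pose x1 := e / 2 / (9 * (r%:R + 1)).
have r10 : 0 < r%:R + 1 :> R by rewrite ltr_wpDl.
have x10 : 0 < x1 by rewrite divr_gt0// mulr_gt0.
pose D n := tame r `&` \bigcup_(i in [set i | (n <= i)%N]) [set y | dl < `|leval (k i) y|].
have mD n : bmeas (D n).
  apply: measurableI; first exact: tame_meas.
  apply: bigcup_measurable => i _; apply: measurable_norm_gt.
  by apply: leval_measurable; exact: bk.
have [||||n0 hn0] := rm_order_continuous Hm (B := D) bF _ _ _ _ x10 p60.
- by move=> y [/tame_sub].
- exact: mD.
- by move=> n y [ty [i /= ni h]]; split=> //; exists i => //; exact: ltnW.
- move=> A mA AD; rewrite (_ : A = set0); first exact: rm_set0 Hm.
  rewrite -subset0 => y /AD h; have [[yr Ny _] _] := h 0%N I.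
  have /cvgrPdist_lt/(_ _ dl0)[n _ hn] := ck (exh_sub yr) Ny.
  have [_ [i /= ni]] := h n I; have := hn i ni.
  by rewrite sub0r normrN => h1 /(lt_trans h1); rewrite ltxx.
exists n0 => n nn0 A mA At.
have mAD : bmeas (A `&` D n0) by exact: measurableI.
have mAD' : bmeas (A `\` D n0) by exact: measurableD.
have sp := @lint_restrU (k n) A (A `&` D n0) (A `\` D n0) (@bk n) mAD mAD' _ _.
have {sp} sp : {ae P, forall w, mu n A w = mu n (A `&` D n0) w + mu n (A `\` D n0) w}.
  by apply: sp; [rewrite setUIDK|rewrite setDE setIACA setICr setI0].
apply: (@le_trans _ _ (oprob P ([set w | e / 2 < `|mu n (A `&` D n0) w|] `|`
   [set w | e / 2 < `|mu n (A `\` D n0) w|]))).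
  apply: le_oprob_ae; apply: filterS sp => w /= -> hw.
  have [h1|h1] := ltP (e / 2) `|mu n (A `&` D n0) w|; [by left|right].
  by have := ler_normD (mu n (A `&` D n0) w) (mu n (A `\` D n0) w); rewrite /=; lra.
have -> : p = 3 * (p / 6) + 3 * (p / 6) by field.
apply: le_trans (oprobU _ _ _) (lerD _ _).
- have bD : Bb O (D n0) by apply: (Bb_sub bF (mD n0)) => y [/tame_sub].
  apply: (lint_small Hm bD x10 _ (fun B mB BD => hn0 B mB BD)).
    move=> q /mapP[q' /bk bq' ->] /=; split; last by move=> y [[]].
    by apply: measurableI => //; exact: Bb_meas bq'.
  move=> z; rewrite leval_restr (_ : e / 2 / (9 * x1) = r%:R + 1); last first.
    by rewrite /x1; field; rewrite ?lt0r_neq0//= ?mulr_gt0// ltr_wpDl.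
  rewrite indicE; case: (boolP (_ \in _)) => [|_]; last by rewrite mul0r normr0 ltW.
  rewrite inE => -[/At[_ _ h] _]; rewrite mul1r.
  by apply: le_trans (h n) _; rewrite lerDl.
- apply: (lint_small Hm bF x0 _ hx).
    move=> q /mapP[q' /bk bq' ->] /=; split; last by move=> y [[/At /tame_sub]].
    by apply: measurableI => //; exact: Bb_meas bq'.
  move=> z; rewrite leval_restr indicE; case: (boolP (_ \in _)) => [|_].
    rewrite inE => -[Az nD]; rewrite mul1r leNgt; apply/negP => h.
    by apply: nD; split; [exact: At|exists n].
  by rewrite mul0r normr0 ltW.
Qed.

Hypothesis cauchy : forall A, bmeas A -> A `<=` O -> forall e p : R, 0 < e -> 0 < p ->
  exists n0, forall n n', (n0 <= n)%N -> (n0 <= n')%N ->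
  oprob P [set w | e < `|mu n A w - mu n' A w|] <= p.

(* Gliding hump: if the integrals over [O] did not tend to 0, they would be
   concentrated on disjoint sets [H i]; over the union of the [H i] with [i]
   even, the integrals would then be large and small infinitely often. *)
Lemma lint_cvg0 (e p : R) : 0 < e -> 0 < p -> exists n0, forall n, (n0 <= n)%N ->
  oprob P [set w | e < `|mu n O w|] <= p.
Proof.
move=> e0 p0; apply: contrapT => hn.
have e80 : 0 < e / 8 by rewrite divr_gt0.
have p80 : 0 < p / 8 by rewrite divr_gt0.
(* From r and n0 this produces n >= n0 and r' >= r such that the integral of [k n] over [O] is
   large, but small inside [tame r] and outside [tame r']: it is carried by the part in between. *)
have /choice[f hf] : forall rn : nat * nat, exists nr : nat * nat,
    [/\ (rn.2 <= nr.1)%N, (rn.1 <= nr.2)%N, p < oprob P [set w | e < `|mu nr.1 O w|],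
      forall A, bmeas A -> A `<=` tame rn.1 -> oprob P [set w | e / 8 < `|mu nr.1 A w|] <=
        p / 8 &
      forall A, bmeas A -> A `<=` O -> A `&` tame nr.2 = set0 ->
        oprob P [set w | e / 8 < `|mu nr.1 A w|] <= p / 8].
  move=> [r n0]; have [n1 hn1] := lint_uniform_small r e80 p80.
  have [n [nn hpn]] : exists n, (maxn n0 n1 <= n)%N /\ p < oprob P [set w | e < `|mu n O w|].
    apply: contrapT => h; apply: hn; exists (maxn n0 n1) => n nn.
    by rewrite leNgt; apply/negP => h'; apply: h; exists n.
  have [r1 hr1] := lint_tail n e80 p80.
  move: nn; rewrite geq_max => /andP[nn0 nn1].
  exists (n, maxn r r1); split=> //=; first exact: leq_maxl.
    exact: hn1.
  by apply: hr1; exact: leq_maxr.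
pose rr := fix rr i : nat := if i is i'.+1 then (f (rr i', i')).2 else 0%N.
pose nn i := (f (rr i, i)).1.
have rrS i : rr i.+1 = (f (rr i, i)).2 by [].
have nn_ge i : (i <= nn i)%N by case: (hf (rr i, i)).
have rr_mono i j : (i <= j)%N -> (rr i <= rr j)%N.
  move=> ij; rewrite -(subnK ij); elim: (j - i)%N => // l IH.
  by rewrite addSn; apply: leq_trans IH _; rewrite rrS; case: (hf (rr (l + i)%N, (l + i)%N)).
pose G i := tame (rr i).
have G_mono i j : (i <= j)%N -> G i `<=` G j by move=> ij; apply: tame_nondecreasing;
  exact: rr_mono.
have mG i : bmeas (G i) by exact: tame_meas.
have GO i : G i `<=` O by move=> x /tame_sub/exh_sub.
pose H i := G i.+1 `\` G i.
have mH i : bmeas (H i) by exact: measurableD.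
have mO : bmeas O by exact: bmeas_open.
have small_in i A : bmeas A -> A `<=` G i -> oprob P [set w | e / 8 < `|mu (nn i) A w|] <=
  p / 8.
  by case: (hf (rr i, i)) => _ _ _ h _; exact: h.
have small_out i A : bmeas A -> A `<=` O -> A `&` G i.+1 = set0 ->
    oprob P [set w | e / 8 < `|mu (nn i) A w|] <= p / 8.
  by case: (hf (rr i, i)) => _ _ _ _ h; exact: h.
have large i : p < oprob P [set w | e < `|mu (nn i) O w|] by case: (hf (rr i, i)).
have split3 i A : bmeas A -> A `<=` O -> {ae P, forall w, mu (nn i) A w =
    mu (nn i) (A `&` G i) w + mu (nn i) (A `&` H i) w + mu (nn i) (A `\` G i.+1) w}.
  move=> mA AO.
  have m1 : bmeas (A `&` G i) by exact: measurableI.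
  have m2 : bmeas (A `&` H i) by exact: measurableI.
  have m3 : bmeas (A `\` G i.+1) by exact: measurableD.
  have m12 : bmeas (A `&` G i.+1) by exact: measurableI.
  have a1 := @lint_restrU (k (nn i)) A (A `&` G i.+1) (A `\` G i.+1) (@bk _) m12 m3 _ _.
  have a2 := @lint_restrU (k (nn i)) (A `&` G i.+1) (A `&` G i) (A `&` H i) (@bk _) m1 m2 _ _.
  have {}a1 := a1 (esym (setUIDK _ _)).
  apply: filterS2 (a1 _) (a2 _ _) => [w -> ->//| | |].
  - by rewrite setDE setIACA setICr setI0.
  - apply/seteqP; split=> x /=.
      by move=> [Ax Gx]; have [Gi|nGi] := pselect (G i x); [left|right].
    by move=> [[Ax /G_mono h]|[Ax []//]]; split=> //; exact: h.
  - by rewrite -subset0 => x [[_ Gx] [_ []]].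
pose A := \bigcup_i H i.*2.
have mA : bmeas A by apply: bigcupT_measurable.
have AO : A `<=` O by move=> x [i _ [/GO]].
have [n0 hn0] := cauchy mA AO (divr_gt0 e0 (ltr0n R 4)) p80.
have AH i : A `&` H i.*2 = O `&` H i.*2.
  apply/seteqP; split=> x [_ Hx]; split=> //; first by case: Hx => /GO.
  by exists i.
have AHodd i : A `&` H i.*2.+1 = set0.
  rewrite -subset0 => x [[j _ [h1 h2]] [h3 h4]].
  have [ji|ij] := leqP j i; first by apply: h4; apply: G_mono h1; rewrite ltnS leq_double.
  by apply: h2; apply: G_mono h3; rewrite -doubleS leq_double.
pose i := n0; set a := i.*2.
have na : (n0 <= nn a)%N by apply: leq_trans (nn_ge a); rewrite /a -addnn leq_addr.
have nb : (n0 <= nn a.+1)%N by apply: leq_trans (nn_ge a.+1); rewrite /a -addnn leqW// leq_addr.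
have mI B C : bmeas B -> bmeas C -> bmeas (B `&` C) by move=> *; exact: measurableI.
have mD B C : bmeas B -> bmeas C -> bmeas (B `\` C) by move=> *; exact: measurableD.
have out0 B j : (B `\` G j) `&` G j = set0 by rewrite -subset0 => x [[]].
have outO B j : B `<=` O -> B `\` G j `<=` O by move=> BO x [/BO].
(* At an even index the integral over [A] must be large, at the next index it must be small, and the
   Cauchy property compares the two. The levels fall from e to 3e/4, e/2 and e/4; the probabilities
   [q1] to [q4] add up to p <= 7p/8. *)
have q1 : p <= p / 8 + oprob P [set w | 3 * e / 4 < `|mu (nn a) (O `&` H a) w|] + p / 8.
  apply: le_trans (ltW (large a)) _.
  apply: (@le_trans _ _ (oprob P ([set w | e / 8 < `|mu (nn a) (O `&` G a) w|] `|`
     [set w | 3 * e / 4 < `|mu (nn a) (O `&` H a) w|] `|`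
     [set w | e / 8 < `|mu (nn a) (O `\` G a.+1) w|]))).
    apply: le_oprob_ae; apply: filterS (split3 a O mO (fun _ h => h)) => w sE /=; rewrite sE.
    set x := mu _ _ _; set y := mu _ _ _; set z := mu _ _ _ => hw.
    have [h1|h1] := ltP (e / 8) `|x|; first by left; left.
    have [h2|h2] := ltP (3 * e / 4) `|y|; first by left; right.
    right; have := ler_normD (x + y) z; have := ler_normD x y; rewrite /=; lra.
  apply: le_trans (oprobU _ _ _) _; apply: lerD; last first.
    by apply: small_out; [exact: mD|exact: outO|exact: out0].
  apply: le_trans (oprobU _ _ _) _; apply: lerD => //.
  by apply: small_in; [exact: mI|move=> x []].
have q2 : oprob P [set w | 3 * e / 4 < `|mu (nn a) (O `&` H a) w|] <=
    p / 8 + oprob P [set w | e / 2 < `|mu (nn a) A w|] + p / 8.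
  rewrite -(AH i).
  apply: (@le_trans _ _ (oprob P ([set w | e / 8 < `|mu (nn a) (A `&` G a) w|] `|`
     [set w | e / 2 < `|mu (nn a) A w|] `|`
     [set w | e / 8 < `|mu (nn a) (A `\` G a.+1) w|]))).
    apply: le_oprob_ae; apply: filterS (split3 a A mA AO) => w /=.
    rewrite -/a; set s := mu _ A _; set x := mu _ _ _; set y := mu _ _ _;
      set z := mu _ _ _ => sE hw.
    have [h1|h1] := ltP (e / 8) `|x|; first by left; left.
    have [h2|h2] := ltP (e / 2) `|s|; first by left; right.
    right.
    have := ler_normB (s - x) z; have := ler_normB s x.
    have yE : y = s - x - z by rewrite sE; ring.
    by move: hw; rewrite yE /=; lra.
  apply: le_trans (oprobU _ _ _) _; apply: lerD; last first.
    by apply: small_out; [exact: mD|exact: outO|exact: out0].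
  apply: le_trans (oprobU _ _ _) _; apply: lerD => //.
  by apply: small_in; [exact: mI|move=> x []].
have q3 : oprob P [set w | e / 4 < `|mu (nn a.+1) A w|] <= p / 8 + p / 8.
  have lint0 : {ae P, forall w, mu (nn a.+1) (A `&` H a.+1) w = 0}.
    rewrite AHodd; have s0 : bmeas set0 by [].
    have := lint_restrU (@bk (nn a.+1)) s0 s0 (esym (setU0 set0)) (setI0 set0).
    by apply: filterS => w; set x := mu _ _ _; lra.
  apply: (@le_trans _ _ (oprob P ([set w | e / 8 < `|mu (nn a.+1) (A `&` G a.+1) w|] `|`
     [set w | e / 8 < `|mu (nn a.+1) (A `\` G a.+2) w|]))).
    apply: le_oprob_ae; apply: filterS2 lint0 (split3 a.+1 A mA AO) => w z0 sE /=;
      rewrite sE z0.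
    set x := mu _ _ _; set z := mu _ _ _ => hw.
    have [h1|h1] := ltP (e / 8) `|x|; [by left|right].
    by have := ler_normD (x + 0) z; move: hw; rewrite addr0; lra.
  apply: le_trans (oprobU _ _ _) _; apply: lerD.
    by apply: small_in; [exact: mI|move=> x []].
  by apply: small_out; [exact: mD|exact: outO|exact: out0].
have q4 : oprob P [set w | e / 2 < `|mu (nn a) A w|] <=
  oprob P [set w | e / 4 < `|mu (nn a.+1) A w|] + p / 8.
  apply: (@le_trans _ _ (oprob P ([set w | e / 4 < `|mu (nn a.+1) A w|] `|`
     [set w | e / 4 < `|mu (nn a) A w - mu (nn a.+1) A w|]))).
    apply: le_oprob => w /=; set x := mu _ _ _; set y := mu _ _ _ => hw.
    have [h1|h1] := ltP (e / 4) `|y|; [by left|right].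
    by have := ler_normD y (x - y); rewrite addrC subrK; lra.
  by apply: le_trans (oprobU _ _ _) _; apply: lerD => //; exact: hn0.
lra.
Qed.

End integral_uniqueness.

Section convergence.
Context (R : realType) (disp : measure_display) (T : measurableType disp).
Variable P : probability T R.
Variables (X : nat -> T -> R) (Y : T -> R).
Hypotheses (mX : forall n, measurable_fun setT (X n)) (mY : measurable_fun setT Y).

Let mXY (e : R) n : measurable [set w | e < `|X n w - Y w|].
Proof. by apply: measurable_norm_gt; exact: measurable_funB. Qed.

Lemma cvg_in_prob_oprob : cvg_in_prob P X Y <-> (forall e p : R, 0 < e -> 0 < p ->
  exists n0, forall n, (n0 <= n)%N -> oprob P [set w | e < `|X n w - Y w|] <= p).
Proof.
split=> [h e p e0 p0|h e e0].
  have /fine_cvgP[_ /cvgrPdist_le /(_ _ p0)[n0 _ hn0]] := h e e0.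
  exists n0 => n nn; have := hn0 n nn; rewrite /= sub0r normrN oprobE// ger0_norm//.
  exact: fine_ge0.
apply/fine_cvgP; split; first by apply: nearW => n; exact: fin_prob.
apply/cvgrPdist_le => p p0; have [n0 hn0] := h e p e0 p0.
exists n0 => // n /= nn; rewrite sub0r normrN ger0_norm ?fine_ge0//.
by rewrite -oprobE//; exact: hn0.
Qed.

End convergence.

(** * The functional as a version of every integral *)

Section integral_of_test_functions.
Context (R : realType) (disp : measure_display) (T : measurableType disp).
Variable P : probability T R.
Context (d : nat).
Local Notation E := 'rV[R]_d.
Local Notation bmeas A := (@measurable _ (borelType E) A).
Variables (O : set E) (M : R -> set E -> {RV P >-> R}) (gamma Sigma : set E -> R)
  (nu : {measure set (borelType E * measurableTypeR R) -> \bar R}).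
Hypotheses (oO : open O) (LM : levy_valued_random_measure O M)
  (ch : characteristics O M gamma Sigma nu).
Variable f : testfun O.

Let approx (t : R) (A : set E) (n : nat) : T -> R := lint (M t) (lrestr A (expansion f n)).

Lemma approx_cvg t A (e p : R) : 0 <= t -> bmeas A -> 0 < e -> 0 < p ->
  exists n0, forall n, (n0 <= n)%N ->
  oprob P [set w | e < `|approx t A n w - canonical_integral M oO f t A w|] <= p.
Proof.
move=> t0 mA; apply: ae_cvg_oprob.
- by move=> n; exact: lint_measurable.
- exact: measurable_funPT.
- exact: cvg_lint_expansion.
Qed.

Lemma canonical_is_M_integral : is_M_integral O M gamma Sigma nu f (canonical_integral M oO f).
Proof.
split.
  move=> mO B mB; apply: measurableI => //.
  apply: continuous_borel; first by have [] := testfun_smooth f [::].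
  by rewrite borel_measurableE.
have /choice[g hg] n := leval_simple_fun (exh_Bb O _) (@expansion_sub _ _ _ f n).
exists g; split.
  exists set0, measurable0; split; first exact: control_measure0 ch.
  by move=> x Ox _; under eq_fun do rewrite hg; exact: cvg_expansion.
move=> A t mA AO t0; apply/cvg_in_prob_oprob.
- move=> n; rewrite (_ : sf_integral M t A (g n) = lint (M t) (lrestr A (sf_list (g n)))).
    exact: lint_measurable.
  by apply/funext => w; rewrite lint_sf_list.
- exact: measurable_funPT.
have same : {ae P, forall w, forall n, sf_integral M t A (g n) w = approx t A n w}.
  apply: ae_foralln => n.
  have bF : Bb O (exh O (supp_bound f).+1 `|` seqU (sf_list (g n)) snd).
    by apply: BbU; [exact: exh_Bb|apply: Bb_seqU => q; exact: sf_list_Bb].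
  have := @lint_eq _ _ _ _ P (M t) _ _ (LM.1 t t0) bF (lrestr A (sf_list (g n))) (lrestr A
    (expansion f n)).
  have h1 q : q \in lrestr A (sf_list (g n)) -> bmeas q.2 /\ q.2 `<=`
    exh O (supp_bound f).+1 `|` seqU (sf_list (g n)) snd.
    move=> /mapP[q' q's ->] /=; split; last by move=> x [_ xq]; right; exists q'.
    by apply: measurableI => //; exact: Bb_meas (sf_list_Bb q's).
  have h2 q : q \in lrestr A (expansion f n) -> bmeas q.2 /\ q.2 `<=`
    exh O (supp_bound f).+1 `|` seqU (sf_list (g n)) snd.
    move=> /mapP[q' /expansion_sub[mq qF] ->] /=; split; first exact: measurableI.
    by move=> x [_ /qF]; left.
  move=> /(_ h1 h2) h; apply: filterS (h _) => [w|y].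
    by rewrite lint_sf_list.
  by rewrite !leval_restr leval_sf_list hg.
move=> e p e0 p0; have [n0 hn0] := approx_cvg t0 mA e0 p0.
exists n0 => n nn; apply: le_trans (hn0 n nn); apply: le_oprob_ae.
by apply: filterS same => w hw /=; rewrite hw.
Qed.

(** The difference of the given approximation and the expansion tends to 0 off [N], and its
    integrals converge in probability over every Borel subset of [O]; [lint_cvg0] identifies the
    limit over [O] as 0. *)
Lemma M_integral_unique J : is_M_integral O M gamma Sigma nu f J ->
  forall t, 0 <= t -> {ae P, forall w, functional M oO O t w f = J t O w}.
Proof.
move=> [_ [g [[N [mN [N0 cvN]]] cvg]]] t t0.
pose k n := sf_list (g n) ++ lscale (-1) (expansion f n).
have muE n A w : lint (M t) (lrestr A (k n)) w = sf_integral M t A (g n) w - approx t A n w.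
  rewrite /lrestr /k map_cat lint_cat lint_sf_list /lscale -map_comp.
  by rewrite /approx /lint !big_map -sumrN; congr (_ + _); apply: eq_bigr => q _ /=;
    rewrite mulN1r mulNr.
have mS A n : measurable_fun setT (sf_integral M t A (g n)).
  rewrite (_ : sf_integral M t A (g n) = lint (M t) (lrestr A (sf_list (g n)))).
    exact: lint_measurable.
  by apply/funext => w; rewrite lint_sf_list.
have cvS A : bmeas A -> A `<=` O -> forall e p : R, 0 < e -> 0 < p ->
  exists n0, forall n, (n0 <= n)%N ->
    oprob P [set w | e < `|sf_integral M t A (g n) w - J t A w|] <= p.
  by move=> mA AO; apply/cvg_in_prob_oprob; [exact: mS|exact: measurable_funPT|exact: cvg].
have bk n q : q \in k n -> Bb O q.2.
  rewrite mem_cat => /orP[|/mapP[q' /expansion_sub[mq qF] ->] /=]; first exact: sf_list_Bb.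
  exact: Bb_sub (exh_Bb O _) mq qF.
have null A : Bb O A -> A `<=` N -> {ae P, forall w, M t A w = 0}.
  by move=> bA AN; apply: (levy_rm_null LM bA) t0; exact: control_null ch N mN N0 A bA AN.
have ck x : O x -> ~ N x -> leval (k n) x @[n --> \oo] --> 0.
  move=> Ox Nx; rewrite (_ : (fun n => _) = (fun n =>
    sf_eval (g n) x - leval (expansion f n) x)); last first.
    by apply/funext => n; rewrite leval_cat leval_scale leval_sf_list mulN1r.
  by rewrite -(subrr (f x)); apply: cvgB; [exact: cvN|exact: cvg_expansion].
have cau A : bmeas A -> A `<=` O -> forall e p : R, 0 < e -> 0 < p ->
    exists n0, forall n n', (n0 <= n)%N -> (n0 <= n')%N ->
    oprob P [set w | e < `|lint (M t) (lrestr A (k n)) w - lint (M t) (lrestr A (k n')) w|]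
      <= p.
  move=> mA AO e p e0 p0; have e4 : 0 < e / 4 by rewrite divr_gt0.
  have p4 : 0 < p / 4 by rewrite divr_gt0.
  have [n1 h1] := cvS A mA AO _ _ e4 p4; have [n2 h2] := approx_cvg t0 mA e4 p4.
  exists (maxn n1 n2) => n n'; rewrite !geq_max => /andP[n1n n2n] /andP[n1n' n2n'].
  have -> : p = (p / 4 + p / 4) + (p / 4 + p / 4) by field.
  apply: le_trans (_ : _ <= oprob P (([set w | e / 4 < `|sf_integral M t A (g n) w - J t A
    w|] `|`
    [set w | e / 4 < `|sf_integral M t A (g n') w - J t A w|]) `|`
    ([set w | e / 4 < `|approx t A n w - canonical_integral M oO f t A w|] `|`
    [set w | e / 4 < `|approx t A n' w - canonical_integral M oO f t A w|]))) _; last first.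
    by do ![apply: le_trans (oprobU _ _ _) _; apply: lerD];
      [exact: h1|exact: h1|exact: h2|exact: h2].
  apply: le_oprob => w /=; rewrite !muE.
  set a := sf_integral _ _ _ _ _; set b := approx _ _ _ _; set a' := sf_integral _ _ _ _ _.
  set b' := approx _ _ _ _; set j := J t A w; set c := canonical_integral _ _ _ _ _ _ => hw.
  have [z1|z1] := ltP (e / 4) `|a - j|; first by left; left.
  have [z2|z2] := ltP (e / 4) `|a' - j|; first by left; right.
  have [z3|z3] := ltP (e / 4) `|b - c|; first by right; left.
  right; right; move: hw; have -> : a - b - (a' - b') =
    ((a - j) - (a' - j)) - ((b - c) - (b' - c)) by ring.
  have := ler_normB ((a - j) - (a' - j)) ((b - c) - (b' - c)).
  have := ler_normB (a - j) (a' - j); have := ler_normB (b - c) (b' - c); rewrite /=; lra.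
have mO : bmeas O by exact: bmeas_open.
have key : {ae P, forall w, forall n : nat, `|canonical_integral M oO f t O w - J t O w| <=
  n.+1%:R^-1}.
  apply: ae_foralln => n; apply: ae_oprob; apply/eqP; rewrite eq_le oprob_ge0 andbT.
  apply/ler_addgt0Pr => p p0; rewrite add0r.
  set e : R := n.+1%:R^-1; have e3 : 0 < e / 3 by rewrite divr_gt0// invr_gt0.
  have p3 : 0 < p / 3 by rewrite divr_gt0.
  have [n1 h1] := cvS O mO (fun _ h => h) _ _ e3 p3; have [n2 h2] := approx_cvg t0 mO e3 p3.
  have [n3 h3] := lint_cvg0 oO (LM.1 t t0) bk mN null ck cau e3 p3.
  pose r := maxn n1 (maxn n2 n3).
  have -> : p = p / 3 + p / 3 + p / 3 by field.
  apply: le_trans (_ : _ <= oprob P ([set w | e / 3 < `|sf_integral M t O (g r) w - J t O w|]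
    `|`
    [set w | e / 3 < `|approx t O r w - canonical_integral M oO f t O w|] `|`
    [set w | e / 3 < `|lint (M t) (lrestr O (k r)) w|])) _; last first.
    do ![apply: le_trans (oprobU _ _ _) _; apply: lerD]; [apply: h1|apply: h2|apply: h3].
    - exact: leq_maxl.
    - by rewrite /r (leq_trans (leq_maxl n2 n3))// leq_maxr.
    - by rewrite /r (leq_trans (leq_maxr n2 n3))// leq_maxr.
  apply: le_oprob => w /= /negP; rewrite -ltNge muE.
  set a := sf_integral _ _ _ _ _; set b := approx _ _ _ _; set j := J t O w.
  set c := canonical_integral _ _ _ _ _ _ => hw.
  have [z1|z1] := ltP (e / 3) `|a - j|; first by left; left.
  have [z2|z2] := ltP (e / 3) `|b - c|; first by left; right.
  right; move: hw; have -> : c - j = (a - j) - (b - c) - (a - b) by ring.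
  have := ler_normB ((a - j) - (b - c)) (a - b); have := ler_normB (a - j) (b - c);
    rewrite /=; lra.
apply: filterS key => w hw; apply/eqP; rewrite -subr_eq0 -normr_eq0 eq_le normr_ge0 andbT.
apply/ler_addgt0Pr => e e0; rewrite add0r.
apply: le_trans (hw (Num.trunc e^-1)) _; rewrite invf_ple ?posrE//.
exact/ltW/archimedean.Num.Theory.truncnS_gt.
Qed.

End integral_of_test_functions.

(** Integrability is asserted separately, so that the equality with every version [J] of the
    integral is not vacuous. The exceptional set may depend on [f] and [t], as equality in L^0
    requires. *)
Theorem theorem2p9 (R : realType) (disp : measure_display)
    (T : measurableType disp) (P : probability T R) (d : nat)
    (O : set 'rV[R]_d) (M : R -> set 'rV[R]_d -> {RV P >-> R})
    (gamma Sigma : set 'rV[R]_d -> R)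
    (nu : {measure set (borelType 'rV[R]_d * measurableTypeR R) -> \bar R}) :
  open O ->
  levy_valued_random_measure O M ->
  characteristics O M gamma Sigma nu ->
  exists Y : R -> T -> strong_dual (testfun O),
    levy_process P Y /\
    forall f : testfun O,
      M_integrable O M gamma Sigma nu f /\
      forall J : R -> set 'rV[R]_d -> {RV P >-> R},
        is_M_integral O M gamma Sigma nu f J ->
        forall t : R, 0 <= t -> {ae P, forall w, Y t w f = J t O w}.
Proof.
move=> oO LM ch; exists (functional M oO O); split; first exact: functional_levy.
move=> f; split; first by exists (canonical_integral M oO f); exact: canonical_is_M_integral.
by move=> J hJ t t0; exact: M_integral_unique hJ t t0.
Qed.
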